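(* Let $F$ be a number field with $r_1$ real and $r_2$ complex infinite primes, and let $w$ be the number of roots of unity in $F$. For $s\in\mathbb{C}$ with $\mathrm{Re}(s)>1$ the integral $$Z_F(s)=\int_{\mathrm{Div}(F)}e(D)\,N(D)^{-s}\,dD$$ converges absolutely and $$Z_F(s)=\left(\tfrac12\pi^{-s/2}\Gamma(s/2)\right)^{r_1}\left((2\pi)^{-s}\Gamma(s)\right)^{r_2}\sum_{0\ne J\subset O_F}N(J)^{-s},$$ where the sum runs over the nonzero ideals $J$ of $O_F$ and $N(J)=\#(O_F/J)$. Moreover, for such $s$, $$Z_F(s)=\frac1w\int_{\mathrm{Pic}(F)}\left(k^0[D]-1\right)N[D]^{-s}\,d[D].$$
   Context: Let $F$ be a number field with ring of integers $O_F$. The infinite primes $\sigma$ of $F$ are the $r_1$ real embeddings together with one chosen embedding from each of the $r_2$ pairs of complex conjugate embeddings. An Arakelov divisor of $F$ is a formal finite sum $D=\sum_P x_P P+\sum_\sigma x_\sigma\sigma$, with $P$ running over the nonzero prime ideals of $O_F$, $\sigma$ over the infinite primes, $x_P\in\mathbb{Z}$ (almost all zero) and $x_\sigma\in\mathbb{R}$. They form a group $\mathrm{Div}(F)\cong\bigoplus_P\mathbb{Z}\times\mathbb{R}^{r_1+r_2}$; the measure $dD$ is the product of counting measure on $\bigoplus_P\mathbb{Z}$ and Lebesgue measure on $\mathbb{R}^{r_1+r_2}$. The degree is $\deg(D)=\sum_P \log(\#(O_F/P))\,x_P+\sum_\sigma x_\sigma$ and the norm is $N(D)=e^{\deg(D)}$.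 For $f\in F^*$ the principal Arakelov divisor $(f)$ has $x_P=\mathrm{ord}_P(f)$, $x_\sigma=-\log|\sigma(f)|$ for $\sigma$ real and $x_\sigma=-2\log|\sigma(f)|$ for $\sigma$ complex. $\mathrm{Pic}(F)$ is the quotient of $\mathrm{Div}(F)$ by the (discrete) subgroup of principal divisors, and $d[D]$ is the quotient Haar measure (with counting measure on the subgroup of principal divisors). The fractional ideal associated to $D$ is $I=\prod_P P^{-x_P}$. For $f\in F$ put $$\|f\|_D^2=\sum_{\sigma\text{ real}}|\sigma(f)|^2e^{-2x_\sigma}+\sum_{\sigma\text{ complex}}2|\sigma(f)|^2e^{-x_\sigma}.$$ The effectivity of $D$ is $e(D)=\exp(-\pi\|1\|_D^2)$ if $O_F\subset I$ and $e(D)=0$ otherwise. Put $k^0(D)=\sum_{f\in I}e^{-\pi\|f\|_D^2}$. Both $k^0(D)$ and $N(D)$ depend only on the class $[D]$ of $D$ in $\mathrm{Pic}(F)$ and are then written $k^0[D]$, $N[D]$. *)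

(* Defs.v *)
From HB Require Import structures.
From mathcomp Require Import all_boot all_order all_algebra all_field.
From mathcomp Require Import finmap freeg.
From mathcomp Require Import all_classical all_reals all_analysis.
From mathcomp Require Import measurable_realfun.
From mathcomp Require Export complex.

Set Implicit Arguments.
Unset Strict Implicit.
Unset Printing Implicit Defensive.

Import Order.TTheory GRing.Theory Num.Theory.

Local Open Scope classical_set_scope.
Local Open Scope ring_scope.

Local Notation Re := complex.Re.
Local Notation Im := complex.Im.

(** [lebesgue_tuple R n] is Lebesgue measure on R^n, where R^n is
    [n.-tuple (measurableTypeR R)] with its product sigma-algebra: the measure on
    R^(n+1) is the image of (Lebesgue measure) x (measure on R^n) under
    [(a, v) |-> a :: v]. *)

Section LebesgueTuple.
Variable R : realType.

Definition consT n (p : measurableTypeR R * n.-tuple (measurableTypeR R)) :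
  n.+1.-tuple (measurableTypeR R) := [tuple of p.1 :: p.2].

Fact measurable_consT n : measurable_fun [set: _] (@consT n).
Proof. exact: measurable_cons. Qed.

Section Step.
Variables (n : nat).
Variable m : {sigma_finite_measure set (n.-tuple (measurableTypeR R)) -> \bar R}.

Definition leb_step : set (n.+1.-tuple (measurableTypeR R)) -> \bar R :=
  pushforward (lebesgue_measure \x m)%E (@consT n).

Fact leb_step0 : leb_step set0 = 0%E.
Proof. by rewrite /leb_step /pushforward preimage_set0 measure0. Qed.

Fact leb_step_ge0 A : (0 <= leb_step A)%E.
Proof. exact: (measure_ge0 (lebesgue_measure \x m)%E). Qed.

Fact leb_step_additive : semi_sigma_additive leb_step.
Proof.
have mf A : measurable A -> measurable (@consT n @^-1` A).
  by move=> mA; rewrite -[X in measurable X]setTI; exact: measurable_consT.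
move=> G mG tG mUG; rewrite /leb_step /pushforward preimage_bigcup.
apply: measure_semi_sigma_additive => [i|//|].
- exact: mf.
- apply/trivIsetP => /= i j _ _ ij; rewrite -preimage_setI.
  by move/trivIsetP : tG => /(_ _ _ _ _ ij) ->//; rewrite preimage_set0.
- by rewrite -preimage_bigcup; exact: mf.
Qed.

HB.instance Definition _ := isMeasure.Build _ _ _ leb_step
  leb_step0 leb_step_ge0 leb_step_additive.

Fact leb_step_sigma_finite : sigma_finite setT leb_step.
Proof.
have /sigma_finiteP[A [AT ndA Aoo]] := sigma_finiteT (@lebesgue_measure R).
have /sigma_finiteP[B [BT ndB Boo]] := sigma_finiteT m.
exists (fun k => [set v | A k (thead v) /\ B k [tuple of behead v]]).
  apply/seteqP; split => // v _.
  have [i _ Ai] : (\bigcup_i A i) (thead v) by rewrite -AT.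
  have [j _ Bj] : (\bigcup_i B i) [tuple of behead v] by rewrite -BT.
  exists (maxn i j) => //; split.
  - by move: Ai; exact/subsetPset/ndA/leq_maxl.
  - by move: Bj; exact/subsetPset/ndB/leq_maxr.
move=> k; have [mA Afin] := Aoo k; have [mB Bfin] := Boo k; split.
  apply: measurableI.
  - by rewrite -[X in measurable X]setTI; exact: (measurable_tnth ord0).
  - by rewrite -[X in measurable X]setTI; exact: measurable_behead.
rewrite /leb_step /pushforward (_ : _ @^-1` _ = A k `*` B k).
  by rewrite product_measure1E// lte_mul_pinfty// ge0_fin_numE.
have hdK p : thead (@consT n p) = p.1 by rewrite theadE.
have tlK p : [tuple of behead (@consT n p)] = p.2 by exact: val_inj.
by apply/seteqP; split => -[a v]; rewrite /= hdK tlK.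
Qed.

HB.instance Definition _ := Measure_isSigmaFinite.Build _ _ _ leb_step
  leb_step_sigma_finite.
End Step.

Fixpoint lebesgue_tuple (n : nat) :
    {sigma_finite_measure set (n.-tuple (measurableTypeR R)) -> \bar R} :=
  match n with
  | 0 => \d_([tuple] : 0.-tuple (measurableTypeR R))
  | n'.+1 => leb_step (lebesgue_tuple n')
  end.

End LebesgueTuple.

Section ComplexAnalysis.
Variable R : realType.

Definition normc (z : R[i]) : R := ComplexField.Normc.normc z.

Definition cexp (z : R[i]) : R[i] :=
  Complex (expR (Re z) * cos (Im z)) (expR (Re z) * sin (Im z)).

(** Meaningful for [t > 0] only: [ln t] is [0] for [t <= 0]. *)
Definition cpow (t : R) (z : R[i]) : R[i] := cexp (z * (ln t)%:C%C).

Section Integral.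
Context d (T : measurableType d).

Definition cintegral (mu : {measure set T -> \bar R}) (D : set T)
    (f : T -> R[i]) : R[i] :=
  Complex (Rintegral mu D (fun x => Re (f x)))
          (Rintegral mu D (fun x => Im (f x))).

Definition cintegrable (mu : {measure set T -> \bar R}) (D : set T)
    (f : T -> R[i]) : Prop :=
  [/\ measurable_fun D (fun x => Re (f x)),
      measurable_fun D (fun x => Im (f x)) &
      (\int[mu]_(x in D) (normc (f x))%:E < +oo)%E].
End Integral.

(** Unordered sums over a (possibly infinite) set of indices, meaningful when
    the family is absolutely summable. *)
Definition rsum (T : choiceType) (A : set T) (f : T -> R) : R :=
  fine (\esum_(i in A) (Num.max (f i) 0)%:E)
  - fine (\esum_(i in A) (Num.max (- f i) 0)%:E).

Definition csum (T : choiceType) (A : set T) (f : T -> R[i]) : R[i] :=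
  Complex (rsum A (fun i => Re (f i))) (rsum A (fun i => Im (f i))).

Definition csummable (T : choiceType) (A : set T) (f : T -> R[i]) : Prop :=
  summable A (fun i => (normc (f i))%:E).

(** Euler's integral; only used for [Re z > 0], where it converges. *)
Definition cGamma (z : R[i]) : R[i] :=
  cintegral (@lebesgue_measure R) `]0, +oo[
    (fun t => cpow t (z - 1) * (expR (- t))%:C%C).

End ComplexAnalysis.

(** Ideals of O_F and fractional ideals are subsets of the field [F]. *)
Section Ideals.
Variable F : fieldExtType rat.
Implicit Types (A B J P : set F).

Definition ringOfIntegers : set F := [set x | integralOver (intr : int -> F) x].
Local Notation OF := ringOfIntegers.

Definition is_ideal J : Prop :=
  [/\ J `<=` OF, J 0, forall x y, J x -> J y -> J (x + y) &
      forall a x, OF a -> J x -> J (a * x)].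

Definition nonzero_ideals : set (set F) :=
  [set J | is_ideal J /\ J <> [set 0]].

Definition is_prime_ideal P : Prop :=
  [/\ is_ideal P, ~ P 1 &
      forall x y, OF x -> OF y -> P (x * y) -> P x \/ P y].

Definition nzprime : Type :=
  {P : set F | `[< is_prime_ideal P /\ P <> [set 0] >]}.
HB.instance Definition _ := Choice.on nzprime.

(** [fset_set] of an infinite set is empty, so this would be 0 if O_F / J were
    infinite; that does not happen for [J] nonzero. *)
Definition absnorm J : nat :=
  #|` fset_set [set [set x + y | y in J] | x in OF]|.

Definition idealM A B : set F :=
  [set x | exists (n : nat) (a b : 'I_n -> F),
    [/\ forall i, A (a i), forall i, B (b i) & x = \sum_i a i * b i]].

Definition idealV A : set F := [set x | forall y, A y -> OF (x * y)].

Definition idealX A (z : int) : set F :=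
  match z with
  | Posz n => iter n (idealM A) OF
  | Negz n => iter n.+1 (idealM (idealV A)) OF
  end.

Definition principal_ideal (f : F) : set F := [set f * a | a in OF].

(** The finite part of the divisor group: the free abelian group on the nonzero
    primes, with the discrete sigma-algebra. *)
Definition findiv : Type := {freeg nzprime}.
HB.instance Definition _ := GRing.Zmodule.on findiv.
HB.instance Definition _ := isPointed.Build findiv 0.
HB.instance Definition _ := @isMeasurable.Build default_measure_display
  findiv discrete_measurable discrete_measurable0
  discrete_measurableC discrete_measurableU.

(** [prod_P P ^ x_P]; the divisor [D] has [I = ideal_of (- D.1)]. *)
Definition ideal_of (x : findiv) : set F :=
  \big[idealM/OF]_(P <- dom x) idealX (val P) (coeff P x).

(** [(ord_P(f))_P], the exponents in the prime factorization
    [f O_F = prod_P P ^ ord_P(f)] of the principal fractional ideal of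
    [f <> 0]. *)
Definition ords (f : F) : findiv :=
  xget 0 [set x : findiv | ideal_of x = principal_ideal f].

Definition num_roots_of_unity : nat :=
  #|` fset_set [set x : F | exists2 n : nat, (0 < n)%N & x ^+ n = 1]|.

End Ideals.

Arguments ringOfIntegers F : clear implicits.
Arguments nonzero_ideals F : clear implicits.

(** An enumeration of the real embeddings, and of a system of representatives of
    the pairs of complex conjugate nonreal embeddings. *)
Record infinitePrimes (R : realType) (F : fieldExtType rat) (r1 r2 : nat) :=
  InfinitePrimes {
    realEmb : 'I_r1 -> {rmorphism F -> R};
    cplxEmb : 'I_r2 -> {rmorphism F -> R[i]};
    realEmbP : forall phi : {rmorphism F -> R},
      exists! i, phi =1 realEmb i;
    cplxEmb_nonreal : forall j, exists x, Im (cplxEmb j x) != 0;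
    cplxEmbP : forall psi : {rmorphism F -> R[i]},
      (exists x, Im (psi x) != 0) ->
      exists! j, psi =1 cplxEmb j \/ psi =1 (fun x => conjc (cplxEmb j x))
  }.

Section Arakelov.
Variables (R : realType) (F : fieldExtType rat) (r1 r2 : nat).
Variable S : infinitePrimes R F r1 r2.

(** Coordinates at infinity: first the [r1] real primes, then the [r2] complex
    ones. *)
Definition arDiv : Type :=
  (findiv F * (r1 + r2).-tuple (measurableTypeR R))%type.
HB.instance Definition _ := Measurable.on arDiv.

Implicit Types D : arDiv.

Definition atReal D (i : 'I_r1) : R := tnth D.2 (lshift r2 i).
Definition atCplx D (j : 'I_r2) : R := tnth D.2 (rshift r1 j).

Definition divD D D' : arDiv :=
  (D.1 + D'.1, [tuple (tnth D.2 k : R) + (tnth D'.2 k : R) | k < r1 + r2]).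

Definition dDiv : {measure set arDiv -> \bar R} :=
  (@counting (findiv F) R \x lebesgue_tuple R (r1 + r2))%E.

Definition divdeg D : R :=
  \sum_(P <- dom D.1) ln (absnorm (val P))%:R * (coeff P D.1)%:~R
  + \sum_(k < r1 + r2) (tnth D.2 k : R).

Definition divnorm D : R := expR (divdeg D).

Definition divideal D : set F := ideal_of (- D.1).

Definition sqnorm D (f : F) : R :=
  \sum_(i < r1) `|realEmb S i f| ^+ 2 * expR (- 2 * atReal D i)
  + \sum_(j < r2) 2 * normc (cplxEmb S j f) ^+ 2 * expR (- atCplx D j).

Definition effectivity D : R :=
  if `[< ringOfIntegers F `<=` divideal D >]
  then expR (- pi * sqnorm D 1) else 0.

Definition k0 D : R :=
  fine (\esum_(f in divideal D) (expR (- pi * sqnorm D f))%:E).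

Definition zeta_integrand (s : R[i]) (D : arDiv) : R[i] :=
  (effectivity D)%:C%C * cpow (divnorm D) (- s).

Definition zetaF (s : R[i]) : R[i] := cintegral dDiv setT (zeta_integrand s).

(** The principal divisor [(f)]; meaningful for [f <> 0] only. *)
Definition princ (f : F) : arDiv :=
  (ords f,
   [tuple match fintype.split k with
          | inl i => - ln `|realEmb S i f|
          | inr j => - (2 * ln (normc (cplxEmb S j f)))
          end | k < r1 + r2]).

(** Pic(F) is the set of cosets of the subgroup of principal divisors, with the
    quotient sigma-algebra. *)
Definition princ_coset D : set arDiv :=
  [set divD D (princ f) | f in [set f : F | f != 0]].

Definition Pic : Type := {c : set arDiv | `[< exists D, c = princ_coset D >]}.
HB.instance Definition _ := Choice.on Pic.

Fact pic_class_subproof D : `[< exists D', princ_coset D = princ_coset D' >].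
Proof. by apply/asboolP; exists D. Qed.

Definition pic_class D : Pic := exist _ (princ_coset D) (pic_class_subproof D).

HB.instance Definition _ := isPointed.Build Pic (pic_class point).

Definition pic_measurable : set (set Pic) :=
  [set A | measurable (pic_class @^-1` A)].

Fact pic_measurable0 : pic_measurable set0.
Proof. by rewrite /pic_measurable/= preimage_set0. Qed.

Fact pic_measurableC A : pic_measurable A -> pic_measurable (~` A).
Proof.
by move=> mA; rewrite /pic_measurable/= preimage_setC; exact: measurableC.
Qed.

Fact pic_measurableU (A : (set Pic)^nat) :
  (forall i, pic_measurable (A i)) -> pic_measurable (\bigcup_i A i).
Proof.
move=> mA; rewrite /pic_measurable/= preimage_bigcup.
exact: bigcupT_measurable.
Qed.

HB.instance Definition _ := @isMeasurable.Build default_measure_display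
  Pic pic_measurable pic_measurable0 pic_measurableC pic_measurableU.

(** The quotient Haar measure [d[D]] on [Div(F) / {principal divisors}], with
    counting measure on the subgroup, is the measure determined by Weil's formula
      int_{Div} phi(D) dD = int_{Pic} (sum_{h principal} phi(D + h)) d[D];
    the inner sum runs over the elements of the coset [[D]]. *)
Definition is_quotient_measure (mu : {measure set Pic -> \bar R}) : Prop :=
  forall phi : arDiv -> \bar R,
    (forall D, (0 <= phi D)%E) -> measurable_fun setT phi ->
    (\int[dDiv]_D phi D = \int[mu]_c (\esum_(D in val c) phi D))%E.

(** Some divisor in the class; [k^0] and [N] do not depend on the choice. *)
Definition pic_repr (c : Pic) : arDiv := xget point (val c).

Definition pic_k0 (c : Pic) : R := k0 (pic_repr c).
Definition pic_norm (c : Pic) : R := divnorm (pic_repr c).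

Definition pic_integrand (s : R[i]) (c : Pic) : R[i] :=
  (pic_k0 c - 1)%:C%C * cpow (pic_norm c) (- s).

End Arakelov.

Arguments pic_integrand {R F r1 r2} S s c.

(* Main.v *)
Require Import Defs.
From HB Require Import structures.
From mathcomp Require Import all_boot all_order all_algebra all_field.
From mathcomp Require Import finmap freeg.
From mathcomp Require Import all_classical all_reals all_analysis.
From mathcomp Require Import measurable_realfun.
From mathcomp Require Import complex ring lra zify.
Set Implicit Arguments.
Unset Strict Implicit.
Unset Printing Implicit Defensive.
Import Order.TTheory GRing.Theory Num.Theory.
Local Open Scope classical_set_scope.
Local Open Scope ring_scope.
Import numFieldNormedType.Exports.

(** The effectivity factors as an indicator of the effective finite divisors,
    i.e. (by unique factorization) of the nonzero ideals of O_F, times a product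
    of one-variable functions of the coordinates at infinity. By Fubini the
    integral over Div(F) is the sum over ideals times one integral over the real
    line for each infinite prime, and [t = c exp (- a v)] turns these into Gamma
    integrals.  The sum over ideals converges because at most [F : Q] primes lie
    above each rational prime.

    For Pic(F), Weil's formula and [e (D + (f)) = exp (- pi ||f||_D^2)] for [f]
    in the ideal of [D], [0] for other [f <> 0], give the integral over Pic(F)
    of [w^-1 * sum_(f <> 0 in I) exp (- pi ||f||_D^2)] [N(D)^(-s)]: by the
    product formula [N] is constant on cosets, and [f |-> D + (f)] is [w]-to-one,
    since an element of O_F whose absolute values are all 1 is a root of unity. *)

(** * Index of subgroups *)

(** Finite index carries the arithmetic. Ideals are bare subsets of F, so a norm is an index,
    Noetherian induction is induction on the norm, and integrality, maximality of primes and
    finiteness of the roots of unity come from the pigeonhole principle modulo a subgroup of finite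
    index. Finiteness itself rests on a family of n integral elements with nonzero discriminant, n
    being the number of embeddings in C; the same family gives the norm of f O_F as the product of
    all absolute values of f, which is the product formula. Two obstacles shape the integral over
    Pic(F). Weil's formula is given for nonnegative functions only, so it is applied to nonnegative
    functionals of the complex integrand: its modulus and the positive and negative parts of its
    real and imaginary parts. And k^0 is [fine] of an extended sum, which reads an infinite theta
    series as 0; that series is therefore shown beforehand to be finite almost everywhere, by Weil's
    formula for the modulus. *)

Section Index.
Variable V : zmodType.
Implicit Types A B C : set V.

Definition is_subgroup B := B 0 /\ forall x y, B x -> B y -> B (x - y).

Lemma subgroupN B x : is_subgroup B -> B x -> B (- x).
Proof. by move=> [B0 BB] Bx; rewrite -sub0r; exact: BB. Qed.

Lemma subgroupD B x y : is_subgroup B -> B x -> B y -> B (x + y).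
Proof.
by move=> sB Bx By; rewrite -(opprK y); apply: sB.2 => //; exact: subgroupN.
Qed.

Lemma subgroupDl B x y : is_subgroup B -> B x -> B (x + y) -> B y.
Proof. by move=> sB Bx Bxy; rewrite -(addKr x y) addrC; exact: sB.2. Qed.

(** Given by a system of representatives, because [A] and [B] are mere subsets. [B] may stick out of
    [A]: for subgroups, [n] is then the index of the intersection in [A]. *)
Definition has_index A B n := exists r : 'I_n -> V,
  [/\ forall i, A (r i), forall a, A a -> exists i, B (a - r i)
    & forall i j, B (r i - r j) -> i = j].

Lemma has_index_fin A B (T : finType) (r : T -> V) :
  (forall i, A (r i)) -> (forall a, A a -> exists i, B (a - r i)) ->
  (forall i j, B (r i - r j) -> i = j) -> has_index A B #|T|.
Proof.
move=> h1 h2 h3; exists (r \o enum_val); split => [i|a /h2[i ai]|i j /h3] /=.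
- exact: h1.
- by exists (enum_rank i); rewrite /= enum_rankK.
- exact: enum_val_inj.
Qed.

Lemma has_index_inj A B n m (s : 'I_m -> V) : is_subgroup B ->
  has_index A B n -> (forall i, A (s i)) ->
  (forall i j, B (s i - s j) -> i = j) -> (m <= n)%N.
Proof.
move=> sB [r [_ Ar _]] As sP.
have /choice[f fP] : forall i, exists j, B (s i - r j) by move=> i; exact: Ar.
rewrite -[m]card_ord -[n]card_ord; apply: (@leq_card _ _ f) => i j fij.
apply: sP; have := sB.2 _ _ (fP i) (fP j); rewrite fij.
by rewrite opprB addrA subrK.
Qed.

Lemma has_index_uniq A B n m : is_subgroup B ->
  has_index A B n -> has_index A B m -> n = m.
Proof.
move=> sB hn hm; apply/eqP; rewrite eqn_leq; apply/andP; split.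
- by have [r [Ar _ rP]] := hn; exact: (has_index_inj sB hm Ar rP).
- by have [r [Ar _ rP]] := hm; exact: (has_index_inj sB hn Ar rP).
Qed.

Lemma has_index_pigeon A B n (u : nat -> V) : is_subgroup B ->
  has_index A B n -> (forall k, A (u k)) ->
  exists i j, (i < j)%N /\ B (u j - u i).
Proof.
move=> sB hn Au; apply: contrapT => H.
suff : (n.+1 <= n)%N by rewrite ltnn.
apply: (@has_index_inj A B n n.+1 (fun i => u i) sB hn) => // i j Bij.
apply: val_inj; case: (ltngtP i j) => // ij; exfalso; apply: H.
- by exists i, j; split => //; rewrite -opprB; exact: subgroupN.
- by exists j, i.
Qed.

(** A family of pairwise incongruent elements injects into [T], so its size is bounded; a family of
    maximal size represents every class, since a missed element could be added to it. *)
Lemma has_index_map A B (T : finType) (h : V -> T) : is_subgroup B ->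
  (forall a a', A a -> A a' -> h a = h a' -> B (a - a')) ->
  exists n, has_index A B n.
Proof.
move=> sB hP.
pose P n := `[< exists r : 'I_n -> V, (forall i, A (r i)) /\
  forall i j, B (r i - r j) -> i = j >].
have P0 : exists n, P n.
  by exists 0%N; apply/asboolP; exists (fun=> 0); split => -[].
have Pub n : P n -> (n <= #|T|)%N.
  move=> /asboolP[r [Ar rP]]; rewrite -[n]card_ord.
  apply: (@leq_card _ _ (h \o r)) => i j hij; apply: rP.
  exact: hP.
case: (ex_maxnP P0 Pub) => n /asboolP[r [Ar rP]] nmax.
exists n, r; split => // a Aa; apply: contrapT => /forallNP aP.
suff /nmax : P n.+1 by rewrite ltnn.
apply/asboolP; exists (fun i => oapp r a (unlift ord_max i)); split.
  by move=> i; case: unliftP => [j _|_] /=.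
move=> i j; case: unliftP => [i' ->|->]; case: unliftP => [j' ->|->] //=.
- by move/rP => ->.
- by rewrite -opprB => /(subgroupN sB); rewrite opprK => /aP.
- by move/aP.
Qed.

(** The class of an element modulo [B] is one of finitely many and determines its class modulo the
    larger [B']. The label [None] is for elements outside [A']. *)
Lemma has_index_restrict A B A' B' n : is_subgroup B -> is_subgroup B' ->
  has_index A B n -> A' `<=` A -> B `<=` B' -> exists m, has_index A' B' m.
Proof.
move=> sB sB' [r [_ rA _]] A'A BB'.
have /choice[h hP] : forall a, exists i : option 'I_n, A' a ->
    exists2 j, i = Some j & B (a - r j).
  move=> a; have [A'a|nA] := pselect (A' a); last by exists None.
  by have [j Bj] := rA _ (A'A _ A'a); exists (Some j) => _; exists j.
apply: (has_index_map (h := h) sB') => a a' Aa Aa'.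
have [i -> Bi] := hP _ Aa; have [j -> Bj] := hP _ Aa' => -[ij].
apply: BB'; have := sB.2 _ _ Bi Bj; rewrite ij.
by rewrite opprB addrA subrK.
Qed.

Lemma has_index_tower A B C m n : is_subgroup A -> is_subgroup B ->
  is_subgroup C -> B `<=` A -> C `<=` B ->
  has_index A B m -> has_index B C n -> has_index A C (m * n).
Proof.
move=> sA sB sC BA CB [r [rA rc ri]] [s [sBs sc si]].
have -> : (m * n)%N = #|{: 'I_m * 'I_n}| by rewrite card_prod !card_ord.
apply: (@has_index_fin A C _ (fun p => r p.1 + s p.2)) => [[i j]|a Aa|[i j] [i' j']] /=.
- by apply: subgroupD => //; exact/BA/sBs.
- have [i Bi] := rc _ Aa; have [j Cj] := sc _ Bi.
  by exists (i, j) => /=; rewrite opprD addrA.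
- move=> H.
  have e : r i + s j - (r i' + s j') = (s j - s j') + (r i - r i').
    by rewrite opprD addrACA addrC.
  have : B (r i - r i').
    apply: (@subgroupDl _ (s j - s j')) => //; first exact: sB.2.
    by rewrite -e; exact: CB.
  by move/ri => ii'; move: H; rewrite e ii' subrr addr0 => /si ->.
Qed.

Lemma has_index_gt0 A B n : A 0 -> has_index A B n -> (0 < n)%N.
Proof. by move=> A0 [r [_ /(_ _ A0)[[[|k] //= lt] _] _]]; case: n lt r. Qed.

Lemma has_index_refl A : is_subgroup A -> has_index A A 1.
Proof.
move=> sA; exists (fun=> 0); split => [i|a Aa|i j _].
- exact: sA.1.
- by exists ord0; rewrite subr0.
- by rewrite !ord1.
Qed.

Lemma has_index1 A B : is_subgroup B -> A 0 -> has_index A B 1 -> A `<=` B.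
Proof.
move=> sB A0 [r [_ rc _]] a Aa; case: (rc _ Aa) => i; case: (rc _ A0) => j.
rewrite !ord1 sub0r => /(subgroupN sB); rewrite opprK => Br Ba.
by rewrite -(subrK (r ord0) a); exact: subgroupD.
Qed.

End Index.

Lemma has_index_image (V W : zmodType) (f : V -> W) (A B : set V) n :
  {morph f : x y / x - y} -> injective f ->
  has_index A B n -> has_index (f @` A) (f @` B) n.
Proof.
move=> fB fi [r [rA rc ri]]; exists (f \o r); split => [i|_ [a Aa <-]|i j] /=.
- by exists (r i) => //; exact: rA.
- by have [i Bi] := rc _ Aa; exists i; rewrite -fB; exists (a - r i).
- by rewrite -fB => -[b Bb /fi bE]; apply: ri; rewrite -bE.
Qed.

Lemma has_index_row_multiples n (d : 'I_n -> int) : (forall i, d i != 0) ->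
  has_index [set: 'rV[int]_n] [set v : 'rV[int]_n | forall i, (d i %| v ord0 i)%Z]
    (\prod_i `|d i|%N).
Proof.
move=> d0.
have -> : (\prod_i `|d i|)%N = #|{dffun forall i : 'I_n, 'I_(`|d i|)}|.
  by rewrite card_dep_ffun foldrE big_image/=; apply: eq_bigr => i _; rewrite card_ord.
apply: (@has_index_fin _ _ _ _
  (fun h : {dffun forall i : 'I_n, 'I_(`|d i|)} => \row_i (h i : nat)%:Z)) => //.
- move=> v _.
  have lt i : (`|(v ord0 i %% d i)%Z| < `|d i|)%N.
    by rewrite -ltz_nat gez0_abs ?modz_ge0// ltz_mod.
  exists [ffun i => Ordinal (lt i)] => i; rewrite !mxE ffunE /=.
  rewrite gez0_abs ?modz_ge0//.
  by rewrite {1}(divz_eq (v ord0 i) (d i)) addrK dvdz_mull.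
- move=> g h gh; apply/ffunP => i; apply: val_inj => /=.
  have /= := gh i; rewrite !mxE -eqz_mod_dvd => /eqP.
  rewrite -[in X in X -> _]modz_abs -[in X in _ = X -> _]modz_abs.
  by rewrite !modz_nat !modn_small ?ltn_ord// => -[].
Qed.

(** Smith form M = L D R with L and R unimodular: right multiplication by R is an automorphism of
    Z^n that carries the row lattice of D, whose index is a count of residues, onto that of M. *)
Lemma has_index_rowspace n (M : 'M[int]_n) : \det M != 0 ->
  has_index [set: 'rV[int]_n] [set v *m M | v in [set: 'rV[int]_n]] `|\det M|%N.
Proof.
have [L uL [R uR [d _ ME]]] := int_Smith_normal_form M.
pose D := \row_(i < n) d`_i.
have DE : \matrix_(i, j) (d`_i *+ (i == j :> nat)) = diag_mx D.
  by apply/matrixP => i j; rewrite !mxE.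
rewrite {}DE in ME.
have absdet (X : 'M[int]_n) : X \in unitmx -> `|\det X|%N = 1%N.
  by rewrite unitmxE => /orP[] /eqP ->.
rewrite {1}ME !det_mulmx det_diag => det0.
have d0 i : D ord0 i != 0.
  by apply: contraNneq det0 => Di; rewrite (bigD1 i)//= Di !(mul0r, mulr0).
have -> : `|\det M|%N = (\prod_i `|D ord0 i|)%N.
  rewrite ME !det_mulmx det_diag !abszM !absdet// mul1n muln1.
  by apply: (big_rec2 (fun (x : int) (y : nat) => `|x|%N = y)) => // i x y _ <-; rewrite abszM.
have := has_index_row_multiples d0.
move=> /(has_index_image (f := mulmxr R)) => /(_ (fun x y => mulmxBl x y R)).
have Ri : injective (@mulmxr _ 1 _ _ R).
  by move=> x y /(congr1 (mulmx^~ (invmx R))); rewrite /= !mulmxK.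
move=> /(_ Ri).
have -> : mulmxr R @` [set: 'rV[int]_n] = setT.
  apply/seteqP; split => // v _; exists (v *m invmx R) => //=.
  by rewrite mulmxKV.
congr (has_index _ _ _); apply/seteqP; split => v /=.
- move=> [w dw <-]; exists ((\row_i (w ord0 i %/ D ord0 i)%Z) *m invmx L) => //.
  rewrite ME !mulmxA mulmxKV//; congr (_ *m _); apply/rowP => i.
  rewrite mul_mx_diag !mxE divzK//; have := dw i; by rewrite mxE.
- move=> [w _ <-]; exists (w *m L *m diag_mx D); last by rewrite ME !mulmxA.
  by move=> i; rewrite mul_mx_diag mxE dvdz_mull.
Qed.

(** * Embeddings and the ring of integers *)

Section Embeddings.
Variables (R : realType) (F : fieldExtType rat) (r1 r2 : nat).
Variable S : infinitePrimes R F r1 r2.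

(** All embeddings of F in C: each complex prime contributes two conjugate indices. Its cardinal
    plays the role of [F : Q]. *)
Definition emb_index : finType := ('I_r1 + ('I_r2 + 'I_r2))%type.

Definition emb (t : emb_index) : {rmorphism F -> R[i]} :=
  match t with
  | inl i => real_complex R \o realEmb S i
  | inr (inl j) => cplxEmb S j
  | inr (inr j) => @conjc R \o cplxEmb S j
  end.

Lemma emb_surj (psi : {rmorphism F -> R[i]}) : exists t, psi =1 emb t.
Proof.
have [nr|/forallNP re] := pselect (exists x, complex.Im (psi x) != 0).
  have [j [[pj|pj] _]] := cplxEmbP S nr.
  - by exists (inr (inl j)).
  - by exists (inr (inr j)).
have {re}re x : psi x = (complex.Re (psi x))%:C%C.
  have /negP := re x; rewrite negbK => /eqP.
  by case: (psi x) => a b /= ->.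
(* A homomorphism with real values is its own real part, which is thus a ring morphism to R and one
   of the listed real embeddings. *)
pose g x := complex.Re (psi x).
have gB : zmod_morphism g.
  by move=> x y; rewrite /g rmorphB; case: (psi x) (psi y) => [a b] [c d].
have gM : monoid_morphism g.
  split=> [|x y]; rewrite /g ?rmorph1// rmorphM (re x) (re y) /=.
  by rewrite mulr0 subr0.
pose G := HB.pack_for {rmorphism F -> R} g
  (GRing.isZmodMorphism.Build F R g gB) (GRing.isMonoidMorphism.Build F R g gM).
have [i [iP _]] := realEmbP S G.
by exists (inl i) => x /=; rewrite -iP re.
Qed.

Lemma emb_uniq t t' : emb t =1 emb t' -> t = t'.
Proof.
have ne i (psi : F -> R[i]) : (exists x, complex.Im (psi x) != 0) ->
    emb (inl i) =1 psi -> False.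
  by move=> [x] xi /(_ x) e; move: xi; rewrite -e /= eqxx.
have nrJ j : exists x, complex.Im (emb (inr (inr j)) x) != 0.
  have [x xj] := cplxEmb_nonreal S j; exists x => /=.
  by move: xj; case: (cplxEmb S j x) => a b /=; rewrite oppr_eq0.
have nr u : exists x, complex.Im (emb (inr u) x) != 0.
  by case: u => j; [exact: cplxEmb_nonreal|exact: nrJ].
(* Both embeddings belong to one conjugate pair, so j = j' and the embedding equals its own
   conjugate, against being nonreal. *)
have JJ j j' : emb (inr (inl j)) =1 emb (inr (inr j')) -> False.
  move=> /= jj'; have [k [_ kP]] := cplxEmbP S (cplxEmb_nonreal S j).
  have jk : k = j by apply: kP; left.
  have j'k : k = j' by apply: kP; right.
  subst k; subst j'; have [x] := cplxEmb_nonreal S j; have /= := jj' x.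
  case: (cplxEmb S j x) => a b /= [] /eqP.
  by rewrite -subr_eq0 opprK -mulr2n mulrn_eq0 /= => ->.
case: t t' => [i|[j|j]] [i'|[j'|j']] tt'.
- have [k [_ kP]] := realEmbP S (realEmb S i').
  congr inl; rewrite -(kP i) ?(kP i')// => x.
  by have /= := tt' x; case=> ->.
- by case: (ne _ _ (nr _) tt').
- by case: (ne _ _ (nr _) tt').
- by case: (ne _ _ (nr _) (fsym tt')).
- have [k [_ kP]] := cplxEmbP S (cplxEmb_nonreal S j).
  have jk : k = j by apply: kP; left.
  have jk' : k = j' by apply: kP; left; exact: tt'.
  by rewrite -jk -jk'.
- by case: (JJ _ _ tt').
- by case: (ne _ _ (nr _) (fsym tt')).
- by case: (JJ _ _ (fsym tt')).
- have [k [_ kP]] := cplxEmbP S (nrJ j).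
  have jk : k = j by apply: kP; right.
  have jk' : k = j' by apply: kP; right; exact: tt'.
  by rewrite -jk -jk'.
Qed.

Lemma emb_alg t q : emb t q%:A = ratr q.
Proof. by rewrite -(fmorph_eq_rat (emb t \o in_alg F)). Qed.

(** This is where the number of embeddings is compared with the degree of F: both are the number of
    roots in C of the minimal polynomial [q] of a primitive element, which is separable. Remainders
    modulo [q] then give the bound on the exponents. *)
Lemma primitive_element : exists theta : F, injective (fun t => emb t theta) /\
  forall f, exists a : 'I_#|emb_index| -> rat, f = \sum_i a i *: theta ^+ i.
Proof.
pose theta := separable_generator 1%VS {:F}.
have sepF : separable 1%VS {:F}.
  apply/separableP => y _; apply: pcharf0_separable => p.
  rewrite !inE; apply/negbTE/andP => -[pp /eqP].
  rewrite -(rmorph_nat (in_alg F)) => /eqP; rewrite fmorph_eq0 pnatr_eq0.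
  by move=> /eqP p0; rewrite p0 in pp.
have gen : {:F}%VS = <<1; theta>>%VS.
  by apply: eq_adjoin_separable_generator => //; exact: sub1v.
have repr f : exists p : {poly rat}, f = (map_poly (in_alg F) p).[theta].
  by apply/Fadjoin1_polyP; rewrite -gen memvf.
have [q qE] : exists q, minPoly 1 theta = map_poly (in_alg F) q.
  by apply/polyOver1P; exact: minPolyOver.
have qdvd p : ((map_poly (in_alg F) p).[theta] == 0) = (q %| p).
  rewrite -(dvdp_map (in_alg F)) -qE; apply/idP/idP.
    by move=> p0; apply: minPoly_dvdp => //; apply/polyOver1P; exists p.
  by move=> /dvdpP[u ->]; rewrite hornerM minPolyxx mulr0.
pose qC : {poly R[i]} := map_poly ratr q.
have mon_q : q \is monic by rewrite -(map_monic (in_alg F)) -qE monic_minPoly.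
have embE t p : emb t (map_poly (in_alg F) p).[theta] = (map_poly ratr p).[emb t theta].
  rewrite -horner_map -map_poly_comp; congr (_.[_]).
  by apply: eq_map_poly => x; rewrite /= emb_alg.
have inj : injective (fun t => emb t theta).
  move=> t t' tt'; apply: emb_uniq => f; have [p ->] := repr f.
  by rewrite !embE tt'.
(* The value at [z] of a polynomial that represents an element does not depend on the polynomial, as
   two choices differ by a multiple of [q]; so each root of [q] gives an embedding. *)
have surj z : root qC z -> exists t, emb t theta = z.
  move=> qz; have [P PE] := choice repr.
  pose g f := (map_poly ratr (P f)).[z] : R[i].
  have g0 p : (map_poly (in_alg F) p).[theta] = 0 -> (map_poly ratr p).[z] = 0 :> R[i].
    move=> /eqP; rewrite qdvd => /dvdpP[u ->]; rewrite rmorphM hornerM.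
    by rewrite (rootP qz) mulr0.
  have gB : zmod_morphism g.
    move=> x y; apply/eqP; rewrite /g -subr_eq0; apply/eqP.
    have := g0 (P (x - y) - (P x - P y)).
    by rewrite !rmorphB /= !hornerE -!PE subrr => /(_ erefl).
  have gM : monoid_morphism g.
    split.
      apply/eqP; rewrite /g -subr_eq0; apply/eqP.
      have := g0 (P 1 - 1).
      by rewrite !rmorphB !rmorph1 /= !hornerE -PE subrr => /(_ erefl).
    move=> x y; apply/eqP; rewrite /g -subr_eq0; apply/eqP.
    have := g0 (P (x * y) - P x * P y).
    by rewrite !rmorphB !rmorphM /= !hornerE -!PE subrr => /(_ erefl).
  pose G := HB.pack_for {rmorphism F -> R[i]} g
    (GRing.isZmodMorphism.Build F R[i] g gB) (GRing.isMonoidMorphism.Build F R[i] g gM).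
  have [t tP] := emb_surj G; exists t; rewrite -tP /= /g.
  apply/eqP; rewrite -subr_eq0; apply/eqP.
  have := g0 (P theta - 'X).
  by rewrite !rmorphB /= !map_polyX !hornerE -PE subrr => /(_ erefl).
have qC0 t : root qC (emb t theta).
  by rewrite /root /qC -embE -qE minPolyxx rmorph0.
have [r rE] := closed_field_poly_normal qC.
have lqC : lead_coef qC = 1 by apply/monicP; rewrite map_monic.
rewrite lqC scale1r in rE.
have ur : uniq r.
  rewrite -separable_prod_XsubC -rE separable_map -(separable_map (in_alg F)) -qE.
  by have /separableP/(_ theta (memvf _)) := sepF.
have szr : size r = (size q).-1.
  by rewrite -(size_map_poly (@ratr R[i]) q) -/qC rE size_prod_XsubC.
have cardT : #|emb_index| = (size q).-1.
  rewrite -szr cardE -(size_map (fun t => emb t theta)).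
  apply/perm_size/uniq_perm => //.
    by rewrite (map_inj_uniq inj) enum_uniq.
  move=> z; rewrite -(root_prod_XsubC r) -rE; apply/mapP/idP => [[t _ ->]//|/surj[t tz]].
  by exists t => //; rewrite mem_enum.
exists theta; split => // f; have [p ->] := repr f.
pose p' := p %% q.
have -> : (map_poly (in_alg F) p).[theta] = (map_poly (in_alg F) p').[theta].
  apply/eqP; rewrite -subr_eq0 -hornerN -hornerD -rmorphB qdvd.
  by rewrite {1}(divp_eq p q) addrK dvdp_mull.
have szp' : (size p' <= #|emb_index|)%N.
  by rewrite cardT -ltnS prednK ?ltn_modp ?size_poly_gt0 ?monic_neq0.
exists (fun i => p'`_i); rewrite horner_coef size_map_poly.
rewrite (big_ord_widen _ (fun i => (map_poly (in_alg F) p')`_i * theta ^+ i) szp').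
rewrite big_mkcond /=; apply: eq_bigr => i _; rewrite coef_map /= mulr_algl.
by case: ltnP => // ?; rewrite nth_default// scale0r.
Qed.

End Embeddings.

Section RingOfIntegers.
Variable F : fieldExtType rat.
Local Notation OF := (ringOfIntegers F).

Lemma OF_int (z : int) : OF z%:~R. Proof. exact: integral_id. Qed.
Lemma OF_nat (n : nat) : OF n%:R. Proof. exact: integral_nat. Qed.
Lemma OF0 : OF 0. Proof. exact: (OF_nat 0). Qed.
Lemma OF1 : OF 1. Proof. exact: (OF_nat 1). Qed.
Lemma OFB x y : OF x -> OF y -> OF (x - y). Proof. exact: integral_sub. Qed.
Lemma OFD x y : OF x -> OF y -> OF (x + y). Proof. exact: integral_add. Qed.
Lemma OFM x y : OF x -> OF y -> OF (x * y). Proof. exact: integral_mul. Qed.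
Lemma OFX x n : OF x -> OF (x ^+ n).
Proof.
by move=> xO; elim: n => [|n IH]; rewrite ?expr0 ?exprS; [exact: OF1|exact: OFM].
Qed.

Lemma OF_subgroup : is_subgroup OF.
Proof. by split; [exact: OF0|exact: OFB]. Qed.

Lemma OF_integrally_closed (p : {poly F}) x :
  p \is monic -> root p x -> (forall i, OF p`_i) -> OF x.
Proof.
by move=> mp px pO; apply: (integral_root_monic mp px); apply/integral_poly.
Qed.

(** The characteristic polynomial of an integer matrix is monic with integer coefficients. *)
Lemma OF_eigenvalue n (M : 'M[int]_n) (v : 'rV[F]_n) x :
  v != 0 -> v *m map_mx intr M = x *: v -> OF x.
Proof.
move=> v0 vM; exists (char_poly M); first exact: char_poly_monic.
rewrite map_char_poly -eigenvalue_root_char; apply/eigenvalueP.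
by exists v.
Qed.

Lemma integral_rat_int (q : rat) :
  integralOver (intr : int -> rat) q -> exists z : int, q = z%:~R.
Proof.
move=> [p mp pq].
have qA : (ratr q : algC) \in Aint.
  apply: (@root_monic_Aint (map_poly intr p)).
  - have -> : map_poly intr p = map_poly ratr (map_poly intr p) :> {poly algC}.
      by rewrite -map_poly_comp; apply: eq_map_poly => x /=; rewrite ratr_int.
    by rewrite fmorph_root.
  - exact: monic_map.
  - by apply/polyOverP => i; rewrite coef_map/= intr_int.
have /intrP[z qz] : (ratr q : algC) \is a Num.int.
  by rewrite Cint_rat_Aint ?Crat_rat.
by exists z; apply: (fmorph_inj (@ratr algC)); rewrite /= qz ratr_int.
Qed.

End RingOfIntegers.

Lemma common_denominator (I : finType) (a : I -> rat) :
  exists2 d : nat, (0 < d)%N & exists z : I -> int, forall i, d%:R * a i = (z i)%:~R.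
Proof.
exists (\prod_i `|denq (a i)|)%N.
  by apply: prodn_gt0 => i; rewrite absz_gt0 denq_neq0.
exists (fun i => (\prod_(j | j != i) `|denq (a j)|)%N%:Z * numq (a i)) => i.
rewrite (bigD1 i)//= natrM mulrC mulrA.
have -> : a i * `|denq (a i)|%N%:R = (numq (a i))%:~R.
  have -> : `|denq (a i)|%N%:R = (denq (a i))%:~R :> rat.
    by rewrite -[X in _ = X%:~R](absz_denq (a i)).
  by rewrite -{1}(divq_num_den (a i)) divfK// intr_eq0 denq_neq0.
by rewrite intrM mulrC.
Qed.

(** * Conjugates, traces and the discriminant *)

Section Lattice.
Variables (R : realType) (F : fieldExtType rat) (r1 r2 : nat).
Variable S : infinitePrimes R F r1 r2.
Local Notation OF := (ringOfIntegers F).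
Local Notation T := (emb_index r1 r2).
Local Notation n := #|emb_index r1 r2|.
Local Notation emb := (emb S).

Definition embn (i : 'I_n) := emb (enum_val i).

Lemma intr_alg (z : int) : z%:~R = z%:~R%:A :> F.
Proof. by have /= -> := rmorph_int (in_alg F) z. Qed.

(** Multiplication by [f] has a rational matrix on the powers of [theta]; once [d] clears its
    denominators, d f is an eigenvalue of an integer matrix (transposed, as it acts on rows) with
    the row of powers as eigenvector. *)
Lemma clear_denominator (f : F) : exists2 d : nat, (0 < d)%N & OF (d%:R * f).
Proof.
have [theta [_ span]] := primitive_element S.
have [A AE] := choice (fun i : 'I_n => span (f * theta ^+ i)).
have [d d0 [z zE]] := common_denominator (fun p : 'I_n * 'I_n => A p.1 p.2).
exists d => //; pose v := \row_(i < n) theta ^+ i.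
apply: (@OF_eigenvalue _ n (\matrix_(i, j) z (j, i)) v).
  apply/eqP => v0; have [a] := span 1; rewrite big1 => [/eqP|i _].
    by rewrite oner_eq0.
  by have /rowP/(_ i) := v0; rewrite !mxE => ->; rewrite scaler0.
apply/rowP => i; rewrite !mxE -mulrA AE mulr_sumr; apply: eq_bigr => j _.
have zF : (z (i, j))%:~R = d%:R * (A i j)%:A :> F.
  by rewrite intr_alg -zE; have /= -> := rmorphM (in_alg F) d%:R (A i j); have /= -> := rmorph_nat (in_alg F) d.
by rewrite !mxE zF mulrCA mulr_algr.
Qed.

Lemma integralC_rat_int (q : rat) :
  integralOver (intr : int -> R[i]) (ratr q) -> exists z : int, q = z%:~R.
Proof.
move=> [p mp pw]; apply: integral_rat_int; exists p => //.
rewrite -(fmorph_root (@ratr R[i])) -map_poly_comp.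
by rewrite (@eq_map_poly _ _ _ intr)// => x /=; rewrite ratr_int.
Qed.

Lemma emb_integral t x : OF x -> integralOver (intr : int -> R[i]) (emb t x).
Proof.
move=> [p mp px]; exists p => //.
rewrite (@eq_map_poly _ _ _ (emb t \o intr)) => [|y /=]; last by rewrite rmorph_int.
by rewrite map_poly_comp fmorph_root.
Qed.

Lemma emb_scale t (a : rat) x : emb t (a *: x) = ratr a * emb t x.
Proof. by rewrite -mulr_algl rmorphM /= emb_alg. Qed.

Lemma emb_index_gt0 : (0 < n)%N.
Proof.
have [theta [_ span]] := primitive_element S; have [a] := span 1.
rewrite lt0n; apply: contra_eqN => /eqP n0; rewrite big1 ?oner_eq0// => i.
by have := ltn_ord i; rewrite [X in (_ < X)%N]n0.
Qed.

Definition emb_mx (e : 'I_n -> F) : 'M[R[i]]_n := \matrix_(i, j) embn j (e i).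

(** The embeddings diagonalize multiplication by every [f] simultaneously; when [emb_mx e] is
    invertible, the determinant and trace of [M] are thus the product and the sum of the conjugates
    of [f]. *)
Lemma mul_emb_mx e f (M : 'M[rat]_n) :
  (forall i, f * e i = \sum_j M i j *: e j) ->
  map_mx ratr M *m emb_mx e = emb_mx e *m diag_mx (\row_j embn j f).
Proof.
move=> ME; apply/matrixP => i j; rewrite mul_mx_diag !mxE mulrC -rmorphM ME.
rewrite rmorph_sum; apply: eq_bigr => k _; by rewrite !mxE /embn /= emb_scale.
Qed.

Lemma det_emb e f (M : 'M[rat]_n) : \det (emb_mx e) != 0 ->
  (forall i, f * e i = \sum_j M i j *: e j) ->
  ratr (\det M) = \prod_j embn j f.
Proof.
move=> E0 /mul_emb_mx /(congr1 determinant); rewrite !det_mulmx mulrC.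
move=> /(mulfI E0); rewrite det_diag det_map_mx => ->.
by apply: eq_bigr => j _; rewrite mxE.
Qed.

Lemma trace_emb e f (M : 'M[rat]_n) : \det (emb_mx e) != 0 ->
  (forall i, f * e i = \sum_j M i j *: e j) ->
  ratr (\tr M) = \sum_j embn j f.
Proof.
move=> E0 /mul_emb_mx ME.
have uE : emb_mx e \in unitmx by rewrite unitmxE unitfE.
have := congr1 (fun X => \tr (X *m invmx (emb_mx e))) ME.
rewrite mulmxK// -mulmxA mxtrace_mulC mulmxKV// mxtrace_diag.
rewrite trace_map_mx => ->.
by apply: eq_bigr => j _; rewrite mxE.
Qed.

(** The family consists of the powers of an integral multiple of a primitive element, and [d] is the
    absolute value of its discriminant. The coordinates of an integral [x] solve the linear system
    whose matrix [Tm] is the trace form on [e] and whose right-hand side consists of the integers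
    Tr(x e_k); by Cramer's rule their denominators divide the determinant of [Tm]. *)
Lemma integral_basis : exists (e : 'I_n -> F) (d : nat),
  [/\ (0 < d)%N, forall i, OF (e i), \det (emb_mx e) != 0,
    forall f, exists a : 'rV[rat]_n, f = \sum_i a ord0 i *: e i
  & forall x, OF x -> exists z : 'rV[int]_n, d%:R * x = \sum_i (z ord0 i)%:~R * e i].
Proof.
have [theta [ti span]] := primitive_element S.
have [m m0 mO] := clear_denominator theta.
have m0F : (m%:R : F) != 0 by rewrite -(rmorph_nat (in_alg F)) fmorph_eq0 pnatr_eq0 -lt0n.
have m0C : (m%:R : R[i]) != 0 by rewrite pnatr_eq0 -lt0n.
pose e (i : 'I_n) := (m%:R * theta) ^+ i.
have eO i : OF (e i) by exact: OFX.
have E0 : \det (emb_mx e) != 0.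
  have -> : emb_mx e = Vandermonde n (\row_j embn j (m%:R * theta)).
    by apply/matrixP => i j; rewrite !mxE rmorphXn.
  rewrite det_Vandermonde; apply/prodf_neq0 => i _; apply/prodf_neq0 => j ij.
  rewrite !mxE subr_eq0 /embn !rmorphM /= !rmorph_nat.
  apply/eqP => /(mulfI m0C) /ti /enum_val_inj ji.
  by rewrite ji ltnn in ij.
have espan f : exists a : 'rV[rat]_n, f = \sum_i a ord0 i *: e i.
  have [a ->] := span f; exists (\row_i (a i / m%:R ^+ i)).
  apply: eq_bigr => i _; rewrite mxE /e exprMn -scalerA; congr (_ *: _).
  have -> : (m%:R : F) ^+ i = (m%:R ^+ i)%:A.
    by have /= -> := rmorphXn (in_alg F) i m%:R; have /= -> := rmorph_nat (in_alg F) m.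
  rewrite mulr_algl scalerA mulVf ?scale1r//.
  by rewrite expf_neq0// pnatr_eq0 -lt0n.
(* The trace is rational, being that of a rational matrix, and integral, being a sum of conjugates
   of [x]; hence it is an integer. *)
have trZ x : OF x -> exists z : int, \sum_j embn j x = z%:~R.
  move=> xO; have [A AE] := choice (fun i => espan (x * e i)).
  pose M := \matrix_(i, j) A i ord0 j.
  have ME i : x * e i = \sum_j M i j *: e j.
    by rewrite AE; apply: eq_bigr => j _; rewrite mxE.
  have trE := trace_emb E0 ME.
  have [z zE] : exists z : int, \tr M = z%:~R.
    apply: integralC_rat_int; rewrite trE.
    elim/big_ind: _ => [|? ? ? ?|i _].
    - exact: (integral_nat _ 0).
    - exact: integral_add.
    - exact: emb_integral.
  by exists z; rewrite -trE zE ratr_int.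
have [tz tzE] := choice (fun p : 'I_n * 'I_n => trZ (e p.1 * e p.2) (OFM (eO _) (eO _))).
pose Tm := \matrix_(i, k) tz (i, k).
(* So the determinant of the trace form is the square of that of [emb_mx e], in particular
   nonzero. *)
have TE : map_mx intr Tm = emb_mx e *m (emb_mx e)^T.
  apply/matrixP => i k; rewrite !mxE -tzE; apply: eq_bigr => j _.
  by rewrite !mxE -rmorphM.
have detT0 : \det Tm != 0.
  rewrite -(intr_eq0 R[i]) -det_map_mx TE det_mulmx det_tr mulf_neq0//.
exists e, `|\det Tm|%N; split => //; first by rewrite absz_gt0.
move=> x xO; have [a xE] := espan x.
have [t tE] := choice (fun k => trZ (x * e k) (OFM xO (eO k))).
pose tr := \row_k t k.
have aT : map_mx ratr a *m map_mx intr Tm = map_mx intr tr :> 'rV[R[i]]_n.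
  apply/rowP => k; rewrite !mxE -tE.
  under [RHS]eq_bigr => j _.
    rewrite rmorphM [in embn j x]xE rmorph_sum /= mulr_suml.
    under eq_bigr do rewrite emb_scale -mulrA.
    over.
  rewrite exchange_big /=; apply: eq_bigr => i _; rewrite !mxE -tzE mulr_sumr.
  by apply: eq_bigr => j _; rewrite -[LHS]/(_ * embn j _) rmorphM.
have aE : map_mx intr (tr *m \adj Tm) = map_mx ratr ((\det Tm)%:~R *: a) :> 'rV[R[i]]_n.
  rewrite map_mxM -aT -mulmxA -map_mxM mul_mx_adj map_scalar_mx mul_mx_scalar.
  by rewrite map_mxZ /= ratr_int.
move: (tr *m \adj Tm) aE => w aE.
have aQ i : (w ord0 i)%:~R = (\det Tm)%:~R * a ord0 i.
  have /rowP/(_ i) := aE; rewrite !mxE => aEi; apply: (fmorph_inj (@ratr R[i])).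
  by rewrite /= -aEi ratr_int.
(* The sign makes the denominator a natural number. *)
pose sg : int := (-1) ^+ (\det Tm < 0)%R.
exists (sg *: w).
have dE : (`|\det Tm|%N%:R : F) = (sg * \det Tm)%:~R.
  by rewrite -[_%:R]/(_%:Z%:~R) abszE normrEsign.
rewrite dE xE mulr_sumr; apply: eq_bigr => i _.
rewrite mxE !intrM -!mulrA; congr (_ * _).
by rewrite [in RHS]intr_alg aQ [in LHS]intr_alg !mulr_algl scalerA.
Qed.
End Lattice.

(** * The modulus of complex numbers *)

Section ComplexModulus.
Variable R : realType.

Lemma normcC (x : R) : normc x%:C%C = `|x|.
Proof. by rewrite /normc /= expr0n addr0 sqrtr_sqr. Qed.

Lemma normcM (x y : R[i]) : normc (x * y) = normc x * normc y.
Proof. exact: ComplexField.Normc.normcM. Qed.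

Lemma normc_eq0 (x : R[i]) : (normc x == 0) = (x == 0).
Proof.
apply/eqP/eqP => [/ComplexField.Normc.eq0_normc//|->].
exact: ComplexField.Normc.normc0.
Qed.

Lemma normc_ge0 (x : R[i]) : 0 <= normc x.
Proof. by case: x => a b; exact: sqrtr_ge0. Qed.

Lemma normc_gt0 (x : R[i]) : (0 < normc x) = (x != 0).
Proof. by rewrite lt_def normc_eq0 normc_ge0 andbT. Qed.

Lemma normc_conj (x : R[i]) : normc (conjc x) = normc x.
Proof. by case: x => a b; rewrite /normc/= sqrrN. Qed.

Lemma ler_normcD (x y : R[i]) : normc (x + y) <= normc x + normc y.
Proof. exact: (@complex.le_normcD R x y). Qed.

Lemma normc_opp (x : R[i]) : normc (- x) = normc x.
Proof. exact: (@complex.normcN R x). Qed.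

Lemma normc1 : normc (1 : R[i]) = 1.
Proof. exact: ComplexField.Normc.normc1. Qed.

Lemma normc_prod (I : Type) (r : seq I) (P : pred I) (G : I -> R[i]) :
  normc (\prod_(i <- r | P i) G i) = \prod_(i <- r | P i) normc (G i).
Proof.
apply: (big_morph _ normcM); exact: ComplexField.Normc.normc1.
Qed.

Lemma normc_int (z : int) : normc (z%:~R : R[i]) = `|z|%N%:R.
Proof.
rewrite -(rmorph_int (real_complex R)) normcC -intr_norm -abszE.
by rewrite -[RHS]/(_%:Z%:~R).
Qed.

End ComplexModulus.

(** * The index of a principal ideal *)

Section IdealNorm.
Variables (R : realType) (F : fieldExtType rat) (r1 r2 : nat).
Variable S : infinitePrimes R F r1 r2.
Local Notation OF := (ringOfIntegers F).
Local Notation n := #|emb_index r1 r2|.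

(** The absolute value of the norm of [f] from F to Q. *)
Definition absemb f : R := \prod_t normc (emb S t f).

Lemma absembM f g : absemb (f * g) = absemb f * absemb g.
Proof.
by rewrite /absemb -big_split; apply: eq_bigr => t _; rewrite rmorphM normcM.
Qed.

Lemma absemb_neq0 f : f != 0 -> absemb f != 0.
Proof.
by move=> f0; apply/prodf_neq0 => t _; rewrite normc_eq0 fmorph_eq0.
Qed.

Lemma absemb_gt0 f : f != 0 -> 0 < absemb f.
Proof.
move=> f0; rewrite lt_def absemb_neq0//=.
by apply: prodr_ge0 => t _; exact: normc_ge0.
Qed.

Lemma principal_subgroup (f : F) : is_subgroup (principal_ideal f).
Proof.
split; first by exists 0; rewrite ?mulr0//; exact: OF0.
by move=> _ _ [a aO <-] [b bO <-]; exists (a - b); rewrite ?mulrBr//; exact: OFB.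
Qed.

Lemma natF_neq0 (m : nat) : (0 < m)%N -> (m%:R : F) != 0.
Proof.
by move=> m0; rewrite -(rmorph_nat (in_alg F)) fmorph_eq0 pnatr_eq0 -lt0n.
Qed.

Lemma image_image_subgroup (V W : zmodType) (f : V -> W) (A : set V) :
  {morph f : x y / x - y} -> is_subgroup A -> is_subgroup (f @` A).
Proof.
move=> fB [A0 AB]; split; first by exists 0 => //; rewrite -(subrr 0) fB subrr.
by move=> _ _ [a aO <-] [b bO <-]; exists (a - b); rewrite ?fB//; exact: AB.
Qed.

(* The index [O_F : f O_F] is read off the lattice spanned by an integral basis,
   where multiplication by a suitable integer multiple of f is an integer matrix;
   indices multiply along towers, so no Z-basis of O_F is needed. *)
Lemma has_index_principal_fin (f : F) : OF f -> f != 0 ->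
  exists2 N, has_index OF (principal_ideal f) N & N%:R = absemb f.
Proof.
have [e [d [d0 eO E0 span Od]]] := integral_basis S.
pose lam (z : 'rV[int]_n) : F := \sum_i (z ord0 i)%:~R * e i.
have lamB : {morph lam : x y / x - y}.
  move=> x y; rewrite /lam -sumrB; apply: eq_bigr => i _.
  by rewrite !mxE intrB mulrBl.
have laminj : injective lam.
  move=> x y /eqP; rewrite -subr_eq0 -lamB => /eqP z0.
  apply/eqP; rewrite -subr_eq0; move: (x - y) z0 => z z0 {x y}.
  have uE : emb_mx S e \in unitmx by rewrite unitmxE unitfE.
  have zE : map_mx intr z *m emb_mx S e = 0 :> 'rV_n.
    apply/rowP => j; transitivity (embn S j (lam z)); last by rewrite z0 rmorph0 mxE.
    by rewrite mxE rmorph_sum; apply: eq_bigr => i _; rewrite !mxE rmorphM rmorph_int.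
  have /rowP z0' : map_mx intr z = 0 :> 'rV[R[i]]_n.
    by rewrite -(mulmxK uE (map_mx _ _)) zE mul0mx.
  by apply/eqP/rowP => i; have := z0' i; rewrite !mxE => /eqP; rewrite intr_eq0 => /eqP.
pose L := lam @` setT.
have sL : is_subgroup L by apply: image_image_subgroup => //; split.
have LO : L `<=` OF.
  move=> _ [z _ <-]; rewrite /lam; elim/big_ind: _ => [|x y|i _].
  - exact: OF0.
  - exact: OFD.
  - by apply: OFM => //; exact: OF_int.
(* The residues modulo [d] of the coordinates of d x determine the class of [x] modulo the lattice
   [L]. *)
have [k hk] : exists k, has_index OF L k.
  case: d d0 Od => // d _ Od.
  have /choice[zz zzP] : forall x : F, exists z : 'rV[int]_n,
      OF x -> d.+1%:R * x = lam z.
    move=> x; have [/Od[z zE]|nO] := pselect (OF x); last by exists 0.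
    by exists z.
  apply: (@has_index_map _ _ _ {ffun 'I_n -> 'I_d.+1}
    (fun x => [ffun i => inord `|(zz x ord0 i %% d.+1)%Z|%N])) => // x y xO yO.
  move=> /ffunP xy; exists (\row_i ((zz x ord0 i - zz y ord0 i) %/ d.+1)%Z) => //.
  apply: (mulfI (natF_neq0 (ltn0Sn d))).
  rewrite mulrBr (zzP x)// (zzP y)// -lamB /lam mulr_sumr; apply: eq_bigr => i _.
  rewrite !mxE mulrA; congr (_ * _); rewrite -[d.+1%:R]/(d.+1%:Z%:~R) -intrM.
  congr (_ %:~R); rewrite mulrC divzK// -eqz_mod_dvd.
  have := xy i; rewrite !ffunE => /(congr1 (@nat_of_ord _)).
  have lt (z : int) : (`|(z %% d.+1)%Z| < d.+1)%N.
    by rewrite -ltz_nat gez0_abs ?modz_ge0// ltz_mod.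
  rewrite !inordK// => /(congr1 Posz); rewrite !gez0_abs ?modz_ge0//.
  by move=> ->.
have k0 : (0 < k)%N by apply: has_index_gt0 hk; exact: OF0.
(* The case in which [g] maps [L] to itself. The chains O_F, L, gL and O_F, gO_F, gL give the index
   of gL in two ways; [gO_F : gL] = [O_F : L] = [k] cancels, leaving [O_F : gO_F] = [L : gL] = |det
   M|. *)
have key g (M : 'M[int]_n) : OF g -> g != 0 ->
    (forall i, g * e i = \sum_j (M i j)%:~R * e j) ->
    exists2 N, has_index OF (principal_ideal g) N & N%:R = absemb g.
  move=> gO g0 ME.
  have ME' i : g * e i = \sum_j (map_mx intr M : 'M[rat]_n) i j *: e j.
    rewrite ME; apply: eq_bigr => j _; rewrite mxE.
    by rewrite (@intr_alg F) mulr_algl.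
  have := det_emb E0 ME'; rewrite det_map_mx ratr_int => detE.
  have NE : `|\det M|%N%:R = absemb g.
    rewrite -normc_int detE normc_prod /absemb [RHS](reindex (fun j : 'I_n => enum_val j)) //=.
    by exists enum_rank => x _; rewrite ?enum_rankK ?enum_valK.
  have det0 : \det M != 0.
    have := absemb_neq0 g0; rewrite -NE pnatr_eq0.
    by apply: contra => /eqP ->.
  exists `|\det M|%N => //.
  have hL := has_index_image lamB laminj (has_index_rowspace det0).
  have gB : {morph *%R g : x y / x - y} by move=> x y; rewrite mulrBr.
  have gi : injective ( *%R g) by exact: mulfI.
  have gL : lam @` [set v *m M | v in setT] = *%R g @` L.
    have lM z : lam (z *m M) = g * lam z.
      rewrite /lam mulr_sumr.
      under [RHS]eq_bigr do rewrite mulrCA ME mulr_sumr.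
      rewrite exchange_big /=; apply: eq_bigr => j _.
      rewrite mxE rmorph_sum /= mulr_suml; apply: eq_bigr => i _.
      by rewrite rmorphM /= mulrA.
    apply/seteqP; split => x.
      by move=> [_ [z _ <-] <-]; exists (lam z); rewrite ?lM//; exists z.
    by move=> [_ [z _ <-] <-]; exists (z *m M); rewrite ?lM//; exists z.
  rewrite gL in hL.
  have sgL : is_subgroup ( *%R g @` L) by apply: image_image_subgroup.
  have gLL : *%R g @` L `<=` L by rewrite -gL => _ [_ [z _ <-] <-]; exists (z *m M).
  have := has_index_tower (@OF_subgroup F) sL sgL LO gLL hk hL.
  have hg : has_index (principal_ideal g) ( *%R g @` L) k by exact: has_index_image.
  have gLg : *%R g @` L `<=` principal_ideal g by apply: image_subset.
  have gOO : principal_ideal g `<=` OF by move=> _ [a aO <-]; exact: OFM.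
  move=> h1; have [N hN] := @has_index_restrict _ _ _ OF _ _ sgL (principal_subgroup g) h1 (fun _ => id) gLg.
  have h2 := has_index_tower (@OF_subgroup F) (principal_subgroup g) sgL gOO gLg hN hg.
  have := has_index_uniq sgL h1 h2; rewrite mulnC => /eqP.
  by rewrite eqn_pmul2r// => /eqP ->.
move=> fO f0.
have [A AE] := choice (fun i => span (f * e i)).
(* For a common denominator [m], both m f and [m] map [L] to itself. Index and [absemb] are
   multiplicative, so the case of [f] follows by cancelling [m]. *)
have [m m0 [z zE]] := common_denominator (fun p : 'I_n * 'I_n => A p.1 ord0 p.2).
have m0F := natF_neq0 m0.
have [N2 h2 E2] : exists2 N, has_index OF (principal_ideal (m%:R * f)) N & N%:R = absemb (m%:R * f).
  apply: (key _ (\matrix_(i, j) z (i, j))); last 1 first.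
  - move=> i; rewrite -mulrA AE mulr_sumr; apply: eq_bigr => j _.
    rewrite mxE (@intr_alg F) -zE /= -[A i ord0 j *: e j]mulr_algl mulrA; congr (_ * _).
    by have /= -> := rmorphM (in_alg F) m%:R (A i ord0 j); have /= -> := rmorph_nat (in_alg F) m.
  - by apply: OFM => //; exact: OF_nat.
  - by rewrite mulf_neq0.
have [N1 h1 E1] : exists2 N, has_index OF (principal_ideal (m%:R : F)) N & N%:R = absemb m%:R.
  apply: (key _ (m%:Z)%:M) => //; first exact: OF_nat.
  move=> i; rewrite (bigD1 i)//= mxE eqxx mulr1n big1 ?addr0// => j ji.
  by rewrite mxE eq_sym (negbTE ji) mulr0n mul0r.
have mi : injective ( *%R (m%:R : F)) by exact: mulfI.
have mB : {morph *%R (m%:R : F) : x y / x - y} by move=> x y; rewrite mulrBr.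
have mfE : principal_ideal (m%:R * f) = *%R m%:R @` principal_ideal f.
  apply/seteqP; split => x.
    by move=> [a aO <-]; exists (f * a); rewrite ?mulrA//; exists a.
  by move=> [_ [a aO <-] <-]; exists a; rewrite ?mulrA.
have mfO : principal_ideal (m%:R * f) `<=` principal_ideal f.
  move=> _ [a aO <-]; exists (m%:R * a); last by rewrite mulrCA mulrA.
  by apply: OFM => //; exact: OF_nat.
have [N hN] := @has_index_restrict _ _ _ OF _ _ (principal_subgroup _) (principal_subgroup f) h2 (fun _ => id) mfO.
have := has_index_image mB mi hN; rewrite -mfE -/(principal_ideal _) => hN'.
have mOO : principal_ideal (m%:R : F) `<=` OF.
  by move=> _ [a aO <-]; apply: OFM => //; exact: OF_nat.
have mfm : principal_ideal (m%:R * f) `<=` principal_ideal m%:R.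
  by move=> _ [a aO <-]; exists (f * a); rewrite ?mulrA//; exact: OFM.
have h3 := has_index_tower (@OF_subgroup F) (principal_subgroup _) (principal_subgroup _) mOO mfm h1 hN'.
have := has_index_uniq (principal_subgroup _) h2 h3 => N2E.
exists N => //; apply: (mulfI (absemb_neq0 m0F)).
by rewrite -absembM -E2 N2E natrM E1.
Qed.

End IdealNorm.

(** * Unique factorization of ideals *)

Section Dedekind.
Variables (R : realType) (F : fieldExtType rat) (r1 r2 : nat).
Variable S : infinitePrimes R F r1 r2.
Local Notation OF := (ringOfIntegers F).
Implicit Types (A B C J : set F) (s : seq (nzprime F)).

(** The O_F-submodules of F, so that fractional ideals and inverses are treated on the same footing
    as ideals. *)
Definition omodule A := [/\ A 0, forall x y, A x -> A y -> A (x + y) &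
  forall a x, OF a -> A x -> A (a * x)].

Lemma omodule_subgroup A : omodule A -> is_subgroup A.
Proof.
move=> [A0 AD AM]; split => // x y Ax Ay; rewrite -mulN1r.
by apply: AD => //; apply: AM => //; rewrite -sub0r; apply: OFB; [exact: OF0|exact: OF1].
Qed.

Lemma omodule_OF : omodule OF.
Proof. by split; [exact: OF0|exact: OFD|exact: OFM]. Qed.

Lemma is_idealP J : is_ideal J <-> J `<=` OF /\ omodule J.
Proof. by split => [[? ? ? ?]|[? []]]; split. Qed.

Lemma ideal_omodule J : nonzero_ideals F J -> omodule J.
Proof. by move=> [/is_idealP[]]. Qed.

Lemma ideal_subOF J : nonzero_ideals F J -> J `<=` OF.
Proof. by move=> [/is_idealP[]]. Qed.

Lemma ideal_subgroup J : nonzero_ideals F J -> is_subgroup J.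
Proof. by move=> /ideal_omodule /omodule_subgroup. Qed.

Lemma ideal_neq0 J : nonzero_ideals F J -> exists2 x, J x & x != 0.
Proof.
move=> [[_ J0 _ _] Jn0]; apply: contrapT => /forall2NP H; apply: Jn0.
apply/seteqP; split => [x Jx|_ ->//] /=.
by have [//|/negP] := H x; rewrite negbK => /eqP.
Qed.

Lemma nonzero_idealP J x : is_ideal J -> J x -> x != 0 -> nonzero_ideals F J.
Proof. by move=> iJ Jx x0; split => // J0; move: Jx; rewrite J0 /= => /eqP; rewrite (negbTE x0). Qed.

Lemma ideal1 J : nonzero_ideals F J -> J 1 -> J = OF.
Proof.
move=> nJ J1; apply/seteqP; split; first exact: ideal_subOF.
by move=> x xO; rewrite -(mulr1 x); have [_ _] := ideal_omodule nJ; apply.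
Qed.

Lemma principal_is_ideal (f : F) : OF f -> is_ideal (principal_ideal f).
Proof.
move=> fO; split.
- by move=> _ [a aO <-]; exact: OFM.
- by exists 0; [exact: OF0|rewrite mulr0].
- by move=> _ _ [a aO <-] [b bO <-]; exists (a + b); [exact: OFD|rewrite mulrDr].
- by move=> a _ aO [b bO <-]; exists (a * b); [exact: OFM|rewrite mulrCA].
Qed.

Lemma principal_mem (f : F) : principal_ideal f f.
Proof. by exists 1; rewrite ?mulr1//; exact: OF1. Qed.

Lemma principal_nonzero (f : F) : OF f -> f != 0 -> nonzero_ideals F (principal_ideal f).
Proof.
by move=> fO; apply: (nonzero_idealP (principal_is_ideal fO)); exact: principal_mem.
Qed.

Lemma principal_sub J x : omodule J -> J x -> principal_ideal x `<=` J.
Proof. by move=> [_ _ JM] Jx _ [a aO <-]; rewrite mulrC; exact: JM. Qed.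

(** [J] contains a nonzero principal ideal, which has finite index. *)
Lemma ideal_index J : nonzero_ideals F J -> exists N, has_index OF J N.
Proof.
move=> nJ; have [x Jx x0] := ideal_neq0 nJ.
have [N hN _] := has_index_principal_fin S (ideal_subOF nJ Jx) x0.
apply: (@has_index_restrict _ _ _ OF _ _ (principal_subgroup x) (ideal_subgroup nJ) hN) => //.
by apply: principal_sub => //; exact: ideal_omodule.
Qed.

(** [absnorm] counts the cosets as sets through [fset_set], so they are first listed as an explicit
    finite set, one for each representative. *)
Lemma absnormE J N : is_subgroup J -> has_index OF J N -> absnorm J = N.
Proof.
move=> sJ [r [rO rc ri]]; rewrite /absnorm.
pose c (x : F) : set F := [set x + y | y in J].
have cP x y : J (x - y) -> c x = c y.
  move=> Jxy; apply/seteqP; split => _ [z Jz <-].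
    by exists (x - y + z); [exact: subgroupD|rewrite addrA subrKC].
  exists (z - (x - y)); first exact: sJ.2.
  by rewrite opprB addrC -addrA -addrA [- x + x]addrC subrr addr0 addrC.
have cI x y : c x = c y -> J (x - y).
  move=> cxy; have : c x x by exists 0; rewrite ?addr0//; exact: sJ.1.
  by rewrite cxy => -[z Jz <-]; rewrite addrAC subrr add0r.
have -> : [set [set x + y | y in J] | x in OF] = [set` [fset c (r i) | i in 'I_N]%fset].
  apply/seteqP; split => [_ [x xO <-]|_ /imfsetP[i /= _ ->]]; last by exists (r i).
  have [i Ji] := rc _ xO; rewrite -/(c x) (cP _ _ Ji) /=.
  by apply/imfsetP; exists i.
rewrite set_fsetK card_imfset /=; first by rewrite size_enum_ord.
by move=> i j /cI /ri.
Qed.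

Lemma absnormP J : nonzero_ideals F J -> has_index OF J (absnorm J).
Proof.
move=> nJ; have [N hN] := ideal_index nJ.
by rewrite (absnormE (ideal_subgroup nJ) hN).
Qed.

Lemma absnorm_gt0 J : nonzero_ideals F J -> (0 < absnorm J)%N.
Proof. by move=> /absnormP; apply: has_index_gt0; exact: OF0. Qed.

Lemma absnorm_OF : absnorm OF = 1%N.
Proof. by apply: absnormE; [exact: OF_subgroup|exact/has_index_refl/OF_subgroup]. Qed.

Lemma absnorm_principal (f : F) : OF f -> f != 0 ->
  (absnorm (principal_ideal f))%:R = absemb S f.
Proof.
move=> fO f0; have [N hN <-] := has_index_principal_fin S fO f0.
by rewrite (absnormE (principal_subgroup f) hN).
Qed.

Lemma absnorm_lt J J' : nonzero_ideals F J -> nonzero_ideals F J' ->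
  J `<=` J' -> J' <> J -> (absnorm J' < absnorm J)%N.
Proof.
move=> nJ nJ' JJ' neq; have sJ := ideal_subgroup nJ; have sJ' := ideal_subgroup nJ'.
have [k hk] := @has_index_restrict _ OF _ J' _ _ sJ sJ (absnormP nJ) (ideal_subOF nJ') (fun _ => id).
have h := has_index_tower (@OF_subgroup F) sJ' sJ (ideal_subOF nJ') JJ' (absnormP nJ') hk.
rewrite (has_index_uniq sJ (absnormP nJ) h) -[ltnLHS]muln1 ltn_pmul2l ?absnorm_gt0//.
rewrite ltnNge; apply/negP => k1; apply: neq; apply/seteqP; split => //.
apply: (has_index1 sJ sJ'.1); suff <- : k = 1%N by [].
by apply/eqP; rewrite eqn_leq k1 (has_index_gt0 sJ'.1 hk).
Qed.

(** Noetherian induction: a strictly larger ideal has strictly smaller norm. *)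
Lemma ideal_ind (Q : set F -> Prop) :
  (forall J, nonzero_ideals F J -> (forall J', nonzero_ideals F J' ->
     J `<=` J' -> J' <> J -> Q J') -> Q J) ->
  forall J, nonzero_ideals F J -> Q J.
Proof.
move=> H J; move: {2}(absnorm J) (leqnn (absnorm J)) => m.
elim: m J => [J J0 /absnorm_gt0|m IH J Jm nJ]; first by rewrite lt0n -leqn0 J0.
apply: H => // J' nJ' JJ' neq; apply: IH => //.
by rewrite -ltnS; apply: leq_trans Jm; exact: absnorm_lt.
Qed.

Definition ideal_adjoin J x := [set y | exists j a, [/\ J j, OF a & y = j + a * x]].

Lemma ideal_adjoin_omodule J x : omodule J -> omodule (ideal_adjoin J x).
Proof.
move=> [J0 JD JM]; split.
- by exists 0, 0; split; [|exact: OF0|rewrite mul0r addr0].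
- move=> _ _ [j [a [Jj aO ->]]] [k [b [Jk bO ->]]]; exists (j + k), (a + b).
  by split; [exact: JD|exact: OFD|rewrite mulrDl addrACA].
- move=> c _ cO [j [a [Jj aO ->]]]; exists (c * j), (c * a).
  by split; [exact: JM|exact: OFM|rewrite mulrDr mulrA].
Qed.

Lemma sub_ideal_adjoin J x : J `<=` ideal_adjoin J x.
Proof. by move=> j Jj; exists j, 0; split; [|exact: OF0|rewrite mul0r addr0]. Qed.

Lemma mem_ideal_adjoin J x : J 0 -> ideal_adjoin J x x.
Proof. by move=> J0; exists 0, 1; split; [|exact: OF1|rewrite add0r mul1r]. Qed.

Lemma ideal_adjoin_nonzero J x : OF x -> nonzero_ideals F J ->
  nonzero_ideals F (ideal_adjoin J x).
Proof.
move=> xO nJ; have [y Jy y0] := ideal_neq0 nJ.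
apply: (@nonzero_idealP _ y) => //; last exact: sub_ideal_adjoin.
apply/is_idealP; split; last exact/ideal_adjoin_omodule/ideal_omodule.
move=> _ [j [a [Jj aO ->]]]; apply: OFD; last exact: OFM.
exact: ideal_subOF Jj.
Qed.

Lemma nzprime_prime (P : nzprime F) : is_prime_ideal (val P).
Proof. by have /asboolP[] := valP P. Qed.

Lemma nzprime_nonzero (P : nzprime F) : nonzero_ideals F (val P).
Proof. by have /asboolP[[iP _ _] P0] := valP P; split. Qed.

Lemma nzprimeN1 (P : nzprime F) : ~ (val P) 1.
Proof. by have [] := nzprime_prime P. Qed.

(** O_F / P is a finite domain. Two powers of [x] agree modulo P, and cancelling the smaller one,
    which is not in P, gives x^(j - i) = 1 modulo P. *)
Lemma prime_maximal (P : nzprime F) J : nonzero_ideals F J ->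
  val P `<=` J -> J <> val P -> J 1.
Proof.
move=> nJ PJ neq; have nP := nzprime_nonzero P; have [iP P1 Pp] := nzprime_prime P.
have [x Jx Px] : exists2 x, J x & ~ (val P) x.
  apply: contrapT => /forall2NP H; apply: neq; apply/seteqP; split => // x Jx.
  by have [//|/contrapT] := H x.
have xO := ideal_subOF nJ Jx; have [J0 JD JM] := ideal_omodule nJ.
have [i [j [ij]]] := has_index_pigeon (ideal_subgroup nP) (absnormP nP) (fun k => OFX k xO).
have -> : x ^+ j - x ^+ i = x ^+ i * (x ^+ (j - i) - 1).
  by rewrite mulrBr mulr1 -exprD subnKC// ltnW.
have xnP k : ~ (val P) (x ^+ k).
  elim: k => [|k IH]; first by rewrite expr0.
  by rewrite exprS => /Pp[] //; exact: OFX.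
move=> /Pp[]; [exact: OFX|by apply: OFB; [exact: OFX|exact: OF1]|by move/xnP|].
move=> /PJ Jx1; rewrite -(subKr (x ^+ (j - i)) 1).
apply: (ideal_subgroup nJ).2 => //.
have : (0 < j - i)%N by rewrite subn_gt0.
by case: (j - i)%N => // k _; rewrite exprSr; apply: JM => //; exact: OFX.
Qed.

Lemma nzprime_sub (P Q : nzprime F) : val P `<=` val Q -> P = Q.
Proof.
move=> PQ; apply: val_inj; apply: contrapT => neq.
apply: (@nzprimeN1 Q); apply: (@prime_maximal P (val Q) (nzprime_nonzero Q) PQ) => e.
by apply: neq; rewrite e.
Qed.

Lemma not_prime J : nonzero_ideals F J -> ~ J 1 ->
  (exists P : nzprime F, val P = J) \/
  (exists x y, [/\ OF x, OF y, J (x * y), ~ J x & ~ J y]).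
Proof.
move=> nJ J1; have [pJ|npJ] := pselect (is_prime_ideal J).
  have h : `[< is_prime_ideal J /\ J <> [set 0] >] by apply/asboolP; split; [|case: nJ].
  by left; exists (exist _ J h).
right; apply: contrapT => H; apply: npJ; split => //; first by case: nJ.
move=> x y xO yO Jxy; apply: contrapT => /not_orP[nx ny]; apply: H.
by exists x, y.
Qed.

Lemma exists_prime J : nonzero_ideals F J -> ~ J 1 ->
  exists P : nzprime F, J `<=` val P.
Proof.
move: J; apply: ideal_ind => J nJ IH J1; have [J0 JD JM] := ideal_omodule nJ.
have [[P <-]|[x [y [xO yO Jxy nx ny]]]] := not_prime nJ J1; first by exists P.
have nJx := ideal_adjoin_nonzero xO nJ.
(* If 1 = j + a x, then y = j y + a x y lies in [J]. *)
have [[j [a [Jj aO e1]]]|Jx1] := pselect (ideal_adjoin J x 1).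
  exfalso; apply: ny; rewrite -(mul1r y) e1 mulrDl -mulrA.
  by apply: JD; [rewrite mulrC; exact: JM|exact: JM].
have neq : ideal_adjoin J x <> J.
  by move=> e; apply: nx; rewrite -e; exact: mem_ideal_adjoin.
have [P PJ] := IH _ nJx (@sub_ideal_adjoin J x) neq Jx1.
by exists P; exact: subset_trans (@sub_ideal_adjoin J x) PJ.
Qed.

Lemma idealM_mem A B a b : A a -> B b -> idealM A B (a * b).
Proof.
by move=> Aa Bb; exists 1%N, (fun=> a), (fun=> b); split => //; rewrite big_ord1.
Qed.

Lemma idealM0 A B : idealM A B 0.
Proof. by exists 0%N, (fun=> 0), (fun=> 0); split; [case|case|rewrite big_ord0]. Qed.

Lemma idealMD A B x y : idealM A B x -> idealM A B y -> idealM A B (x + y).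
Proof.
move=> [m [a [b [Aa Bb ->]]]] [n [a' [b' [Aa' Bb' ->]]]].
pose g T (u : 'I_m -> T) (v : 'I_n -> T) (k : 'I_(m + n)) :=
  match fintype.split k with inl i => u i | inr j => v j end.
exists (m + n)%N, (g _ a a'), (g _ b b'); split.
- by move=> k; rewrite /g; case: fintype.split.
- by move=> k; rewrite /g; case: fintype.split.
rewrite big_split_ord /=; congr (_ + _); apply: eq_bigr => i _.
- by rewrite /g -[lshift _ _]/(unsplit (inl i)) unsplitK.
- by rewrite /g -[rshift _ _]/(unsplit (inr i)) unsplitK.
Qed.

Lemma idealM_sub A B C : C 0 -> (forall x y, C x -> C y -> C (x + y)) ->
  (forall a b, A a -> B b -> C (a * b)) -> idealM A B `<=` C.
Proof.
move=> C0 CD CM _ [m [a [b [Aa Bb ->]]]].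
by elim/big_ind: _ => // i _; exact: CM.
Qed.

Lemma idealMC A B : idealM A B = idealM B A.
Proof.
suff sub A' B' : idealM A' B' `<=` idealM B' A' by apply/seteqP.
apply: idealM_sub; [exact: idealM0|exact: idealMD|].
by move=> a b Aa Bb; rewrite mulrC; exact: idealM_mem.
Qed.

Lemma idealMA A B C : idealM A (idealM B C) = idealM (idealM A B) C.
Proof.
suff sub A' B' C' : idealM A' (idealM B' C') `<=` idealM (idealM A' B') C'.
  apply/seteqP; split => //; rewrite idealMC [idealM A B]idealMC.
  by rewrite [idealM A _]idealMC [idealM B C]idealMC; exact: sub.
apply: idealM_sub; [exact: idealM0|exact: idealMD|] => a b Aa.
apply: (@idealM_sub _ _ [set x | idealM (idealM A' B') C' (a * x)]) => /=.
- by rewrite mulr0; exact: idealM0.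
- by move=> x y; rewrite mulrDr; exact: idealMD.
- by move=> x y Bx Cy; rewrite mulrA; apply: idealM_mem => //; exact: idealM_mem.
Qed.

Lemma idealM_omodule A B : omodule A -> omodule (idealM A B).
Proof.
move=> [A0 AD AM]; split; [exact: idealM0|exact: idealMD|] => c x cO.
apply: (@idealM_sub _ _ [set x | idealM A B (c * x)]) => /=.
- by rewrite mulr0; exact: idealM0.
- by move=> y z; rewrite mulrDr; exact: idealMD.
- by move=> a b Aa Bb; rewrite mulrA; apply: idealM_mem => //; exact: AM.
Qed.

Lemma idealM1 A : omodule A -> idealM OF A = A.
Proof.
move=> [A0 AD AM]; apply/seteqP; split; first exact: idealM_sub.
by move=> a Aa; rewrite -(mul1r a); apply: idealM_mem => //; exact: OF1.
Qed.

Lemma idealM_mono A A' B B' : A `<=` A' -> B `<=` B' -> idealM A B `<=` idealM A' B'.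
Proof.
move=> AA BB; apply: idealM_sub; [exact: idealM0|exact: idealMD|].
by move=> a b /AA Aa /BB Bb; exact: idealM_mem.
Qed.

Lemma idealM_subl A B : omodule A -> B `<=` OF -> idealM A B `<=` A.
Proof.
move=> oA BO; rewrite -[X in _ `<=` X](idealM1 oA) idealMC.
exact: idealM_mono.
Qed.

Lemma idealV_omodule A : omodule (idealV A).
Proof.
split.
- by move=> y _; rewrite mul0r; exact: OF0.
- by move=> x y Vx Vy z Az; rewrite mulrDl; apply: OFD; [exact: Vx|exact: Vy].
- by move=> a x aO Vx y Ay; rewrite -mulrA; apply: OFM => //; exact: Vx.
Qed.

Definition prodI s := foldr (fun P A => idealM (val P) A) OF s.

Lemma prodI_omodule s : omodule (prodI s).
Proof.
elim: s => [|P s IH] /=; first exact: omodule_OF.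
by apply: idealM_omodule; exact/ideal_omodule/nzprime_nonzero.
Qed.

Lemma prodI_sub s : prodI s `<=` OF.
Proof.
elim: s => [//|P s IH] /=; apply: subset_trans (ideal_subOF (nzprime_nonzero P)).
by apply: idealM_subl => //; exact/ideal_omodule/nzprime_nonzero.
Qed.

Lemma prodI_cat s s' : prodI (s ++ s') = idealM (prodI s) (prodI s').
Proof.
elim: s => [|P s IH] /=; first by rewrite idealM1//; exact: prodI_omodule.
by rewrite IH idealMA.
Qed.

Lemma prodI_rem P s : P \in s -> prodI s = idealM (val P) (prodI (rem P s)).
Proof.
elim: s => [//|Q s IH]; rewrite inE /=; case: eqVneq => [->//|QP] /=.
move=> /IH ->; by rewrite idealMA [idealM (val Q) _]idealMC -idealMA.
Qed.

(** A prime that contains a product contains one of the factors, and by maximality it is equal to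
    that factor. *)
Lemma prime_prodI (P : nzprime F) s : prodI s `<=` val P -> P \in s.
Proof.
elim: s => [|Q s IH] /= sP; first by case: (@nzprimeN1 P); apply: sP; exact: OF1.
rewrite inE; apply/orP; have [QP|] := pselect (val Q `<=` val P).
  by left; apply/eqP/esym/nzprime_sub.
move=> /existsNP[q /not_implyP[Qq Pq]]; right; apply: IH => x sx.
have [_ _ Pp] := nzprime_prime P; have /sP := idealM_mem Qq sx.
by case/(Pp _ _ (ideal_subOF (nzprime_nonzero Q) Qq) (prodI_sub sx)).
Qed.

(** If [J] is neither O_F nor prime, then x y lies in [J] for some [x], [y] outside it, and the
    product of the larger ideals J + x O_F and J + y O_F is contained in [J]. *)
Lemma contains_prodI J : nonzero_ideals F J -> exists s, prodI s `<=` J.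
Proof.
move: J; apply: ideal_ind => J nJ IH; have oJ := ideal_omodule nJ.
have [J1|J1] := pselect (J 1); first by exists [::]; rewrite (ideal1 nJ J1).
have [[P <-]|[x [y [xO yO Jxy nx ny]]]] := not_prime nJ J1.
  exists [:: P]; apply: idealM_subl => //; exact/ideal_omodule/nzprime_nonzero.
have [|s1 h1] := IH _ (ideal_adjoin_nonzero xO nJ) (@sub_ideal_adjoin J x).
  by move=> e; apply: nx; rewrite -e; apply: mem_ideal_adjoin; case: oJ.
have [|s2 h2] := IH _ (ideal_adjoin_nonzero yO nJ) (@sub_ideal_adjoin J y).
  by move=> e; apply: ny; rewrite -e; apply: mem_ideal_adjoin; case: oJ.
exists (s1 ++ s2); rewrite prodI_cat; have [J0 JD JM] := oJ.
apply: subset_trans (idealM_mono h1 h2) _; apply: idealM_sub => //.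
move=> _ _ [j [a [Jj aO ->]]] [k [b [Jk bO ->]]].
have JO := ideal_subOF nJ.
rewrite mulrDl; apply: (JD).
  by rewrite mulrC; apply: JM => //; apply: OFD; [exact: JO|exact: OFM].
rewrite mulrDr; apply: (JD); first by apply: JM => //; exact: OFM.
by rewrite mulrACA; apply: JM => //; exact: OFM.
Qed.

(* Two powers of z agree on some y in J modulo y O_F, as that ideal has finite
   index; this gives a monic equation for z over O_F. *)
Lemma stable_integral J z : nonzero_ideals F J -> (forall y, J y -> J (z * y)) -> OF z.
Proof.
move=> nJ Jz; have [y Jy y0] := ideal_neq0 nJ.
have yk k : J (z ^+ k * y).
  by elim: k => [|k IH]; rewrite ?expr0 ?mul1r// exprS -mulrA; exact: Jz.
have yO := ideal_subOF nJ Jy.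
have [N hN _] := has_index_principal_fin S yO y0.
have [i [j [ij [u uO]]]] := has_index_pigeon (principal_subgroup y) hN
  (fun k => ideal_subOF nJ (yk k)).
rewrite -mulrBl mulrC => /(mulIf y0) uE.
have deg : (size (- 'X^i - u%:P : {poly F})%R < size ('X^j : {poly F})%R)%N.
  rewrite size_polyXn; apply: leq_ltn_trans (size_polyD _ _) _.
  rewrite !size_polyN size_polyXn gtn_max ltnS ij /=.
  by apply: leq_ltn_trans (size_polyC_leq1 _) _; rewrite ltnS; case: j ij {uE}.
apply: (@OF_integrally_closed _ ('X^j + (- 'X^i - u%:P))).
- by rewrite monicE lead_coefDl// lead_coefXn.
- by apply/rootP; rewrite !(hornerD, hornerN) !hornerXn hornerC uE; ring.
- move=> k; rewrite !coefE; apply: OFD; first exact: OF_nat.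
  apply: OFB; first by rewrite -sub0r; apply: OFB; [exact: OF0|exact: OF_nat].
  by case: ifP => _ //; exact: OF0.
Qed.

(** The witness is b / a. For a nonzero [a] in P, take a shortest product of primes inside a O_F; P
    is one of its factors, and by minimality the product of the others has an element [b] outside a
    O_F. *)
Lemma prime_idealV_nonintegral (P : nzprime F) : exists2 z, idealV (val P) z & ~ OF z.
Proof.
have nP := nzprime_nonzero P; have [a Pa a0] := ideal_neq0 nP.
have aO := ideal_subOF nP Pa; have na := principal_nonzero aO a0.
pose Q m := `[< exists2 s, size s = m & prodI s `<=` principal_ideal a >].
have exQ : exists m, Q m.
  by have [s sa] := contains_prodI na; exists (size s); apply/asboolP; exists s.
case: (ex_minnP exQ) => m /asboolP[s sm sa] mmin.
have Ps : P \in s.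
  apply: prime_prodI; apply: subset_trans sa _.
  by apply: principal_sub => //; exact: ideal_omodule.
have : ~ prodI (rem P s) `<=` principal_ideal a.
  move=> H; have /mmin : Q (size (rem P s)) by apply/asboolP; exists (rem P s).
  rewrite size_rem// sm; case: (m) sm Ps => [/size0nil ->//|k _ _].
  by rewrite ltnn.
move=> /existsNP[b /not_implyP[sb ab]]; exists (b / a) => [p Pp|zO].
  have /sa : prodI s (p * b) by rewrite (prodI_rem Ps); exact: idealM_mem.
  by move=> [u uO uE]; rewrite mulrAC [b * p]mulrC -uE mulrAC divff// mul1r.
by apply: ab; exists (b / a) => //; rewrite mulrC divfK.
Qed.

Lemma sub1_idealV A : A `<=` OF -> idealV A 1.
Proof. by move=> AO y Ay; rewrite mul1r; exact: AO. Qed.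

(** P P^-1 is an ideal that contains P, hence is P or O_F; if it were P, every element of P^-1 would
    map P to itself and be integral. *)
Lemma prime_invertible (P : nzprime F) : idealM (val P) (idealV (val P)) = OF.
Proof.
have nP := nzprime_nonzero P; have oP := ideal_omodule nP.
set X := idealM _ _.
have XO : X `<=` OF.
  apply: idealM_sub; [exact: OF0|exact: OFD|] => a b Pa Vb.
  by rewrite mulrC; exact: Vb.
have PX : val P `<=` X.
  move=> p Pp; rewrite -(mulr1 p); apply: idealM_mem => //.
  exact/sub1_idealV/ideal_subOF.
have nX : nonzero_ideals F X.
  have [x Px x0] := ideal_neq0 nP; apply: (@nonzero_idealP _ x) => //; last exact: PX.
  by apply/is_idealP; split => //; exact: idealM_omodule.
apply: ideal1 => //; apply: (prime_maximal nX PX) => XP.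
have [z Vz] := prime_idealV_nonintegral P; apply; apply: (stable_integral nP) => y Py.
by rewrite -XP mulrC; exact: idealM_mem.
Qed.

(** An element of P^-1 maps P J into [J]; were P J equal to [J], all of P^-1 would be integral. *)
Lemma idealM_prime_neq (P : nzprime F) J : nonzero_ideals F J -> idealM (val P) J <> J.
Proof.
move=> nJ e; have [z Vz] := prime_idealV_nonintegral P; apply.
apply: (stable_integral nJ) => y; rewrite -[X in X y]e => /=.
have [J0 JD JM] := ideal_omodule nJ.
apply: (@idealM_sub _ _ [set y | J (z * y)]) => /=.
- by rewrite mulr0.
- by move=> ? ?; rewrite mulrDr; exact: JD.
- by move=> p j Pp Jj; rewrite mulrA; apply: JM => //; exact: Vz.
Qed.

(** J = P (J P^-1) for a prime P that contains [J], and J P^-1 is strictly larger than [J] by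
    [idealM_prime_neq]. *)
Lemma ideal_factor J : nonzero_ideals F J -> exists s, J = prodI s.
Proof.
move: J; apply: ideal_ind => J nJ IH; have oJ := ideal_omodule nJ.
have [J1|J1] := pselect (J 1); first by exists [::]; rewrite (ideal1 nJ J1).
have [P JP] := exists_prime nJ J1; have nP := nzprime_nonzero P.
pose J' := idealM J (idealV (val P)).
have J'P : idealM (val P) J' = J.
  by rewrite /J' idealMA [idealM _ J]idealMC -idealMA prime_invertible idealMC idealM1.
have JJ' : J `<=` J'.
  move=> x Jx; rewrite -(mulr1 x); apply: idealM_mem => //.
  exact/sub1_idealV/ideal_subOF.
have nJ' : nonzero_ideals F J'.
  have [x Jx x0] := ideal_neq0 nJ; apply: (@nonzero_idealP _ x) => //; last exact: JJ'.
  apply/is_idealP; split; last exact: idealM_omodule.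
  by rewrite -(prime_invertible P); exact: idealM_mono.
have [|s sE] := IH _ nJ' JJ'; last by exists (P :: s); rewrite /= -sE.
by move=> e; apply: (@idealM_prime_neq P J') => //; rewrite J'P e.
Qed.

End Dedekind.

(** * Ideals of divisors *)

Section FreegBig.
Variables (K : choiceType) (M : Type) (idx : M) (op : Monoid.com_law idx).
Variable h : K -> int -> M.
Hypothesis h0 : forall k, h k 0 = idx.
Hypothesis hD : forall k a b, h k (a + b) = op (h k a) (h k b).

(** Covers both homomorphisms on finite divisors that occur below: the ideal of a divisor and the
    logarithm of its norm. *)
Definition freeg_big (D : {freeg K}) := \big[op/idx]_(k <- dom D) h k (coeff k D).

Lemma freeg_big_widen s (D : {freeg K}) : uniq s -> {subset dom D <= s} ->
  freeg_big D = \big[op/idx]_(k <- s) h k (coeff k D).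
Proof.
move=> us Ds; rewrite /freeg_big (bigID (mem (dom D))) /=.
rewrite [X in op _ X]big1 ?Monoid.mulm1; last first.
  by move=> k kD; rewrite coeff_outdom// h0.
rewrite -[RHS]big_filter; apply: perm_big; apply: uniq_perm.
- exact: uniq_dom.
- exact: filter_uniq.
- by move=> k; rewrite mem_filter /=; case: (boolP (k \in dom D)) => // /Ds ->.
Qed.

Lemma freeg_bigD (D D' : {freeg K}) :
  freeg_big (D + D') = op (freeg_big D) (freeg_big D').
Proof.
pose s := undup (dom D ++ dom D').
have us : uniq s by exact: undup_uniq.
rewrite (@freeg_big_widen s (D + D'))// => [|k /domD_subset]; last by rewrite mem_undup.
rewrite (@freeg_big_widen s D)// => [|k kD]; last by rewrite mem_undup mem_cat kD.
rewrite (@freeg_big_widen s D')// => [|k kD]; last by rewrite mem_undup mem_cat kD orbT.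
by rewrite -big_split; apply: eq_bigr => k _; rewrite coeffD hD.
Qed.

Lemma freeg_bigU k : freeg_big << k >> = h k 1.
Proof. by rewrite /freeg_big domU1 big_seq1 coeffU eqxx mulr1. Qed.

Lemma freeg_big0 : freeg_big 0 = idx.
Proof. by rewrite /freeg_big dom0 big_nil. Qed.

Lemma freeg_big_sum s : freeg_big (\sum_(k <- s) << k >>) = \big[op/idx]_(k <- s) h k 1.
Proof. by rewrite (big_morph _ freeg_bigD freeg_big0); apply: eq_bigr => k _; exact: freeg_bigU. Qed.

End FreegBig.

Definition effective (K : choiceType) (D : {freeg K}) := forall k, 0 <= coeff k D.

Lemma effective_sum (K : choiceType) (D : {freeg K}) : effective D ->
  exists s : seq K, D = \sum_(k <- s) << k >>.
Proof.
move=> D0; exists (flatten [seq nseq `|coeff k D|%N k | k <- dom D]).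
rewrite big_flatten big_map -{1}[D]freeg_sumE; apply: eq_bigr => k _.
rewrite big_nseq iter_addr_0 freegU_muln; congr (<< _ *g _ >>).
by rewrite pmulrn gez0_abs// intz.
Qed.

Lemma coeff_sum (K : choiceType) (s : seq K) k :
  coeff k (\sum_(j <- s) << j >> : {freeg K}) = (count_mem k s)%:Z.
Proof.
rewrite raddf_sum; elim: s => [|j s IH]; first by rewrite big_nil.
by rewrite big_cons IH /= coeffU mul1r PoszD; congr (_ + _); case: eqP.
Qed.

Lemma sum_effective (K : choiceType) (s : seq K) :
  effective (\sum_(j <- s) << j >> : {freeg K}).
Proof. by move=> k; rewrite coeff_sum. Qed.

Section OModuleMonoid.
Variable F : fieldExtType rat.
Local Notation OF := (ringOfIntegers F).

(** O_F is neutral for the product of submodules but not for that of arbitrary subsets; on this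
    subtype the product is a commutative monoid law, as big operators require. *)
Definition omod := {A : set F | omodule A}.

Lemma omod_inj (A B : omod) : sval A = sval B -> A = B.
Proof. by case: A B => [A oA] [B oB] /= AB; exact: eq_exist. Qed.

Definition omod1 : omod := exist _ OF (omodule_OF F).
Definition omodM (A B : omod) : omod :=
  exist _ (idealM (sval A) (sval B)) (idealM_omodule (sval B) (svalP A)).

Lemma omodMA : associative omodM.
Proof. by move=> A B C; apply: omod_inj; exact: idealMA. Qed.
Lemma omodMC : commutative omodM.
Proof. by move=> A B; apply: omod_inj; exact: idealMC. Qed.
Lemma omod1M : left_id omod1 omodM.
Proof. by move=> A; apply: omod_inj; exact: (idealM1 (svalP A)). Qed.

HB.instance Definition _ := Monoid.isComLaw.Build omod omod1 omodM omodMA omodMC omod1M.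

Lemma idealX_omodule (A : set F) z : omodule A -> omodule (idealX A z).
Proof.
have it (B : set F) n : omodule B -> omodule (iter n (idealM B) OF).
  by move=> oB; elim: n => [|n IH] /=; [exact: omodule_OF|exact: idealM_omodule].
by case: z => n oA; apply: it => //; exact: idealV_omodule.
Qed.

End OModuleMonoid.

Section DivisorIdeals.
Variables (R : realType) (F : fieldExtType rat) (r1 r2 : nat).
Variable S : infinitePrimes R F r1 r2.
Local Notation OF := (ringOfIntegers F).
Implicit Types (A B C J : set F) (x y : findiv F) (P : nzprime F).

Definition prime_pow P (z : int) : omod F :=
  exist _ (idealX (val P) z) (idealX_omodule z (ideal_omodule (nzprime_nonzero P))).

Lemma prime_pow0 P : prime_pow P 0 = omod1 F.
Proof. exact: omod_inj. Qed.

(** [idealX] iterates P or P^-1 according to the sign of the exponent; the two directions fit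
    together because P P^-1 = O_F. *)
Lemma prime_powD P a b : prime_pow P (a + b) = omodM (prime_pow P a) (prime_pow P b).
Proof.
pose p : omod F := exist _ (val P) (ideal_omodule (nzprime_nonzero P)).
pose v : omod F := exist _ (idealV (val P)) (idealV_omodule _).
have pv : omodM p v = omod1 F by apply: omod_inj; exact: (prime_invertible S).
have vp : omodM v p = omod1 F by rewrite omodMC.
have pS z : prime_pow P (z + 1) = omodM p (prime_pow P z).
  case: z => n; apply: omod_inj.
    by rewrite -[_ + _]/(Posz (n + 1)) addn1.
  case: n => [|n].
    rewrite /= idealMA (_ : idealM (val P) _ = OF); last exact: (congr1 sval pv).
    by rewrite idealM1//; exact: omodule_OF.
  have -> : Negz n.+1 + 1 = Negz n by lia.
  rewrite /= [in RHS]idealMA (_ : idealM (val P) _ = OF); last exact: (congr1 sval pv).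
  by rewrite idealM1//; apply: idealM_omodule; exact: idealV_omodule.
have pN z : prime_pow P (z - 1) = omodM v (prime_pow P z).
  by rewrite -{2}(subrK 1 z) pS omodMA vp omod1M.
elim/int_rect: a => [|n IH|n IH].
- by rewrite add0r prime_pow0 omod1M.
- by rewrite intS [1 + _]addrC addrAC !pS IH omodMA.
- by rewrite intS opprD [- 1 + _]addrC addrAC !pN IH omodMA.
Qed.

Lemma ideal_ofE x : ideal_of x = sval (freeg_big (@omodM F) prime_pow x).
Proof.
by rewrite /ideal_of /freeg_big (big_morph (fun A : omod F => sval A) (id1 := OF) (op1 := @idealM F)).
Qed.

Lemma ideal_ofD x y : ideal_of (x + y) = idealM (ideal_of x) (ideal_of y).
Proof. by rewrite !ideal_ofE freeg_bigD//; [exact: prime_pow0|exact: prime_powD]. Qed.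

Lemma ideal_of0 : ideal_of (0 : findiv F) = OF.
Proof. by rewrite ideal_ofE freeg_big0. Qed.

Lemma ideal_of_omodule x : omodule (ideal_of x).
Proof. by rewrite ideal_ofE; exact: svalP. Qed.

Lemma ideal_ofN x : idealM (ideal_of x) (ideal_of (- x)) = OF.
Proof. by rewrite -ideal_ofD subrr ideal_of0. Qed.

Lemma ideal_of_sum (s : seq (nzprime F)) : ideal_of (\sum_(P <- s) << P >>) = prodI s.
Proof.
rewrite ideal_ofE freeg_big_sum; [|exact: prime_pow0|exact: prime_powD].
elim: s => [|P s IH]; first by rewrite big_nil.
rewrite big_cons /= IH; congr (idealM _ _).
by rewrite idealMC idealM1//; exact/ideal_omodule/nzprime_nonzero.
Qed.

Lemma ideal_ofU P : ideal_of << P >> = val P.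
Proof.
have := ideal_of_sum [:: P]; rewrite big_seq1 => -> /=.
by rewrite idealMC idealM1//; exact/ideal_omodule/nzprime_nonzero.
Qed.

Lemma idealM_cancel x A B : omodule A -> omodule B ->
  idealM (ideal_of x) A = idealM (ideal_of x) B -> A = B.
Proof.
move=> oA oB /(congr1 (idealM (ideal_of (- x)))).
by rewrite !idealMA [idealM (ideal_of (- x)) _]idealMC ideal_ofN !idealM1.
Qed.

Lemma idealM_sub_cancel x A B : omodule A -> omodule B ->
  idealM (ideal_of x) A `<=` idealM (ideal_of x) B -> A `<=` B.
Proof.
move=> oA oB /(@idealM_mono _ (ideal_of (- x)) (ideal_of (- x)) _ _ (fun _ => id)).
by rewrite !idealMA [idealM (ideal_of (- x)) _]idealMC ideal_ofN !idealM1.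
Qed.

Lemma effective_sub x : effective x -> ideal_of x `<=` OF.
Proof. by move=> /effective_sum[s ->]; rewrite ideal_of_sum; exact: prodI_sub. Qed.

Lemma ideal_of_neq0 x : ideal_of x <> [set 0].
Proof.
move=> x0; have : idealM (ideal_of x) (ideal_of (- x)) `<=` [set 0].
  rewrite x0; apply: idealM_sub => [//|_ _ -> ->|a b -> _] /=; first by rewrite addr0.
  by rewrite mul0r.
by rewrite ideal_ofN => /(_ 1 (OF1 F)) /eqP; rewrite oner_eq0.
Qed.

Lemma ideal_of_nonzero x : ideal_of x `<=` OF -> nonzero_ideals F (ideal_of x).
Proof.
move=> xO; split; last exact: ideal_of_neq0.
by apply/is_idealP; split => //; exact: ideal_of_omodule.
Qed.

Lemma effective_coeff_gt0 x P : effective x -> ideal_of x `<=` val P -> 0 < coeff P x.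
Proof.
move=> /effective_sum[s ->]; rewrite ideal_of_sum => /(prime_prodI S).
by rewrite coeff_sum ltz_nat -has_count has_pred1.
Qed.

(** Let [y] and [z] be the positive and negative parts of [x]. If the coefficient at P were
    negative, P would divide the ideal of [z], so the ideal of y = x + z would be contained in P,
    although P does not occur in [y]. *)
Lemma sub_effective x : ideal_of x `<=` OF -> effective x.
Proof.
move=> xO P; rewrite leNgt; apply/negP => xP.
pose y := fgpos x; pose z := fgneg x.
have ye : effective y by move=> Q; rewrite coeff_fgposE le_max lexx.
have ze : effective (z - << P >>).
  move=> Q; rewrite coeffB coeff_fgnegE coeffU mul1r.
  case: eqVneq => [<-|_]; last by rewrite subr0 oppr_ge0 ge_min lexx.
  by rewrite min_r ?(ltW xP)//; move: (coeff P x) xP => c; lia.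
have yz : ideal_of y `<=` val P.
  have -> : y = x + z by rewrite {1}[x](fg_decomp x) subrK.
  have [u ue ->] : exists2 u, effective u & z = << P >> + u.
    by exists (z - << P >>) => //; rewrite addrC subrK.
  rewrite !ideal_ofD ideal_ofU.
  rewrite idealMA [idealM _ (val P)]idealMC -idealMA.
  apply: idealM_subl; first exact/ideal_omodule/nzprime_nonzero.
  rewrite -(idealM1 (omodule_OF F)).
  by apply: idealM_mono => //; exact: effective_sub.
have := effective_coeff_gt0 ye yz; rewrite coeff_fgposE max_l ?ltxx//.
exact: ltW.
Qed.

Lemma ideal_of_inj x y : ideal_of x = ideal_of y -> x = y.
Proof.
move=> xy.
have e (u v : findiv F) : ideal_of u = ideal_of v -> effective (u - v).
  move=> uv; have uvO : ideal_of (u - v) `<=` OF by rewrite ideal_ofD uv ideal_ofN.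
  exact: (sub_effective uvO).
apply/eqP/freeg_eqP => P; apply/eqP; rewrite eq_le.
have := e _ _ xy P; have := e _ _ (esym xy) P.
by rewrite !coeffB !subr_ge0 => -> ->.
Qed.

Lemma nonzero_ideal_of J : nonzero_ideals F J ->
  exists x, effective x /\ ideal_of x = J.
Proof.
move=> /(ideal_factor S)[s ->]; exists (\sum_(P <- s) << P >>); split.
  exact: sum_effective.
exact: ideal_of_sum.
Qed.

(** Unique factorization, in the form that reindexes sums over ideals. *)
Lemma ideal_of_bij : set_bij [set x : findiv F | effective x] (nonzero_ideals F) (@ideal_of F).
Proof.
split.
- by move=> x /= /effective_sub /ideal_of_nonzero.
- by move=> x y _ _; exact: ideal_of_inj.
- by move=> J /nonzero_ideal_of[x [xe <-]]; exists x.
Qed.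

(** J / PJ is a line over the field O_F / P: for any [x] in [J] outside P J, multiplication by [x]
    carries representatives of O_F modulo P to representatives of [J] modulo P J. *)
Lemma absnormM P J : nonzero_ideals F J ->
  absnorm (idealM (val P) J) = (absnorm (val P) * absnorm J)%N.
Proof.
move=> nJ; have nP := nzprime_nonzero P; set PJ := idealM (val P) J.
have oPJ : omodule PJ by apply: idealM_omodule; exact: ideal_omodule.
have sPJ := omodule_subgroup oPJ; have sJ := ideal_subgroup nJ.
have oJ := ideal_omodule nJ; have PO := ideal_subOF nP; have JO := ideal_subOF nJ.
have PJJ : PJ `<=` J by rewrite /PJ idealMC; apply: idealM_subl.
have [x Jx PJx] : exists2 x, J x & ~ PJ x.
  apply: contrapT => /forall2NP H; apply: (@idealM_prime_neq _ _ _ _ S P J nJ).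
  apply/seteqP; split => // y Jy; by have [//|/contrapT] := H y.
have xO := JO _ Jx; have [_ PJD PJM] := oPJ; have [J0 JD JM] := oJ.
suff hPJ : has_index J PJ (absnorm (val P)).
  apply: absnormE => //; rewrite mulnC.
  by apply: (has_index_tower (@OF_subgroup F) sJ) => //; exact: (absnormP S nJ).
(* The ideal K = J^-1 (P J + x O_F) lies between P and O_F and is not P, so it is O_F. *)
have adj : ideal_adjoin PJ x = J.
  have [j [je jE]] := nonzero_ideal_of nJ.
  have oX := ideal_adjoin_omodule x oPJ.
  pose K := idealM (ideal_of (- j)) (ideal_adjoin PJ x).
  have oK : omodule K by apply: idealM_omodule; exact: ideal_of_omodule.
  have JK : idealM J K = ideal_adjoin PJ x.
    by rewrite /K idealMA -jE ideal_ofN idealM1.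
  have XJ : ideal_adjoin PJ x `<=` J.
    move=> _ [q [a [/PJJ Jq aO ->]]]; apply: JD => //; exact: JM.
  have PK : val P `<=` K.
    apply: (@idealM_sub_cancel j) => //; first exact: ideal_omodule.
    by rewrite jE JK idealMC; exact: sub_ideal_adjoin.
  have KO : K `<=` OF.
    apply: (@idealM_sub_cancel j) => //; first exact: omodule_OF.
    by rewrite jE JK idealMC idealM1.
  have nK : nonzero_ideals F K.
    have [p Pp p0] := ideal_neq0 nP; apply: (@nonzero_idealP _ _ p) => //; last exact: PK.
    by apply/is_idealP.
  have KP : K <> val P.
    move=> KP; apply: PJx; rewrite /PJ idealMC -KP JK.
    by apply: mem_ideal_adjoin; case: oPJ.
  have K1 := ideal1 nK (prime_maximal S nK PK KP).
  by rewrite -JK K1 idealMC idealM1.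
have [r [rO rc ri]] := absnormP S nP.
exists (fun i => r i * x); split.
- by move=> i; apply: JM.
- rewrite -[X in forall a, X a -> _]adj => y [q [a [PJq aO ->]]].
  have [i Pi] := rc _ aO; exists i.
  by rewrite -addrA -mulrBl; apply: PJD => //; exact: idealM_mem.
- move=> i j; rewrite -mulrBl => ijx; apply: ri; apply: contrapT => Pij.
  have aO : OF (r i - r j) by apply: OFB.
  (* By maximality 1 = p + a (r_i - r_j) with [p] in P, which puts [x] in P J. *)
  have [|p [a [Pp aO' e1]]] := prime_maximal S (ideal_adjoin_nonzero aO nP) (@sub_ideal_adjoin _ _ _).
    by move=> e; apply: Pij; rewrite -e; apply: mem_ideal_adjoin; case: (ideal_omodule nP).
  apply: PJx; rewrite -(mul1r x) e1 mulrDl; apply: PJD; first exact: idealM_mem.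
  by rewrite -mulrA; apply: PJM.
Qed.

Lemma absnorm_gt1 P : (1 < absnorm (val P))%N.
Proof.
have nP := nzprime_nonzero P.
rewrite ltn_neqAle eq_sym (absnorm_gt0 S nP) andbT; apply/eqP => e.
have := absnormP S nP; rewrite e => /(has_index1 (ideal_subgroup nP) (OF0 F)).
by move=> /(_ 1 (OF1 F)); exact: nzprimeN1.
Qed.

Definition lognorm x : R := \sum_(P <- dom x) ln (absnorm (val P))%:R * (coeff P x)%:~R.

Lemma lognormE x : lognorm x =
  freeg_big +%R (fun P z => ln (absnorm (val P))%:R * z%:~R : R) x.
Proof. by []. Qed.

Lemma lognormD x y : lognorm (x + y) = lognorm x + lognorm y.
Proof.
rewrite !lognormE freeg_bigD// => [P|P a b]; first by rewrite mulr0.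
by rewrite intrD mulrDr.
Qed.

Lemma lognorm0 : lognorm 0 = 0. Proof. by rewrite /lognorm dom0 big_nil. Qed.

Lemma lognormN x : lognorm (- x) = - lognorm x.
Proof. by apply/eqP; rewrite -addr_eq0 -lognormD addNr lognorm0. Qed.

Lemma lognorm_effective x : effective x ->
  lognorm x = ln (absnorm (ideal_of x))%:R.
Proof.
move=> /effective_sum[s ->]; rewrite ideal_of_sum lognormE freeg_big_sum; last first.
- by move=> P a b; rewrite intrD mulrDr.
- by move=> P; rewrite mulr0.
elim: s => [|P s IH] /=; first by rewrite big_nil absnorm_OF ln1.
have nI : nonzero_ideals F (prodI s).
  rewrite -ideal_of_sum; apply: ideal_of_nonzero; apply: effective_sub.
  exact: sum_effective.
rewrite big_cons IH mulr1 absnormM// natrM lnM// posrE ltr0n.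
- exact: ltnW (absnorm_gt1 P).
- exact: absnorm_gt0 S _ nI.
Qed.

Lemma frac_OF (f : F) : exists a b, [/\ OF a, OF b, b != 0 & f = a / b].
Proof.
have [d d0 dO] := clear_denominator S f; have dn0 := natF_neq0 F d0.
exists (d%:R * f), d%:R; split => //; first exact: OF_nat.
by rewrite mulrAC divff// mul1r.
Qed.

Lemma principalM (f g : F) : idealM (principal_ideal f) (principal_ideal g) = principal_ideal (f * g).
Proof.
apply/seteqP; split.
  apply: idealM_sub.
  - by exists 0; [exact: OF0|rewrite mulr0].
  - by move=> _ _ [a aO <-] [b bO <-]; exists (a + b); [exact: OFD|rewrite mulrDr].
  - by move=> _ _ [a aO <-] [b bO <-]; exists (a * b); [exact: OFM|rewrite mulrACA].
move=> _ [a aO <-]; rewrite -mulrA; apply: idealM_mem; first exact: principal_mem.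
by exists a.
Qed.

Lemma principal1 : principal_ideal (1 : F) = OF.
Proof.
by apply/seteqP; split => [_ [a aO <-]|a aO]; [rewrite mul1r|exists a; rewrite ?mul1r].
Qed.

Lemma principal_omodule (f : F) : omodule (principal_ideal f).
Proof.
split.
- by exists 0; [exact: OF0|rewrite mulr0].
- by move=> _ _ [a aO <-] [b bO <-]; exists (a + b); [exact: OFD|rewrite mulrDr].
- by move=> a _ aO [b bO <-]; exists (a * b); [exact: OFM|rewrite mulrCA].
Qed.

(** For f = a / b with [a], [b] integral, the difference of the divisors of a O_F and b O_F has
    ideal f O_F, and by [ideal_of_inj] it is the divisor that [ords] picks. The second half is the
    finite side of the product formula. *)
Lemma ords_frac (f : F) : f != 0 ->
  ideal_of (ords f) = principal_ideal f /\ lognorm (ords f) = ln (absemb S f).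
Proof.
move=> f0; have [a [b [aO bO b0 fab]]] := frac_OF f.
have a0 : a != 0 by apply: contraNneq f0 => a0; rewrite fab a0 mul0r.
have [x [xe xE]] := nonzero_ideal_of (principal_nonzero aO a0).
have [y [ye yE]] := nonzero_ideal_of (principal_nonzero bO b0).
have xyE : ideal_of (x - y) = principal_ideal f.
  apply: (@idealM_cancel y); [exact: ideal_of_omodule|exact: principal_omodule|].
  by rewrite -ideal_ofD addrC subrK xE yE principalM fab mulrC divfK.
have ordsE : ords f = x - y.
  by apply: ideal_of_inj; rewrite xyE /ords; case: xgetP => [//|/(_ (x - y))].
rewrite ordsE; split => //.
rewrite lognormD lognormN !lognorm_effective// xE yE !(absnorm_principal S)//.
have := absembM S f b; rewrite {1}fab divfK// => ->.
by rewrite lnM ?addrK// posrE; exact: absemb_gt0.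
Qed.

Lemma ideal_of_ords (f : F) : f != 0 -> ideal_of (ords f) = principal_ideal f.
Proof. by move=> /ords_frac[]. Qed.

Lemma ordsM (f g : F) : f != 0 -> g != 0 -> ords (f * g) = ords f + ords g.
Proof.
move=> f0 g0; apply: ideal_of_inj; rewrite ideal_ofD !ideal_of_ords ?mulf_neq0//.
by rewrite principalM.
Qed.

End DivisorIdeals.

(** * Finiteness and countability *)

Section PrimesAbove.
Variables (R : realType) (F : fieldExtType rat) (r1 r2 : nat).
Variable S : infinitePrimes R F r1 r2.
Local Notation OF := (ringOfIntegers F).
Local Notation n := #|emb_index r1 r2|.
Implicit Types (P : nzprime F) (x y : findiv F).

(** If [d] clears the denominator of x^-1 for a nonzero [x] in P, then d = (d x^-1) x lies in P. *)
Lemma exists_nat_in_prime P : exists p : nat, (0 < p)%N && `[< val P (p%:R : F) >].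
Proof.
have nP := nzprime_nonzero P; have [x Px x0] := ideal_neq0 nP.
have [d d0 dO] := clear_denominator S x^-1.
exists d; rewrite d0; apply/asboolP; rewrite -[d%:R](divfK x0).
by have [_ _] := ideal_omodule nP; apply.
Qed.

Definition prime_below P := ex_minn (exists_nat_in_prime P).

(** By minimality of p = [prime_below P], the integers 0, ..., p - 1 are pairwise incongruent modulo
    P; hence the last bound. *)
Lemma prime_belowP P : [/\ (1 < prime_below P)%N, val P ((prime_below P)%:R : F) &
  (prime_below P <= absnorm (val P))%N].
Proof.
rewrite /prime_below; case: ex_minnP => p /andP[p0 /asboolP Pp] pmin.
have nP := nzprime_nonzero P; split => //.
  rewrite ltn_neqAle p0 andbT eq_sym; apply/eqP => p1.
  by apply: (@nzprimeN1 _ P); move: Pp; rewrite p1.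
have sP := ideal_subgroup nP.
apply: (@has_index_inj _ OF (val P) _ p (fun i => (i : nat)%:R) sP (absnormP S nP)).
  by move=> i; exact: OF_nat.
have lt (i j : 'I_p) : (j < i)%N -> ~ (val P) ((i : nat)%:R - (j : nat)%:R : F).
  move=> ji; rewrite -natrB ?(ltnW ji)// => Pij.
  have /pmin : (0 < i - j)%N && `[< val P ((i - j)%:R : F) >].
    by rewrite subn_gt0 ji; apply/asboolP.
  by rewrite leqNgt; case: i ji {Pij} => i ip /= ji; rewrite (leq_ltn_trans (leq_subr _ _) ip).
move=> i j Pij; apply: val_inj; case: (ltngtP i j) => // ij.
- by case: (lt _ _ ij); rewrite -opprB; exact: subgroupN.
- by case: (lt _ _ ij).
Qed.

Lemma absemb_nat (m : nat) : absemb S (m%:R : F) = m%:R ^+ n.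
Proof.
rewrite /absemb (eq_bigr (fun=> m%:R)) ?prodr_const// => t _.
by rewrite rmorph_nat -(rmorph_nat (real_complex R)) normcC ger0_norm.
Qed.

(* The divisor of p dominates the sum of the primes above p, each of norm at
   least p, while p has norm p ^ n. *)
Lemma card_primes_above p (s : seq (nzprime F)) : uniq s ->
  (forall P, P \in s -> prime_below P = p) -> (size s <= n)%N.
Proof.
move=> us sp; case: s us sp => [//|P0 s0] + sp; set s := P0 :: s0 => us.
have [p1 _ _] := prime_belowP P0; rewrite sp ?mem_head// in p1.
have p0 : (0 < p)%N by exact: ltnW.
have pF0 := natF_neq0 F p0; have pO := OF_nat F p.
have [xE xN] := ords_frac S pF0; set x := ords _ in xE xN.
have xe : effective x.
  by apply: (sub_effective S); rewrite xE; apply: principal_sub => //; exact: omodule_OF.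
have xs P : P \in s -> 1 <= coeff P x.
  move=> Ps; suff : 0 < coeff P x by move: (coeff P x) => c; lia.
  apply: (effective_coeff_gt0 S xe); rewrite xE; apply: principal_sub.
    exact/ideal_omodule/nzprime_nonzero.
  by have [_ + _] := prime_belowP P; rewrite sp.
have lnN_ge P : P \in s -> ln p%:R <= ln (absnorm (val P))%:R :> R.
  move=> Ps; have [_ _] := prime_belowP P; rewrite sp// => pP.
  by rewrite ler_ln ?posrE ?ltr0n ?ler_nat//; exact: leq_trans pP.
have lnp : 0 < ln p%:R :> R by rewrite ln_gt0// ltr1n.
have sx : {subset s <= dom x}.
  by move=> P /xs; rewrite mem_dom; apply: contraTneq => ->.
have key : (size s)%:R * ln p%:R <= lognorm R x.
  have -> : (size s)%:R * ln p%:R = \sum_(P <- s) (ln p%:R : R).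
    by rewrite big_const_seq count_predT iter_addr_0 mulr_natl.
  rewrite /lognorm [X in _ <= X](bigID (mem s)) /=.
  rewrite -[X in X <= _]addr0; apply: lerD; last first.
    apply: sumr_ge0 => P _; apply: mulr_ge0; last by rewrite ler0z.
    by apply: ln_ge0; rewrite ler1n; exact: ltnW (absnorm_gt1 S P).
  rewrite -[X in _ <= X]big_filter [X in _ <= X](perm_big s) /=.
    rewrite big_seq [X in _ <= X]big_seq; apply: ler_sum => P Ps.
    rewrite -[X in X <= _]mulr1; apply: ler_pM => //.
    - exact: ltW.
    - exact: lnN_ge.
    - by rewrite -[1]/(1%:~R) ler_int xs.
  apply: uniq_perm => //; first exact/filter_uniq/uniq_dom.
  by move=> P; rewrite mem_filter /=; case: (boolP (P \in s)) => // /sx ->.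
move: key; rewrite xN absemb_nat lnXn ?ltr0n// -[ln _ *+ _]mulr_natl ler_pM2r// ler_nat.
by [].
Qed.

Lemma countable_nzprime : countable [set: nzprime F].
Proof.
have -> : [set: nzprime F] = \bigcup_(p in [set: nat]) [set P | prime_below P = p].
  by apply/seteqP; split => // P _; exists (prime_below P).
apply: bigcup_countable => // p _; apply: finite_set_countable.
apply: contrapT => /(@infinite_set_fset _ _ n.+1)[X Xp].
rewrite leqNgt => /negP; apply; rewrite ltnS.
by apply: (@card_primes_above p X (fset_uniq X)) => P PX; exact: Xp.
Qed.

(** A divisor is encoded by the list of its coefficients with the indices of their primes.
    Countability makes the counting measure sigma-finite, as Fubini's theorem requires. *)
Lemma countable_findiv : countable [set: findiv F].
Proof.
have /countable_injP[f fi] := countable_nzprime.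
pose g (x : findiv F) : seq (int * nat) := [seq (coeff P x, f P) | P <- dom x].
apply/countable_injP; exists (choice.pickle \o g) => x y _ _ /= /(pcan_inj choice.pickleK) gxy.
have dxy : dom x = dom y.
  have : map f (dom x) = map f (dom y).
    have := congr1 (map snd) gxy; by rewrite -!map_comp.
  by apply: inj_map => P Q /fi; apply; rewrite inE.
apply/eqP/freeg_eqP => P; case: (boolP (P \in dom x)) => Px.
  by move: gxy; rewrite /g -dxy => /eq_in_map/(_ P Px)[].
by rewrite !coeff_outdom// -dxy.
Qed.

Lemma countable_field : countable [set: F].
Proof.
have [e [d [_ _ _ span _]]] := integral_basis S.
have [a aP] := choice span.
apply/countable_injP; exists (choice.pickle \o a) => f g _ _ /= /(pcan_inj choice.pickleK) afg.
by rewrite (aP f) (aP g) afg.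
Qed.

End PrimesAbove.

(** * Units of absolute value 1 and roots of unity *)

Section RootsOfUnity.
Variables (R : realType) (F : fieldExtType rat) (r1 r2 : nat).
Variable S : infinitePrimes R F r1 r2.
Local Notation OF := (ringOfIntegers F).
Local Notation n := #|emb_index r1 r2|.

Definition roots_of_unity : set F := [set x : F | exists2 m : nat, (0 < m)%N & x ^+ m = 1].

(** The kernel of f |-> (f); [unit_moduliE] identifies it with the roots of unity. *)
Definition unit_moduli : set F :=
  [set x | [/\ x != 0, ords x = 0 & forall t, normc (emb S t x) = 1]].

Lemma ords_eq0 (x : F) : x != 0 -> ords x = 0 -> OF x /\ OF x^-1.
Proof.
move=> x0 xord; have := ideal_of_ords S x0; rewrite xord ideal_of0 => OE.
have : OF x by rewrite OE; exact: principal_mem.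
split=> //; have : OF 1 by exact: OF1.
rewrite [X in X 1]OE => -[a aO xa].
by have -> : x^-1 = a by apply: (mulfI x0); rewrite xa divff.
Qed.

Lemma unit_moduliM x y : unit_moduli x -> unit_moduli y -> unit_moduli (x * y).
Proof.
move=> [x0 xo xm] [y0 yo ym]; split; first by rewrite mulf_neq0.
  by rewrite (ordsM S)// xo yo addr0.
by move=> t; rewrite rmorphM normcM xm ym mulr1.
Qed.

Lemma unit_moduli1 : unit_moduli 1.
Proof.
split; [exact: oner_neq0| |by move=> t; rewrite rmorph1 normc1].
apply: (ideal_of_inj S); rewrite ideal_of0 (ideal_of_ords S) ?oner_neq0//.
exact: principal1.
Qed.

(* If x - y = 3 u with u <> 0, then the norm of x - y is at least 3 ^ n; but
   each absolute value of x - y is at most 2. *)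
Lemma unit_moduli_congr3 x y : unit_moduli x -> unit_moduli y ->
  principal_ideal 3%:R (x - y) -> x = y.
Proof.
move=> [x0 xo xm] [y0 yo ym] [u uO uE]; apply/eqP; rewrite -subr_eq0 -uE mulf_eq0.
apply/orP; right; apply: contraT => u0.
have N1 : 1 <= absemb S u.
  by rewrite -(absnorm_principal S)// ler1n (absnorm_gt0 S)//; exact: principal_nonzero.
have : absemb S (3%:R * u) <= 2%:R ^+ n.
  rewrite uE /absemb -prodr_const; apply: ler_prod => t _; rewrite normc_ge0 /=.
  rewrite rmorphB; apply: le_trans (ler_normcD _ _) _.
  by rewrite normc_opp xm ym.
rewrite absembM absemb_nat => H.
have : (3%:R : R) ^+ n <= 2%:R ^+ n.
  by apply: le_trans H; rewrite ler_peMr// exprn_ge0.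
rewrite ler_pXn2r ?nnegrE// ?emb_index_gt0//; last exact: (emb_index_gt0 S).
by rewrite ler_nat.
Qed.

Lemma index3 : exists N, has_index OF (principal_ideal (3%:R : F)) N.
Proof.
have [N hN _] := has_index_principal_fin S (OF_nat F 3) (natF_neq0 F (ltn0Sn 2)).
by exists N.
Qed.

Lemma unit_moduliX x k : unit_moduli x -> unit_moduli (x ^+ k).
Proof.
move=> xu; elim: k => [|k IH]; first by rewrite expr0; exact: unit_moduli1.
by rewrite exprS; exact: unit_moduliM.
Qed.

(** Two powers of [x] agree modulo 3 O_F, which has finite index, and are then equal by
    [unit_moduli_congr3]. Conversely, a root of unity and its inverse are integral. *)
Lemma unit_moduliE : unit_moduli = roots_of_unity.
Proof.
apply/seteqP; split => x.
  move=> xu; have [x0 xo xm] := xu; have [xO _] := ords_eq0 x0 xo.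
  have [N hN] := index3.
  have [i [j [ij]]] := has_index_pigeon (principal_subgroup _) hN (fun k => OFX k xO).
  move=> /(unit_moduli_congr3 (unit_moduliX _ xu) (unit_moduliX _ xu)) xij.
  exists (j - i)%N; rewrite ?subn_gt0//.
  apply: (mulfI (expf_neq0 i x0)); rewrite -exprD subnKC ?mulr1//.
  exact: ltnW.
move=> [m m0 xm].
have x0 : x != 0.
  by apply: contra_eqN xm => /eqP ->; rewrite expr0n -(prednK m0) /= eq_sym oner_eq0.
have OFroot (y : F) : y ^+ m = 1 -> OF y.
  move=> ym; exists ('X^m - 1); first exact: monicXnsubC.
  by apply/rootP; rewrite rmorphB rmorph1 /= map_polyXn hornerD hornerN hornerXn hornerC ym subrr.
have xO := OFroot _ xm; have xVO : OF x^-1 by apply: OFroot; rewrite exprVn xm invr1.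
split=> //.
  apply: (ideal_of_inj S); rewrite ideal_of0 (ideal_of_ords S)//.
  apply/seteqP; split; first by apply: principal_sub => //; exact: omodule_OF.
  by move=> a aO; exists (x^-1 * a); [exact: OFM|rewrite mulVKf].
move=> t; apply/eqP; rewrite -(@pexpr_eq1 _ _ m)// ?normc_ge0//; apply/eqP.
transitivity (normc (emb S t (x ^+ m))); last by rewrite xm rmorph1 normc1.
elim: (m) => [|k IH]; first by rewrite !expr0 rmorph1 normc1.
by rewrite !exprS IH rmorphM normcM.
Qed.

(** Each of the finitely many classes modulo 3 O_F contains at most one root of unity; [g] picks it
    where it exists. *)
Lemma finite_roots_of_unity : finite_set roots_of_unity.
Proof.
rewrite -unit_moduliE; have [N [r [_ rc _]]] := index3.
have /choice[g gP] : forall i : 'I_N, exists y, forall x, unit_moduli x ->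
    principal_ideal 3%:R (x - r i) -> x = y.
  move=> i; have [[y [yu yr]]|nex] :=
      pselect (exists y, unit_moduli y /\ principal_ideal 3%:R (y - r i)).
    exists y => x xu xr; apply: unit_moduli_congr3 => //.
    have := (principal_subgroup (3%:R : F)).2 _ _ xr yr.
    by rewrite opprB addrA subrK.
  by exists 0 => x xu xr; case: nex; exists x.
apply: (@sub_finite_set _ _ (range g)); last exact/finite_image/finite_finset.
move=> x xu; have [x0 xo _] := xu; have [xO _] := ords_eq0 x0 xo.
by have [i xi] := rc _ xO; exists i => //; rewrite (gP i x).
Qed.

Lemma num_roots_of_unity_gt0 : (0 < num_roots_of_unity F)%N.
Proof.
rewrite /num_roots_of_unity -/roots_of_unity cardfs_gt0; apply/fset0Pn; exists 1.
rewrite in_fset_set; last exact: finite_roots_of_unity.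
by rewrite inE; exists 1%N => //; rewrite expr1n.
Qed.

End RootsOfUnity.

(** * Convergence of the Dedekind zeta function *)

Section ZetaConvergence.
Variables (R : realType) (F : fieldExtType rat) (r1 r2 : nat).
Variable S : infinitePrimes R F r1 r2.
Local Notation n := #|emb_index r1 r2|.
Implicit Types (P : nzprime F) (x y : findiv F).
Variable sigma : R.
Hypothesis sigma_gt1 : 1 < sigma.

Local Notation npow m := (expR (- sigma * ln m%:R)).

Lemma npow_pow2 k : npow (2 ^ k)%N *+ (2 ^ k) = (expR ((1 - sigma) * ln 2)) ^+ k.
Proof.
have e : (2 ^ k)%N%:R = expR (ln (2 ^ k)%N%:R) :> R.
  by rewrite lnK// posrE ltr0n expn_gt0.
rewrite -[LHS]mulr_natr [X in _ * X = _]e -expRD -expRM_natr natrX lnXn// -![ln _ *+ _]mulr_natr.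
congr expR; ring.
Qed.

Lemma npow_le m m' : (0 < m)%N -> (m <= m')%N -> npow m' <= npow m.
Proof.
move=> m0 mm'; rewrite ler_expR !mulNr lerN2 ler_pM2l ?(lt_trans _ sigma_gt1)//.
by rewrite ler_ln ?posrE ?ltr0n ?ler_nat//; exact: leq_trans mm'.
Qed.

(** Cauchy condensation: the 2^k terms from 2^k to 2^(k+1) - 1 are at most the first of them, so the
    dyadic blocks are dominated by a geometric series of ratio 2^(1 - sigma) < 1. *)
Lemma sum_npow_bounded : exists2 C : R, 0 <= C & forall M, \sum_(m < M) npow m.+1 <= C.
Proof.
set q := expR ((1 - sigma) * ln 2).
have q1 : q < 1.
  by rewrite -expR0 ltr_expR nmulr_rlt0 ?subr_lt0// ln_gt0// ltr1n.
have q0 : 0 < q by exact: expR_gt0.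
have dy k : \sum_(1 <= m < 2 ^ k) npow m <= \sum_(j < k) q ^+ j.
  elim: k => [|k IH]; first by rewrite big_geq// big_ord0.
  rewrite (@big_cat_nat _ _ _ (2 ^ k)%N) ?expn_gt0 ?leq_exp2l//= big_ord_recr /=.
  apply: lerD => //; rewrite -npow_pow2.
  have -> : npow (2 ^ k)%N *+ 2 ^ k = \sum_(2 ^ k <= m < 2 ^ k.+1) npow (2 ^ k)%N.
    rewrite big_const_nat iter_addr_0; congr (_ *+ _).
    by rewrite expnS mul2n -addnn addnK.
  apply: ler_sum_nat => m /andP[km _]; apply: npow_le => //.
  by rewrite expn_gt0.
exists (1 - q)^-1; first by rewrite invr_ge0 subr_ge0 ltW.
move=> M; apply: (@le_trans _ _ (\sum_(1 <= m < 2 ^ M) npow m)).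
  rewrite -(big_mkord xpredT (fun m => npow m.+1)) -(big_add1 _ _ _ M.+1 xpredT (fun m => npow m)).
  rewrite [X in _ <= X](@big_cat_nat _ _ _ M.+1)//=; last exact: ltn_expl.
  by rewrite lerDl sumr_ge0// => i _; exact: expR_ge0.
apply: le_trans (dy _) _.
rewrite -[X in _ <= X]div1r ler_pdivlMr ?subr_gt0//.
have -> : (\sum_(j < M) q ^+ j) * (1 - q) = 1 - q ^+ M.
  by rewrite -[RHS]opprB subrX1 mulrC -mulNr opprB.
by rewrite gerBl exprn_ge0// ltW.
Qed.

Lemma npow_half m : (1 < m)%N -> npow m <= 2^-1.
Proof.
move=> m1; apply: (@le_trans _ _ (npow 2)); first exact: npow_le.
rewrite -[X in _ <= X]lnK ?posrE ?invr_gt0// lnV ?posrE// ler_expR mulNr lerN2.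
by rewrite ler_peMl ?ln_ge0 ?ler1n// ltW.
Qed.

(** The norm of P is at least [prime_below P], and at most [n] primes share that value; the sum is
    thus bounded by [n] times the sum over all positive integers. *)
Lemma sum_primes_bounded : exists2 C : R, 0 <= C &
  forall s : seq (nzprime F), uniq s -> \sum_(P <- s) npow (absnorm (val P)) <= C.
Proof.
have [C C0 Cb] := sum_npow_bounded; exists (n%:R * C); first exact: mulr_ge0.
move=> s us; pose M := (\max_(P <- s) prime_below S P).
apply: (@le_trans _ _ (\sum_(P <- s) npow (prime_below S P))).
  apply: ler_sum => P _; have [p1 _ pN] := prime_belowP S P.
  by apply: npow_le => //; exact: ltnW.
pose g P : 'I_M.+1 := inord (prime_below S P).-1.
have gE P : P \in s -> (g P).+1 = prime_below S P.
  move=> Ps; have [/ltnW p0 _ _] := prime_belowP S P; rewrite /g inordK ?prednK//.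
  by apply: leqW; exact: (leq_bigmax_seq P Ps isT).
rewrite (partition_big g xpredT)//= -[n%:R * C]mulrC.
apply: (@le_trans _ _ (\sum_(j < M.+1) npow j.+1 * n%:R)); last first.
  by rewrite -mulr_suml; apply: ler_wpM2r.
apply: ler_sum => j _; rewrite -big_filter.
have -> : \sum_(P <- [seq P <- s | g P == j]) npow (prime_below S P) =
    \sum_(P <- [seq P <- s | g P == j]) npow j.+1.
  rewrite big_seq [RHS]big_seq; apply: eq_bigr => P.
  by rewrite mem_filter => /andP[/eqP <- Ps]; rewrite gE.
rewrite big_const_seq count_predT iter_addr_0 -[X in X <= _]mulr_natr ler_wpM2l ?expR_ge0//.
rewrite ler_nat; apply: (@card_primes_above R F r1 r2 S j.+1); first exact: filter_uniq.
by move=> P; rewrite mem_filter => /andP[/eqP <- Ps]; rewrite gE.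
Qed.

Lemma lognorm_prod (s : seq (nzprime F)) x : effective x -> uniq s ->
  {subset dom x <= s} ->
  expR (- sigma * lognorm R x) =
  \prod_(P <- s) npow (absnorm (val P)) ^+ `|coeff P x|%N.
Proof.
move=> xe us xs; rewrite lognormE (freeg_big_widen _ _ us xs); last by move=> P; rewrite mulr0.
rewrite mulr_sumr expR_sum; apply: eq_bigr => P _.
rewrite -expRM_natr mulrA; congr (expR (_ * _)).
by rewrite -{1}(gez0_abs (xe P)).
Qed.

(** 1 / (1 - t) <= 1 + 2 t <= e^(2 t) on [0, 1/2]. The range is that of [npow_half], every prime
    having norm at least 2. *)
Lemma geometric_bound (t : R) K : 0 <= t <= 2^-1 -> \sum_(k < K) t ^+ k <= expR (2 * t).
Proof.
move=> /andP[t0 t1].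
have t1' : 0 < 1 - t by rewrite subr_gt0; lra.
apply: (@le_trans _ _ (1 - t)^-1).
  rewrite -[X in _ <= X]div1r ler_pdivlMr//.
  have -> : (\sum_(j < K) t ^+ j) * (1 - t) = 1 - t ^+ K.
    by rewrite -[RHS]opprB subrX1 mulrC -mulNr opprB.
  by rewrite gerBl exprn_ge0.
apply: (@le_trans _ _ (1 + 2 * t)); last exact: expR_ge1Dx.
rewrite -[X in X <= _]div1r ler_pdivrMr//; nra.
Qed.

(** The Euler product as an upper bound. A finite set of effective divisors involves finitely many
    primes [s] with exponents below some [K], so its sum is part of the expansion of the product
    over [s] of truncated geometric series; each factor is at most e^(2 t), and [sum_primes_bounded]
    bounds the sum of the [t]. *)
Lemma esum_effective_norm :
  (\esum_(x in [set x : findiv F | effective x]) (expR (- sigma * lognorm R x))%:E < +oo)%E.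
Proof.
have [C C0 Cb] := sum_primes_bounded.
apply: (@le_lt_trans _ _ (expR (2 * C))%:E); last exact: ltry.
apply: ge_ereal_sup => _ [X [finX Xe] <-].
rewrite fsbig_finite//= sumEFin lee_fin.
set L := fset_set X.
have Le x : x \in L -> effective x by rewrite in_fset_set// inE => /Xe.
pose s := undup (flatten [seq dom x | x <- L]).
have us : uniq s by exact: undup_uniq.
have xs x : x \in L -> {subset dom x <= s}.
  by move=> xL P Px; rewrite mem_undup; apply/flattenP; exists (dom x) => //; exact: map_f.
pose K := (\max_(x <- L) \max_(P <- s) `|coeff P x|%N).+1.
pose ts := in_tuple s; pose t i := npow (absnorm (val (tnth ts i))).
pose h x : {ffun 'I_(size s) -> 'I_K} := [ffun i => inord `|coeff (tnth ts i) x|%N].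
have hE x i : x \in L -> h x i = `|coeff (tnth ts i) x|%N :> nat.
  move=> xL; rewrite ffunE inordK// ltnS.
  apply: leq_trans (leq_bigmax_seq x xL isT).
  exact: (leq_bigmax_seq (F := fun P => `|coeff P x|%N) (tnth ts i) (mem_tnth i ts) isT).
have hinj : {in L &, injective h}.
  move=> x y xL yL hxy; apply/eqP/freeg_eqP => P.
  case: (boolP (P \in s)) => Ps; last first.
    by rewrite !coeff_outdom//; apply: contra Ps; exact: xs.
  have /tnthP[i ->] : P \in ts by [].
  rewrite -(gez0_abs (Le _ xL (tnth ts i))) -(gez0_abs (Le _ yL (tnth ts i))).
  by rewrite -!hE// hxy.
have sumE : \sum_(x <- L) expR (- sigma * lognorm R x) =
    \sum_(f <- map h L) \prod_i t i ^+ f i.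
  rewrite big_map big_seq [RHS]big_seq; apply: eq_bigr => x xL.
  rewrite (lognorm_prod (Le _ xL) us (xs _ xL)) (big_tnth _ _ s).
  by apply: eq_bigr => i _; rewrite hE.
have t12 i : 0 <= t i <= 2^-1.
  by rewrite expR_ge0 /=; apply: npow_half; exact: (absnorm_gt1 S).
rewrite sumE; apply: (@le_trans _ _ (\sum_(f : {ffun 'I_(size s) -> 'I_K}) \prod_i t i ^+ f i)).
  have uh : uniq (map h L) by rewrite map_inj_in_uniq ?fset_uniq.
  rewrite big_uniq//= [X in _ <= X](bigID (mem (map h L)))/= lerDl.
  apply: sumr_ge0 => f _; apply: prodr_ge0 => i _; apply: exprn_ge0.
  by case/andP: (t12 i).
rewrite -(bigA_distr_bigA (fun i (k : 'I_K) => t i ^+ k)).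
apply: (@le_trans _ _ (\prod_i expR (2 * t i))).
  apply: ler_prod => i _; rewrite geometric_bound ?t12// andbT.
  by apply: sumr_ge0 => k _; apply: exprn_ge0; case/andP: (t12 i).
rewrite -expR_sum ler_expR -mulr_sumr ler_pM2l//.
apply: le_trans (Cb s us); by rewrite (big_tnth _ _ s).
Qed.

End ZetaConvergence.

(** * Integration of complex-valued functions *)

Section ComplexIntegral.
Variable R : realType.
Local Notation Re := (@complex.Re R).
Local Notation Im := (@complex.Im R).

Lemma ler_Re_normc (z : R[i]) : `|Re z| <= normc z.
Proof. by case: z => a b; rewrite -sqrtr_sqr ler_sqrt ?lerDl ?addr_ge0 ?sqr_ge0. Qed.

Lemma ler_Im_normc (z : R[i]) : `|Im z| <= normc z.
Proof. by case: z => a b; rewrite -sqrtr_sqr ler_sqrt ?lerDr ?addr_ge0 ?sqr_ge0. Qed.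

Lemma ReCM (x y : R[i]) : Re (x * y) = Re x * Re y - Im x * Im y.
Proof. by case: x y => [a b] [c d]. Qed.

Lemma ImCM (x y : R[i]) : Im (x * y) = Re x * Im y + Im x * Re y.
Proof. by case: x y => [a b] [c d]. Qed.

Lemma measurable_normc d (T : measurableType d) (D : set T) (f : T -> R[i]) :
  measurable_fun D (fun x => Re (f x)) -> measurable_fun D (fun x => Im (f x)) ->
  measurable_fun D (fun x => normc (f x)).
Proof.
move=> mR mI.
have -> : (fun x => normc (f x)) =
    (fun x => Num.sqrt (Re (f x) ^+ 2 + Im (f x) ^+ 2)).
  by apply/funext => x; rewrite /normc; case: (f x).
apply: (@measurableT_comp _ _ _ _ _ _ (@Num.sqrt R)).
  by apply: continuous_measurable_fun => x; exact: sqrt_continuous.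
by apply: measurable_funD; apply: measurable_funX.
Qed.

Section Basic.
Context d (T : measurableType d) (mu : {measure set T -> \bar R}).
Implicit Types f g : T -> R[i].

Lemma cintegrable_Re f : cintegrable mu setT f -> mu.-integrable setT (EFin \o (Re \o f)).
Proof.
move=> [mR mI foo]; apply/integrableP; split; first exact/measurable_EFinP.
apply: le_lt_trans foo; apply: ge0_le_integral => //=.
- exact/measurable_EFinP/measurableT_comp.
- exact/measurable_EFinP/measurable_normc.
- by move=> x _; rewrite lee_fin ler_Re_normc.
Qed.

Lemma cintegrable_Im f : cintegrable mu setT f -> mu.-integrable setT (EFin \o (Im \o f)).
Proof.
move=> [mR mI foo]; apply/integrableP; split; first exact/measurable_EFinP.
apply: le_lt_trans foo; apply: ge0_le_integral => //=.
- exact/measurable_EFinP/measurableT_comp.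
- exact/measurable_EFinP/measurable_normc.
- by move=> x _; rewrite lee_fin ler_Im_normc.
Qed.

Lemma cintegralZ (c : R[i]) f : cintegrable mu setT f ->
  cintegral mu setT (fun x => c * f x) = c * cintegral mu setT f.
Proof.
move=> fi; have iR := cintegrable_Re fi; have iI := cintegrable_Im fi.
apply/eqP; rewrite eq_complex ReCM ImCM /cintegral /=; apply/andP; split; apply/eqP.
- under eq_Rintegral do rewrite ReCM.
  rewrite RintegralB//; [|exact: (integrableZl _ _ iR)|exact: (integrableZl _ _ iI)].
  by rewrite (RintegralZl _ _ iR)// (RintegralZl _ _ iI).
- under eq_Rintegral do rewrite ImCM.
  rewrite RintegralD//; [|exact: (integrableZl _ _ iI)|exact: (integrableZl _ _ iR)].
  by rewrite (RintegralZl _ _ iR)// (RintegralZl _ _ iI).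
Qed.

End Basic.

Section Product.
Context d1 d2 (T1 : measurableType d1) (T2 : measurableType d2).
Variable m1 : {sigma_finite_measure set T1 -> \bar R}.
Variable m2 : {sigma_finite_measure set T2 -> \bar R}.

Lemma measurable_fun_prodM (u : T1 -> R) (v : T2 -> R) :
  measurable_fun setT u -> measurable_fun setT v ->
  measurable_fun setT (fun z : T1 * T2 => u z.1 * v z.2).
Proof.
by move=> mu mv; apply: measurable_funM; apply: measurableT_comp.
Qed.

Lemma ge0_integral_prodM (u : T1 -> R) (v : T2 -> R) :
  measurable_fun setT u -> measurable_fun setT v ->
  (forall x, 0 <= u x) -> (forall y, 0 <= v y) ->
  (\int[m1 \x m2]_z (u z.1 * v z.2)%:E =
   \int[m1]_x (u x)%:E * \int[m2]_y (v y)%:E)%E.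
Proof.
move=> mu mv u0 v0; have muv : measurable_fun setT (fun z : T1 * T2 => (u z.1 * v z.2)%:E).
  by apply/measurable_EFinP; exact: measurable_fun_prodM.
rewrite fubini_tonelli1//; last by move=> z; rewrite lee_fin mulr_ge0.
rewrite /fubini_F /=.
transitivity (\int[m1]_x ((u x)%:E * \int[m2]_y (v y)%:E))%E.
  apply: eq_integral => x _; under eq_integral do rewrite EFinM.
  rewrite ge0_integralZl//; first exact/measurable_EFinP.
  - by move=> y _; rewrite lee_fin.
  - by rewrite lee_fin.
rewrite ge0_integralZr//.
- exact/measurable_EFinP.
- by move=> x _; rewrite lee_fin.
- by apply: integral_ge0 => y _; rewrite lee_fin.
Qed.

Lemma Rintegral_prodM (u : T1 -> R) (v : T2 -> R) :
  m1.-integrable setT (EFin \o u) -> m2.-integrable setT (EFin \o v) ->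
  (m1 \x m2)%E.-integrable setT (EFin \o (fun z => u z.1 * v z.2)) /\
  Rintegral (m1 \x m2)%E setT (fun z => u z.1 * v z.2) =
  Rintegral m1 setT u * Rintegral m2 setT v.
Proof.
move=> iu iv; have /integrableP[/measurable_EFinP mu uoo] := iu.
have /integrableP[/measurable_EFinP mv voo] := iv.
have iuv : (m1 \x m2)%E.-integrable setT (EFin \o (fun z => u z.1 * v z.2)).
  apply/integrableP; split; first by apply/measurable_EFinP; exact: measurable_fun_prodM.
  under eq_integral do rewrite /= normrM.
  rewrite (@ge0_integral_prodM (fun x => `|u x|) (fun y => `|v y|))//.
  - by rewrite lte_mul_pinfty// ?ge0_fin_numE// integral_ge0.
  - exact: measurableT_comp.
  - exact: measurableT_comp.
split=> //; rewrite {1}/Rintegral -(integral12_prod_meas1 iuv) /fubini_F /=.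
have -> : (\int[m1]_x \int[m2]_y (u x * v y)%:E =
    \int[m1]_x (u x * Rintegral m2 setT v)%:E)%E.
  apply: eq_integral => x _; under eq_integral do rewrite EFinM.
  by rewrite integralZl// EFinM fineK//; exact: integrable_fin_num.
exact: RintegralZr.
Qed.

Lemma cintegral_prodM (f : T1 -> R[i]) (g : T2 -> R[i]) :
  cintegrable m1 setT f -> cintegrable m2 setT g ->
  cintegrable (m1 \x m2)%E setT (fun z => f z.1 * g z.2) /\
  cintegral (m1 \x m2)%E setT (fun z => f z.1 * g z.2) =
  cintegral m1 setT f * cintegral m2 setT g.
Proof.
move=> fi gi; have [mfR mfI foo] := fi; have [mgR mgI goo] := gi.
have fR := cintegrable_Re fi; have fI := cintegrable_Im fi.
have gR := cintegrable_Re gi; have gI := cintegrable_Im gi.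
have [iRR eRR] := Rintegral_prodM fR gR; have [iII eII] := Rintegral_prodM fI gI.
have [iRI eRI] := Rintegral_prodM fR gI; have [iIR eIR] := Rintegral_prodM fI gR.
split; first split.
- under eq_fun do rewrite ReCM.
  by apply: measurable_funB; apply: (measurable_fun_prodM (u := _ \o _) (v := _ \o _)).
- under eq_fun do rewrite ImCM.
  by apply: measurable_funD; apply: (measurable_fun_prodM (u := _ \o _) (v := _ \o _)).
- under eq_integral do rewrite normcM.
  rewrite (@ge0_integral_prodM (fun x => normc (f x)) (fun y => normc (g y))).
  + by rewrite lte_mul_pinfty// ?integral_ge0// ?ge0_fin_numE ?integral_ge0// => x _;
      rewrite lee_fin normc_ge0.
  + exact: measurable_normc.
  + exact: measurable_normc.
  + by move=> x; exact: normc_ge0.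
  + by move=> x; exact: normc_ge0.
apply/eqP; rewrite eq_complex ReCM ImCM /cintegral /=; apply/andP; split; apply/eqP.
- rewrite -eRR -eII -RintegralB//.
  by apply: eq_Rintegral => z _; exact: ReCM.
- rewrite -eRI -eIR -RintegralD//.
  by apply: eq_Rintegral => z _; exact: ImCM.
Qed.

End Product.

Lemma cintegral_pushforward d1 d2 (T1 : measurableType d1) (T2 : measurableType d2)
    (mu : {measure set T1 -> \bar R}) (nu : {measure set T2 -> \bar R})
    (phi : T1 -> T2) (f : T2 -> R[i]) :
  measurable_fun setT phi -> (nu : set T2 -> \bar R) = pushforward mu phi ->
  measurable_fun setT (fun y => Re (f y)) -> measurable_fun setT (fun y => Im (f y)) ->
  cintegrable mu setT (f \o phi) ->
  cintegrable nu setT f /\ cintegral nu setT f = cintegral mu setT (f \o phi).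
Proof.
move=> mphi nuE mR mI fi; have [_ _ foo] := fi; split; first split => //.
  rewrite nuE ge0_integral_pushforward//.
  - exact/measurable_EFinP/measurable_normc.
  - by move=> y _; rewrite lee_fin normc_ge0.
rewrite /cintegral /Rintegral; congr (Complex (fine _) (fine _)).
- rewrite nuE integral_pushforward//; first exact/measurable_EFinP.
  exact: (cintegrable_Re fi).
- rewrite nuE integral_pushforward//; first exact/measurable_EFinP.
  exact: (cintegrable_Im fi).
Qed.

End ComplexIntegral.

Section TupleIntegral.
Variable R : realType.
Local Notation Re := (@complex.Re R).
Local Notation Im := (@complex.Im R).

Lemma measurable_cprod d (T : measurableType d) (D : set T) (I : Type) (r : seq I)
    (h : I -> T -> R[i]) : measurable D ->
  (forall i, measurable_fun D (fun x => Re (h i x))) ->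
  (forall i, measurable_fun D (fun x => Im (h i x))) ->
  measurable_fun D (fun x => Re (\prod_(i <- r) h i x)) /\
  measurable_fun D (fun x => Im (\prod_(i <- r) h i x)).
Proof.
move=> mD hR hI; elim: r => [|i r [IHR IHI]].
  by split; under eq_fun do rewrite big_nil; exact: measurable_cst.
split; under eq_fun do rewrite big_cons.
- under eq_fun do rewrite ReCM.
  by apply: measurable_funB; apply: measurable_funM.
- under eq_fun do rewrite ImCM.
  by apply: measurable_funD; apply: measurable_funM.
Qed.

(** The induction follows the construction of [lebesgue_tuple] as an image of product measures under
    [consT], starting from a unit mass. *)
Lemma cintegral_tuple n (g : 'I_n -> measurableTypeR R -> R[i]) :
  (forall k, cintegrable (@lebesgue_measure R) setT (g k)) ->
  let f := fun v : n.-tuple (measurableTypeR R) => \prod_k g k (tnth v k) in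
  cintegrable (lebesgue_tuple R n) setT f /\
  cintegral (lebesgue_tuple R n) setT f =
    \prod_k cintegral (@lebesgue_measure R) setT (g k).
Proof.
elim: n g => [|n IH] g gi f.
  have fE : f = cst 1 by apply/funext => v; rewrite /f big_ord0.
  rewrite fE big_ord0; split; first split.
  - exact: measurable_cst.
  - exact: measurable_cst.
  - under eq_integral do rewrite normc1.
    by rewrite integral_dirac// diracT mul1e ltry.
  - rewrite /cintegral /Rintegral /=.
    by rewrite !integral_dirac// diracT !mul1e.
have [fR fI] : measurable_fun setT (fun v => Re (f v)) /\ measurable_fun setT (fun v => Im (f v)).
  apply: measurable_cprod => // i; have [mR mI _] := gi i.
  - by apply: (measurableT_comp mR); exact: measurable_tnth.
  - by apply: (measurableT_comp mI); exact: measurable_tnth.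
pose g' k := g (fintype.lift ord0 k).
have [fi' fE'] := IH g' (fun k => gi _).
have fE : f \o @consT R n = fun z => g ord0 z.1 * \prod_k g' k (tnth z.2 k).
  apply/funext => z; rewrite /f /= big_ord_recl; congr (_ * _).
  by apply: eq_bigr => k _; rewrite /g' tnthS.
have [pi pE] := cintegral_prodM (gi ord0) fi'.
rewrite -fE in pi pE.
have [] := cintegral_pushforward (@measurable_consT R n) (nu := leb_step (lebesgue_tuple R n)) erefl fR fI pi.
by move=> fi ->; split => //; rewrite pE fE' [RHS]big_ord_recl.
Qed.

End TupleIntegral.

(** * Sums as integrals against the counting measure *)

Section CountingIntegral.
Variables (R : realType) (d : measure_display) (T : measurableType d).
Hypothesis mT : forall A : set T, measurable A.
Hypothesis cT : countable [set: T].

Lemma measurable_fun_discrete d' (U : measurableType d') (D : set T) (f : T -> U) :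
  measurable_fun D f.
Proof. by move=> _ B _; exact: mT. Qed.

Lemma sigma_finite_counting_countable : sigma_finite setT (@counting T R).
Proof.
have /countable_injP[f fi] := cT.
exists (fun n => [set x | f x = n]); first by apply/seteqP; split => // x _; exists (f x).
move=> n; split => //; rewrite /counting; case: asboolP => [_|]; first by rewrite ltry.
case; apply: contrapT => /(@infinite_set_fset _ _ 2)[X Xn].
rewrite leqNgt => /negP; apply.
have X1 x y : x \in X -> y \in X -> x = y.
  by move=> /Xn /= xn /Xn /= yn; apply: fi; rewrite ?inE// xn yn.
rewrite ltnS -[X in (X <= _)%N]/(size (enum_fset X)).
have := fset_uniq X; case E : (enum_fset X) => [|x [|y s]] //=.
have Xe z : (z \in X) = (z \in enum_fset X) by [].
by rewrite inE (X1 x y) ?Xe ?E ?inE ?eqxx ?orbT.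
Qed.

(** The fibres of an injection into the natural numbers are empty or single points, which turns the
    integral into a countable series. *)
Lemma ge0_integral_counting (f : T -> \bar R) : (forall x, 0 <= f x)%E ->
  (\int[@counting T R]_x f x = \esum_(x in setT) f x)%E.
Proof.
move=> f0; have /countable_injP[g gi] := cT.
pose A n := [set x | g x = n].
have AT : [set: T] = \bigcup_n A n by apply/seteqP; split => // x _; exists (g x).
have tA : trivIset setT A.
  by apply/trivIsetP => i j _ _ /eqP ij; apply/seteqP; split => // x [xi xj]; apply: ij; rewrite -xi -xj.
rewrite AT ge0_integral_bigcup; [|by move=> k; exact: mT|by move=> _ B _; exact: mT|by []|by []].
rewrite esum_bigcupT// nneseries_esumT => [|n]; last exact: integral_ge0.
apply: eq_esum => n _.
have [[x Ax]|/set0P/negP/negPn/eqP ->] := pselect (A n !=set0); last first.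
  by rewrite integral_set0 esum_set0.
have -> : A n = [set x].
  apply/seteqP; split => [y Ay|_ ->//] /=.
  by apply: gi; rewrite ?inE//; rewrite Ay Ax.
rewrite esum_set1// (eq_integral (cst (f x))); last by move=> y; rewrite inE => ->.
rewrite integral_cst; last exact: mT.
rewrite /= /counting asboolT; last exact: finite_set1.
by rewrite fset_set1 cardfs1 mule1.
Qed.

Local Notation ext A f := (fun x => if x \in A then f x else 0).

(** Families on [A] are extended by zero because the integral runs over the whole type; absolute
    summability keeps the positive and negative parts finite. *)
Lemma rsum_Rintegral (A : set T) (u : T -> R) :
  (\esum_(x in A) `|u x|%:E < +oo)%E ->
  Rintegral (@counting T R) setT (ext A u) = rsum A u.
Proof.
move=> foo.
have E (v : T -> R) : (forall x, 0 <= v x) ->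
    (\esum_(x in A) (v x)%:E = \esum_(x in setT) (ext A v x)%:E)%E.
  by move=> v0; rewrite esum_mkcond; apply: eq_esum => x _; case: ifP.
have fin (v : T -> R) : (forall x, 0 <= v x <= `|u x|) -> (\esum_(x in A) (v x)%:E)%E \is a fin_num.
  move=> vu; rewrite ge0_fin_numE; last first.
    by apply: esum_ge0 => x _; rewrite lee_fin; case/andP: (vu x).
  by apply: le_lt_trans foo; apply: le_esum => x _; rewrite lee_fin; case/andP: (vu x).
rewrite /Rintegral /rsum integralE !ge0_integral_counting//.
have -> : (\esum_(x in setT) ((fun x => (ext A u x)%:E)^\+ x) = \esum_(i in A) (Num.max (u i) 0)%:E)%E.
  rewrite E => [|x]; last by rewrite le_max lexx orbT.
  by apply: eq_esum => x _; rewrite funeposE -EFin_max; case: ifP => //; rewrite maxxx.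
have -> : (\esum_(x in setT) ((fun x => (ext A u x)%:E)^\- x) = \esum_(i in A) (Num.max (- u i) 0)%:E)%E.
  rewrite E => [|x]; last by rewrite le_max lexx orbT.
  by apply: eq_esum => x _; rewrite funenegE -EFinN -EFin_max; case: ifP => //; rewrite oppr0 maxxx.
rewrite fineB// fin// => x; rewrite le_max lexx orbT ge_max normr_ge0 andbT.
- exact: ler_norm.
- by rewrite -normrN ler_norm.
Qed.

Lemma csum_cintegral (A : set T) (f : T -> R[i]) : csummable A f ->
  cintegrable (@counting T R) setT (ext A f) /\
  cintegral (@counting T R) setT (ext A f) = csum A f.
Proof.
rewrite /csummable /summable => foo; split; first split.
- exact: measurable_fun_discrete.
- exact: measurable_fun_discrete.
- rewrite ge0_integral_counting; last by move=> x; rewrite lee_fin normc_ge0.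
  apply: le_lt_trans foo; rewrite [X in (_ <= X)%E]esum_mkcond; apply: le_esum => x _.
  case: ifP => _; first by rewrite abse_EFin ger0_norm// normc_ge0.
  by rewrite /normc ComplexField.Normc.normc0.
have foo' (p : R[i] -> R) : (forall z, `|p z| <= normc z) ->
    (\esum_(x in A) `|p (f x)|%:E < +oo)%E.
  move=> pn; apply: le_lt_trans foo; apply: le_esum => x _.
  by rewrite lee_fin ger0_norm ?normc_ge0.
rewrite /csum -!rsum_Rintegral; last 2 first.
- exact/foo'/ler_Im_normc.
- exact/foo'/ler_Re_normc.
by congr Complex; apply: eq_Rintegral => x _; case: ifP.
Qed.

End CountingIntegral.

(** * The local integrals at infinity *)

Section LogSubstitution.
Variable R : realType.
Local Notation mu := (@lebesgue_measure R).
Variables (a c : R).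
Hypothesis a0 : 0 < a.

Let L (t : R) := (ln c - ln t) / a.

Let dL (t : R) : 0 < t -> is_derive t 1 L (- (a * t)^-1).
Proof.
move=> t0; have := is_derive1_ln t0 => dln.
apply: is_derive_eq.
by rewrite add0r mul1r scaler0 add0r scalerN invfM.
Qed.

Let dL1 (t : R) : 0 < t -> derive1 L t = - (a * t)^-1.
Proof. by move=> t0; rewrite derive1E; have [_ ->] := dL t0. Qed.

Let cV (t : R) : 0 < t -> - (a * x)^-1 @[x --> t] --> - (a * t)^-1.
Proof.
move=> t0; apply: cvgN; apply: cvgV; first by rewrite mulf_neq0// gt_eqF.
by apply: cvgM; [exact: cvg_cst|exact: cvg_id].
Qed.

Let near_gt0 (t : R) : 0 < t -> \forall x \near t, 0 < x.
Proof. exact: lt_nbhsr. Qed.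

(** For c > 0, [L] is the inverse of v |-> c exp(- a v). It is singular at 0; cutting at a positive
    [e] keeps the substitution where [L] is smooth. *)
Lemma ge0_log_substitution_itv (G : R -> R) (e : R) : 0 < e ->
  continuous G -> (forall x, 0 <= G x) ->
  (\int[mu]_(v in `]-oo, L e]) (G v)%:E =
   \int[mu]_(t in `[e, +oo[) (G (L t) / (a * t))%:E)%E.
Proof.
move=> e0 cG G0.
rewrite (@decreasing_ge0_integration_by_substitutiony _ L G e).
- apply: eq_integral => t; rewrite inE/= in_itv/= andbT => et.
  by rewrite -[LHS]/((G (L t) * - derive1 L t)%:E) dL1 ?opprK// (lt_le_trans e0).
- move=> x y; rewrite !in_itv/= !andbT => ex ey xy.
  rewrite /L ltr_pM2r ?invr_gt0// ltrD2l ltrN2 ltr_ln// posrE.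
  + exact: lt_le_trans ey.
  + exact: lt_le_trans ex.
- move=> x; rewrite in_itv/= andbT => ex; have x0 := lt_trans e0 ex.
  rewrite /continuous_at dL1//; apply: cvg_trans (cV x0); apply: near_eq_cvg.
  by near=> y; rewrite dL1//; near: y; exact: near_gt0.
- apply/cvg_ex; exists (- (a * e)^-1); apply: cvg_trans (cvg_at_right_filter (cV e0)).
  apply: near_eq_cvg; near=> y; rewrite dL1//.
  by apply: lt_trans e0 _; near: y; exact: nbhs_right_gt.
- apply/cvg_ex; exists (- 0); apply: (@cvg_trans _ (- (a * y)^-1 @[y --> +oo])).
    apply: near_eq_cvg; apply: (filterS _ (nbhs_pinfty_gt (num_real (0 : R)))).
    by move=> y y0; rewrite dL1.
  apply: cvgN; apply/gtr0_cvgV0.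
    apply: (filterS _ (nbhs_pinfty_gt (num_real (0 : R)))) => y y0.
    exact: mulr_gt0.
  by apply: gt0_cvgMry => //; exact: cvg_id.
- split.
    move=> x; rewrite in_itv/= andbT => ex.
    by have [] := dL (lt_trans e0 ex).
  apply: cvg_at_right_filter; apply: differentiable_continuous.
  by apply/derivable1_diffP; have [] := dL e0.
- apply/cvgrNyPle => A; apply: (filterS _ (nbhs_pinfty_ge (num_real (expR (ln c - A * a))))).
  move=> x xA; have x0 : 0 < x by apply: lt_le_trans xA; exact: expR_gt0.
  by rewrite /L ler_pdivrMr// lerBlDr -lerBlDl -[X in X <= _]expRK ler_ln ?posrE ?expR_gt0.
- exact: continuous_subspaceT.
- by move=> x _.
Unshelve. all: by end_near. Qed.

(** The truncated identities pass to the limit on both sides by monotone convergence as the cut-off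
    1 / (n + 1) tends to 0. *)
Lemma ge0_log_substitution (G : R -> R) :
  continuous G -> (forall x, 0 <= G x) ->
  (\int[mu]_v (G v)%:E = \int[mu]_(t in `]0%R, +oo[) (G (L t) / (a * t))%:E)%E.
Proof.
move=> cG G0.
have mG : measurable_fun setT G by exact: continuous_measurable_fun.
pose e n : R := n.+1%:R^-1.
have e0 n : 0 < e n by rewrite invr_gt0.
have eT : \bigcup_n `]-oo, L (e n)]%classic = [set: R].
  apply/seteqP; split => // x _.
  (* Then N + 1 > exp(a x - ln c), which gives x <= L (e N). *)
  pose N := Num.truncn (expR (a * x - ln c)).
  exists N => //=; rewrite in_itv/= /L ler_pdivlMr// lnV ?posrE// opprK.
  rewrite -lerBlDl mulrC -[X in X <= _]expRK ler_ln ?posrE ?expR_gt0//.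
  by apply/ltW; exact: truncnS_gt.
have e0T : \bigcup_n `[e n, +oo[%classic = `]0%R, +oo[%classic.
  apply/seteqP; split => [x [n _]|x] /=; rewrite !in_itv/= !andbT.
    exact: lt_le_trans.
  move=> x0; exists (Num.truncn x^-1) => //=; rewrite in_itv/= andbT.
  by rewrite /e invf_ple ?posrE//; apply/ltW; exact: truncnS_gt.
have en : {homo e : n m / (n <= m)%N >-> m <= n}.
  by move=> n m nm; rewrite lef_pV2 ?posrE// ler_nat.
have h1 : (\int[mu]_(v in `]-oo, L (e n)]) (G v)%:E @[n --> \oo] --> \int[mu]_v (G v)%:E)%E.
  rewrite -[X in _ --> (\int[mu]_(v in X) _)%E]eT.
  apply: ge0_nondecreasing_set_cvg_integral => //.
  - apply/nondecreasing_seqP => n; apply/subsetPset => x /=; rewrite !in_itv/=.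
    move=> /le_trans; apply; rewrite /L ler_pM2r ?invr_gt0// lerD2l lerN2 ler_ln ?posrE//.
    exact: en.
  - by move=> n; apply/measurable_EFinP; exact: measurable_funTS.
  - by move=> n x _; rewrite lee_fin.
have mGL : measurable_fun (`]0, +oo[%classic : set R) (fun t => (G (L t) / (a * t))%:E).
  apply/measurable_EFinP; apply: open_continuous_measurable_fun; first exact: interval_open.
  move=> x; rewrite inE/= in_itv/= andbT => x0; apply: cvgM.
    apply: (@cvg_comp _ _ _ L G _ (nbhs (L x))); last exact: cG.
    apply: differentiable_continuous.
    by apply/derivable1_diffP; have [] := dL x0.
  apply: cvgV; first by rewrite mulf_neq0// gt_eqF.
  by apply: cvgM; [exact: cvg_cst|exact: cvg_id].
have h2 : (\int[mu]_(t in `[e n, +oo[) (G (L t) / (a * t))%:E @[n --> \oo] -->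
    \int[mu]_(t in `]0%R, +oo[) (G (L t) / (a * t))%:E)%E.
  rewrite -[X in _ --> (\int[mu]_(v in X) _)%E]e0T.
  apply: ge0_nondecreasing_set_cvg_integral => //.
  - apply/nondecreasing_seqP => n; apply/subsetPset => x /=; rewrite !in_itv/= !andbT.
    by apply: le_trans; exact: en.
  - move=> n; apply: measurable_funS mGL => //.
    by move=> x /=; rewrite !in_itv/= !andbT; exact: lt_le_trans.
  - move=> n x /=; rewrite in_itv/= andbT => ex; rewrite lee_fin divr_ge0// mulr_ge0//.
      exact: ltW.
    by apply: le_trans ex; exact: ltW.
rewrite (_ : (fun n => _) = (fun n => \int[mu]_(v in `]-oo, L (e n)]) (G v)%:E)%E) in h2.
  exact: (cvg_unique (@ereal_hausdorff R) h1 h2).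
by apply/funext => n; rewrite ge0_log_substitution_itv.
Qed.

Lemma log_substitution (G : R -> R) : continuous G ->
  (\int[mu]_v (G v)%:E = \int[mu]_(t in `]0%R, +oo[) (G (L t) / (a * t))%:E)%E.
Proof.
move=> cG; rewrite [LHS]integralE [RHS]integralE.
have cpos (H : R -> R) : continuous H -> continuous (fun x => Num.max (H x) 0).
  by move=> cH x; apply: continuous_max; [exact: cH|exact: cvg_cst].
have pos (H : R -> R) : continuous H ->
    (\int[mu]_v (Num.max (H v) 0)%:E =
     \int[mu]_(t in `]0%R, +oo[) (Num.max (H (L t) / (a * t)) 0)%:E)%E.
  move=> cH; rewrite ge0_log_substitution; [|exact: cpos|by move=> x; rewrite le_max lexx orbT].
  apply: eq_integral => t; rewrite inE/= in_itv/= andbT => t0.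
  by rewrite maxr_pMl ?mul0r// invr_ge0 mulr_ge0// ltW.
congr (_ - _)%E.
- transitivity (\int[mu]_v (Num.max (G v) 0)%:E)%E.
    by apply: eq_integral => x _; rewrite funeposE EFin_max.
  by rewrite pos//; apply: eq_integral => x _; rewrite funeposE EFin_max.
- transitivity (\int[mu]_v (Num.max (- G v) 0)%:E)%E.
    by apply: eq_integral => x _; rewrite funenegE EFin_max EFinN.
  rewrite (pos (fun v => - G v)); last by move=> x; apply: continuousN; exact: cG.
  by apply: eq_integral => x _; rewrite funenegE EFin_max mulNr EFinN.
Qed.

End LogSubstitution.

(** * The complex exponential *)

Section ComplexExponential.
Variable R : realType.
Local Notation Re := (@complex.Re R).
Local Notation Im := (@complex.Im R).
Implicit Types (x y z : R[i]).

Lemma cexpD x y : cexp (x + y) = cexp x * cexp y.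
Proof.
case: x y => [a b] [c d]; apply/eqP; rewrite eq_complex /= expRD cosD sinD.
by apply/andP; split; apply/eqP; ring.
Qed.

Lemma cexp_real (r : R) : cexp (r%:C%C) = (expR r)%:C%C.
Proof. by rewrite /cexp /= cos0 sin0 mulr1 mulr0. Qed.

Lemma cexp0 : cexp (0 : R[i]) = 1.
Proof. by rewrite (cexp_real 0) expR0. Qed.

Lemma cexp_sum (I : Type) (r : seq I) (P : pred I) (f : I -> R[i]) :
  cexp (\sum_(i <- r | P i) f i) = \prod_(i <- r | P i) cexp (f i).
Proof. exact: (big_morph _ cexpD cexp0). Qed.

Lemma normc_cexp z : normc (cexp z) = expR (Re z).
Proof.
rewrite /normc /= !exprMn -mulrDr cos2Dsin2 mulr1 sqrtr_sqr.
by rewrite ger0_norm// expR_ge0.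
Qed.

Lemma cexp_neq0 z : cexp z != 0.
Proof. by rewrite -normc_eq0 normc_cexp gt_eqF// expR_gt0. Qed.

Lemma Re_mulC z (r : R) : Re (z * r%:C%C) = Re z * r.
Proof. by case: z => a b /=; rewrite mulr0 subr0. Qed.

Lemma Im_mulC z (r : R) : Im (z * r%:C%C) = Im z * r.
Proof. by case: z => a b /=; rewrite mulr0 add0r. Qed.

End ComplexExponential.

(** * The local factors as Gamma integrals *)

Section GammaIntegral.
Variable R : realType.
Local Notation Re := (@complex.Re R).
Local Notation Im := (@complex.Im R).
Local Notation mu := (@lebesgue_measure R).
Variables (a c : R) (s : R[i]).
Hypotheses (a0 : 0 < a) (c0 : 0 < c) (s0 : 0 < Re s).

(* The factor of the integrand at a real prime for a = 2 and c = pi, at a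
   complex prime for a = 1 and c = 2 pi. *)
Definition gamma_kernel (v : R) : R[i] :=
  (expR (- c * expR (- a * v)))%:C%C * cexp (- s * v%:C%C).

Let g := gamma_kernel.

Lemma Re_gamma_kernel v : Re (g v) =
  expR (- c * expR (- a * v)) * (expR (- Re s * v) * cos (- Im s * v)).
Proof. by rewrite /g /gamma_kernel mulrC Re_mulC mulrC /cexp Re_mulC Im_mulC; case: s. Qed.

Lemma Im_gamma_kernel v : Im (g v) =
  expR (- c * expR (- a * v)) * (expR (- Re s * v) * sin (- Im s * v)).
Proof. by rewrite /g /gamma_kernel mulrC Im_mulC mulrC /cexp Re_mulC Im_mulC; case: s. Qed.

Lemma normc_gamma_kernel v : normc (g v) = expR (- c * expR (- a * v)) * expR (- Re s * v).
Proof.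
rewrite normcM normcC ger0_norm ?expR_ge0// normc_cexp Re_mulC.
by case: s.
Qed.

Let clin (k : R) : continuous ( *%R k).
Proof. by move=> x; apply: cvgM; [exact: cvg_cst|exact: cvg_id]. Qed.

Let cexpl (k : R) : continuous (fun v => expR (k * v)).
Proof. by move=> x; apply: continuous_comp; [exact: clin|exact: continuous_expR]. Qed.

Let cdexp : continuous (fun v => expR (- c * expR (- a * v))).
Proof. by move=> x; apply: (@continuous_comp _ _ _ (fun v => expR (- a * v)) (fun u => expR (- c * u))); exact: cexpl. Qed.

Lemma continuous_Re_gamma : continuous (Re \o g).
Proof.
rewrite (_ : _ \o _ = fun v => expR (- c * expR (- a * v)) * (expR (- Re s * v) * cos (- Im s * v))).
  move=> x; apply: cvgM; first exact: cdexp.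
  apply: cvgM; first exact: cexpl.
  by apply: (@continuous_comp _ _ _ ( *%R (- Im s)) cos); [exact: clin|exact: continuous_cos].
by apply/funext => v; exact: Re_gamma_kernel.
Qed.

Lemma continuous_Im_gamma : continuous (Im \o g).
Proof.
rewrite (_ : _ \o _ = fun v => expR (- c * expR (- a * v)) * (expR (- Re s * v) * sin (- Im s * v))).
  move=> x; apply: cvgM; first exact: cdexp.
  apply: cvgM; first exact: cexpl.
  by apply: (@continuous_comp _ _ _ ( *%R (- Im s)) sin); [exact: clin|exact: continuous_sin].
by apply/funext => v; exact: Im_gamma_kernel.
Qed.

Let sigma := Re s.

(** For v >= 0 the first exponential is at most 1, leaving e^(- sigma v); for v < 0 it decays doubly
    exponentially and beats e^((sigma + 1)|v|). Exponential densities serve as majorants because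
    their integrals are known. *)
Lemma gamma_kernel_bound : exists2 C : R, 0 <= C & forall v,
  normc (g v) <= sigma^-1 * exponential_pdf sigma v + C * exponential_pdf 1 (- v).
Proof.
(* The maximum over u = - v of (sigma + 1) u - c (a u)^2 / 4, where (a u)^2 / 4 is a lower bound for
   e^(a u) when u >= 0. *)
pose D := (sigma + 1) ^+ 2 / (c * a ^+ 2).
exists (expR D); first exact: expR_ge0.
move=> v; rewrite normc_gamma_kernel.
have p1 (r : R) u : 0 < r -> 0 <= exponential_pdf r u.
  by move=> r0; apply: exponential_pdf_ge0; exact: ltW.
have [v0|v0] := leP 0 v.
  apply: (@le_trans _ _ (sigma^-1 * exponential_pdf sigma v)); last first.
    by rewrite lerDl mulr_ge0 ?expR_ge0// p1.
  rewrite exponential_pdfE// mulrA mulVf ?gt_eqF// mul1r.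
  rewrite ler_piMl ?expR_ge0// -expR0 ler_expR mulNr oppr_le0 mulr_ge0 ?expR_ge0//.
  exact: ltW.
apply: (@le_trans _ _ (expR D * exponential_pdf 1 (- v))); last first.
  by rewrite lerDr mulr_ge0 ?p1// invr_ge0 ltW.
rewrite exponential_pdfE ?oppr_ge0 ?(ltW v0)// mul1r mulN1r opprK -!expRD ler_expR.
have av : 0 <= - a * v by rewrite mulNr -mulrN mulr_ge0 ?oppr_ge0 ?(ltW a0) ?(ltW v0).
have e2 : (- a * v) ^+ 2 / 4 <= expR (- a * v).
  have -> : expR (- a * v) = expR (- a * v / 2) ^+ 2.
    by rewrite -expRM_natr; congr expR; rewrite divfK.
  have := expR_ge1Dx (- a * v / 2); set y := expR _ => yv.
  have -> : (- a * v) ^+ 2 / 4 = (- a * v / 2) ^+ 2 by field.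
  rewrite ler_pXn2r// ?nnegrE ?divr_ge0//; last exact: expR_ge0.
  by apply: le_trans yv; rewrite lerDr.
have key : 0 <= c * ((- a * v) ^+ 2 / 4) - (sigma + 1) * (- v) + D.
  have -> : c * ((- a * v) ^+ 2 / 4) - (sigma + 1) * (- v) + D =
      (c * a ^+ 2)^-1 * ((c * a ^+ 2) * (- v) / 2 - (sigma + 1)) ^+ 2.
    by rewrite /D; field; rewrite !gt_eqF.
  by rewrite mulr_ge0 ?sqr_ge0// invr_ge0 mulr_ge0 ?sqr_ge0// ltW.
have := ler_wpM2l (ltW c0) e2; rewrite -/sigma; nra.
Qed.

Lemma integral_exponential_pdfN :
  (\int[mu]_v (exponential_pdf 1 (- v))%:E = 1)%E.
Proof.
rewrite -(@integral_exponential_pdf R 1)//.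
have mE : measurable_fun setT (EFin \o @exponential_pdf R 1).
  by apply/measurable_EFinP; exact: measurable_exponential_pdf.
have mN : measurable_fun setT (-%R : R -> measurableTypeR R) by by apply: continuous_measurable_fun => x; apply: cvgN; exact: cvg_id.
transitivity (\int[pushforward mu (-%R : R -> measurableTypeR R)]_v (exponential_pdf 1 v)%:E)%E.
  rewrite ge0_integral_pushforward//.
  by move=> y _; rewrite lee_fin exponential_pdf_ge0.
by apply: eq_measure_integral => //= A mA _; exact: lebesgue_measureN.
Qed.

Lemma cintegrable_gamma : cintegrable mu setT g.
Proof.
split.
- exact: (continuous_measurable_fun continuous_Re_gamma).
- exact: (continuous_measurable_fun continuous_Im_gamma).
have [C C0 gb] := gamma_kernel_bound.
have mE r : measurable_fun setT (EFin \o @exponential_pdf R r).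
  by apply/measurable_EFinP; exact: measurable_exponential_pdf.
have mEN : measurable_fun setT (fun v : R => (@exponential_pdf R 1 (- v))%:E).
  have mN : measurable_fun setT (fun v : R => - v).
    by apply: continuous_measurable_fun => x; apply: cvgN; exact: cvg_id.
  by apply/measurable_EFinP; exact: (measurableT_comp (measurable_exponential_pdf _) mN).
apply: (@le_lt_trans _ _ (\int[mu]_v ((sigma^-1)%:E * (exponential_pdf sigma v)%:E +
    C%:E * (exponential_pdf 1 (- v))%:E))%E).
  apply: ge0_le_integral => //.
  - by move=> v _; rewrite lee_fin normc_ge0.
  - apply/measurable_EFinP; apply: measurable_normc.
    + exact: (continuous_measurable_fun continuous_Re_gamma).
    + exact: (continuous_measurable_fun continuous_Im_gamma).
  - apply: emeasurable_funD; apply: measurable_funeM; [exact: mE|exact: mEN].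
  - by move=> v _; rewrite -!EFinM -EFinD lee_fin.
have pos r v : 0 < r -> (0 <= (exponential_pdf r v)%:E :> \bar R)%E.
  by move=> r0; rewrite lee_fin exponential_pdf_ge0// ltW.
have sV : (0 <= (sigma^-1)%:E)%E by rewrite lee_fin invr_ge0 ltW.
rewrite ge0_integralD//.
- have -> : (\int[mu]_v ((sigma^-1)%:E * (exponential_pdf sigma v)%:E) =
      (sigma^-1)%:E * \int[mu]_v (exponential_pdf sigma v)%:E)%E.
    by rewrite ge0_integralZl//; [exact: mE|move=> v _; exact: pos].
  have -> : (\int[mu]_v (C%:E * (exponential_pdf 1 (- v))%:E) =
      C%:E * \int[mu]_v (exponential_pdf 1 (- v))%:E)%E.
    by rewrite ge0_integralZl//; move=> v _; exact: pos.
  rewrite (integral_exponential_pdf s0) integral_exponential_pdfN !mule1.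
  by rewrite -EFinD ltry.
- by move=> v _; rewrite mule_ge0// pos.
- by apply: measurable_funeM; exact: mE.
- by move=> v _; rewrite mule_ge0// pos.
- by apply: measurable_funeM; exact: mEN.
Qed.

(** Under t = c exp(- a v), g(v) dv becomes K t^(z - 1) e^(- t) dt with z = s / a. The constant is
    divided out before substituting, because the substitution is stated for real functions: the real
    and imaginary parts of K^-1 g then correspond to those of the integrand of [cGamma]. *)
Lemma cintegral_gamma : cintegral mu setT g =
  (a^-1)%:C%C * cpow c (- (s / a%:C%C)) * cGamma (s / a%:C%C).
Proof.
set K := _%:C%C * cpow _ _; set z := s / a%:C%C.
have aC0 : a%:C%C != 0 :> R[i] by rewrite (inj_eq (@complexI R) a 0) gt_eqF.
have K0 : K != 0.
  by rewrite mulf_neq0 ?cexp_neq0// (inj_eq (@complexI R) _ 0) invr_eq0 gt_eqF.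
apply: (canRL (mulVKf K0)); rewrite -cintegralZ; last exact: cintegrable_gamma.
have sub t : 0 < t -> g ((ln c - ln t) / a) * ((a * t)^-1)%:C%C =
    K * (cpow t (z - 1) * (expR (- t))%:C%C).
  move=> t0; rewrite /g /gamma_kernel.
  have -> : - c * expR (- a * ((ln c - ln t) / a)) = - t.
    rewrite mulNr; congr (- _).
    have -> : - a * ((ln c - ln t) / a) = ln t - ln c by field; rewrite gt_eqF.
    by rewrite expRD expRN !lnK ?posrE// mulrCA mulfV ?mulr1// gt_eqF.
  have -> : - s * ((ln c - ln t) / a)%:C%C = - z * (ln c)%:C%C + z * (ln t)%:C%C.
    rewrite rmorphM rmorphB /= fmorphV /z; field.
    exact: aC0.
  have zt : cpow t (z - 1) = cexp (z * (ln t)%:C%C) * (t^-1)%:C%C.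
    rewrite /cpow mulrBl mul1r cexpD -rmorphN cexp_real expRN lnK//.
  rewrite cexpD zt /K /cpow invfM rmorphM /=; ring.
have cKG (p : R[i] -> R) : continuous (p \o (fun v => K^-1 * g v)) ->
    (forall x (r : R), p (x * r%:C%C) = p x * r) ->
    Rintegral mu setT (fun v => p (K^-1 * g v)) =
    Rintegral mu `]0%R, +oo[ (fun t => p (cpow t (z - 1) * (expR (- t))%:C%C)).
  move=> cp pM; congr fine; rewrite (log_substitution c a0 cp).
  apply: eq_integral => t; rewrite inE/= in_itv/= andbT => t0.
  congr (_%:E); rewrite /= -pM -mulrA sub//.
  by rewrite mulKf.
apply/eqP; rewrite eq_complex; apply/andP; split; apply/eqP; rewrite /cGamma /cintegral /=; [apply: (cKG Re)|apply: (cKG Im)].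
- rewrite (_ : _ \o _ = fun v => Re K^-1 * (Re \o g) v - Im K^-1 * (Im \o g) v).
    move=> x; apply: cvgB; (apply: cvgM; first exact: cvg_cst).
    + exact: continuous_Re_gamma.
    + exact: continuous_Im_gamma.
  by apply/funext => v; rewrite /= ReCM.
- exact: Re_mulC.
- rewrite (_ : _ \o _ = fun v => Re K^-1 * (Im \o g) v + Im K^-1 * (Re \o g) v).
    move=> x; apply: cvgD; (apply: cvgM; first exact: cvg_cst).
    + exact: continuous_Im_gamma.
    + exact: continuous_Re_gamma.
  by apply/funext => v; rewrite /= ImCM.
- exact: Im_mulC.
Qed.

End GammaIntegral.

(** * The integral over Div(F) *)

Section ZetaFormula.
Variables (R : realType) (F : fieldExtType rat) (r1 r2 : nat).
Variable S : infinitePrimes R F r1 r2.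
Local Notation Re := (@complex.Re R).
Local Notation Im := (@complex.Im R).
Implicit Types (x : findiv F) (D : arDiv R F r1 r2).

Lemma findiv_measurable (A : set (findiv F)) : measurable A.
Proof. by []. Qed.

(** The counting measure packaged with its sigma-finiteness, so that its product with
    [lebesgue_tuple] falls under Fubini's theorem. *)
Definition counting_findiv : {sigma_finite_measure set (findiv F) -> \bar R} :=
  HB.pack_for {sigma_finite_measure set (findiv F) -> \bar R} (@counting (findiv F) R)
    (Measure_isSigmaFinite.Build _ _ _ (@counting (findiv F) R)
      (sigma_finite_counting_countable R findiv_measurable (countable_findiv S))).

(** Multiplying by the inverse ideal, I contains O_F if and only if I^-1, the ideal of [D.1], is
    contained in O_F. *)
Lemma effectiveP D : (ringOfIntegers F `<=` divideal D) <-> effective D.1.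
Proof.
rewrite /divideal; split => [sub|De].
  apply: (sub_effective S); rewrite -(ideal_ofN S (- D.1)) opprK idealMC.
  rewrite -[X in X `<=` _](idealM1 (ideal_of_omodule D.1)) idealMC.
  exact: idealM_mono.
rewrite -(ideal_ofN S D.1) -[X in _ `<=` X](idealM1 (ideal_of_omodule (- D.1))).
exact: (idealM_mono (effective_sub S De) (fun _ => id)).
Qed.

Variable s : R[i].

Definition zeta_fin x : R[i] :=
  if x \in [set x : findiv F | effective x] then cexp (- s * (lognorm R x)%:C%C) else 0.

Definition zeta_inf (k : 'I_(r1 + r2)) : R -> R[i] :=
  match fintype.split k with
  | inl _ => gamma_kernel 2 pi s
  | inr _ => gamma_kernel 1 (2 * pi) s
  end.

Lemma divdegE D : divdeg D = lognorm R D.1 + \sum_(k < r1 + r2) (tnth D.2 k : R).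
Proof. by []. Qed.

Lemma zeta_integrandE D :
  zeta_integrand S s D = zeta_fin D.1 * \prod_k zeta_inf k (tnth D.2 k).
Proof.
rewrite /zeta_integrand /effectivity /zeta_fin.
have [De|De] := pselect (effective D.1); last first.
  rewrite asboolF; last by move/effectiveP.
  by rewrite memNset// !mul0r.
rewrite asboolT; last exact/effectiveP.
have cD (u w : R) : cexp (- s * (u + w)%:C%C) = cexp (- s * u%:C%C) * cexp (- s * w%:C%C).
  by rewrite rmorphD mulrDr cexpD.
rewrite mem_set// /cpow /divnorm expRK divdegE cD.
rewrite mulrCA; congr (_ * _).
have -> : - pi * sqnorm S D 1 =
    \sum_(i < r1) (- pi * expR (- 2 * tnth D.2 (lshift r2 i))) +
    \sum_(j < r2) (- (2 * pi) * expR (- 1 * tnth D.2 (rshift r1 j))).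
  rewrite /sqnorm mulrDr !mulr_sumr; congr (_ + _); apply: eq_bigr => i _.
    by rewrite rmorph1 normr1 expr1n mul1r.
  by rewrite rmorph1 normc1 expr1n mulr1 mulN1r mulrA mulNr [pi * 2]mulrC.
rewrite expRD !expR_sum rmorphM !rmorph_prod rmorph_sum mulr_sumr cexp_sum.
rewrite !big_split_ord /= mulrACA; congr (_ * _).
- rewrite -big_split; apply: eq_bigr => i _.
  by rewrite /zeta_inf -[lshift _ _]/(unsplit (inl i)) unsplitK.
- rewrite -big_split; apply: eq_bigr => i _.
  by rewrite /zeta_inf -[rshift _ _]/(unsplit (inr i)) unsplitK.
Qed.

Hypothesis s_gt1 : 1 < Re s.

Lemma csummable_effective :
  csummable [set x : findiv F | effective x] (fun x => cexp (- s * (lognorm R x)%:C%C)).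
Proof.
rewrite /csummable /summable; apply: le_lt_trans (esum_effective_norm S s_gt1).
apply: le_esum => x _; rewrite lee_fin normc_cexp Re_mulC ger0_norm ?expR_ge0//.
by case: (s).
Qed.

Lemma ideal_cpow x : effective x ->
  cpow (absnorm (ideal_of x))%:R (- s) = cexp (- s * (lognorm R x)%:C%C) :> R[i].
Proof. by move=> xe; rewrite /cpow (lognorm_effective S). Qed.

(** Stated for any [f], so that one reindexing serves for the modulus and for the positive and
    negative parts that make up [csum]. *)
Lemma esum_ideals (f : R[i] -> \bar R) :
  (\esum_(J in nonzero_ideals F) f (cpow (absnorm J)%:R (- s))%R =
   \esum_(x in [set x : findiv F | effective x]) f (cexp (- s * (lognorm R x)%:C%C))%R)%E.
Proof.
rewrite (reindex_esum _ _ _ _ (ideal_of_bij S)).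
by apply: eq_esum => x xe; rewrite ideal_cpow.
Qed.

Lemma csummable_ideals :
  csummable (nonzero_ideals F) (fun J => cpow (absnorm J)%:R (- s) : R[i]).
Proof.
rewrite /csummable /summable (esum_ideals (fun z => `|(normc z)%:E|%E)).
exact: csummable_effective.
Qed.

Lemma csum_ideals :
  csum (nonzero_ideals F) (fun J => cpow (absnorm J)%:R (- s)) =
  csum [set x : findiv F | effective x] (fun x => cexp (- s * (lognorm R x)%:C%C)).
Proof.
rewrite /csum /rsum.
rewrite (esum_ideals (fun z => (Num.max (Re z) 0)%:E)) (esum_ideals (fun z => (Num.max (- Re z) 0)%:E)).
by rewrite (esum_ideals (fun z => (Num.max (Im z) 0)%:E)) (esum_ideals (fun z => (Num.max (- Im z) 0)%:E)).
Qed.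

Lemma zeta_formula :
  cintegrable (dDiv R F r1 r2) setT (zeta_integrand S s) /\
  zetaF S s =
    (2^-1 * cpow pi (- (s / 2)) * cGamma (s / 2)) ^+ r1 *
    (cpow (2 * pi) (- s) * cGamma s) ^+ r2 *
    csum (nonzero_ideals F) (fun J => cpow (absnorm J)%:R (- s)).
Proof.
have s0 : 0 < Re s by exact: lt_trans s_gt1.
have pi0 := pi_gt0 R; have pi20 : 0 < 2 * pi :> R by rewrite mulr_gt0.
have gi k : cintegrable (@lebesgue_measure R) setT (zeta_inf k).
  by rewrite /zeta_inf; case: fintype.split => _; exact: cintegrable_gamma.
have [ti tE] := cintegral_tuple gi.
have [fi fE] := csum_cintegral findiv_measurable (countable_findiv S) csummable_effective.
have [zi zE] := @cintegral_prodM R _ _ _ _ counting_findiv (lebesgue_tuple R (r1 + r2)) _ _ fi ti.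
have intE : zeta_integrand S s =
    fun D : arDiv R F r1 r2 => zeta_fin D.1 * \prod_k zeta_inf k (tnth D.2 k).
  by apply/funext => D; exact: zeta_integrandE.
split; first by rewrite intE; exact: zi.
rewrite /zetaF intE; transitivity (csum (nonzero_ideals F)
    (fun J => cpow (absnorm J)%:R (- s) : R[i]) *
    \prod_k cintegral (@lebesgue_measure R) setT (zeta_inf k)).
  by rewrite csum_ideals -fE -tE; exact: zE.
rewrite mulrC; congr (_ * _); rewrite big_split_ord /=; congr (_ * _).
- rewrite -[in RHS](card_ord r1) -prodr_const; apply: eq_bigr => i _.
  rewrite /zeta_inf -[lshift _ _]/(unsplit (inl i)) unsplitK cintegral_gamma//.
  by rewrite fmorphV /= (rmorph_nat (real_complex R) 2).
- rewrite -[in RHS](card_ord r2) -prodr_const; apply: eq_bigr => i _.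
  rewrite /zeta_inf -[rshift _ _]/(unsplit (inr i)) unsplitK cintegral_gamma//.
  by rewrite invr1 rmorph1 mul1r divr1.
Qed.

End ZetaFormula.

(** * The integral over Pic(F) *)

Section EsumLemmas.
Variable R : realType.

(** For k > 0 the inequality [<=], applied to k^-1 and the scaled family, gives its own converse. *)
Lemma esumZl (T : choiceType) (A : set T) (k : R) (a : T -> \bar R) :
  0 <= k -> (forall i, (0 <= a i)%E) ->
  (\esum_(i in A) (k%:E * a i) = k%:E * \esum_(i in A) a i)%E.
Proof.
move=> k0 a0.
have le (r : R) (b : T -> \bar R) : 0 <= r -> (forall i, (0 <= b i)%E) ->
    (\esum_(i in A) (r%:E * b i) <= r%:E * \esum_(i in A) b i)%E.
  move=> r0 b0; apply: ge_ereal_sup => _ [X [finX XA] <-].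
  rewrite fsbig_finite//= -ge0_sume_distrr//; apply: lee_wpmul2l; first by rewrite lee_fin.
  by apply: ereal_sup_ubound; exists X => //; rewrite fsbig_finite.
apply/eqP; rewrite eq_le le//=.
have [->|kn0] := eqVneq k 0.
  by rewrite mul0e; apply: esum_ge0 => i _; rewrite mul0e.
have kV : 0 <= k^-1 by rewrite invr_ge0.
have k0' : (0 <= k%:E)%E by rewrite lee_fin.
have := le k^-1 (fun i => k%:E * a i)%E kV (fun i => mule_ge0 k0' (a0 i)).
under eq_esum do rewrite muleA -EFinM mulVf// mul1e.
move=> H; apply: le_trans (lee_wpmul2l _ H) _; first by rewrite lee_fin.
by rewrite muleA -EFinM divff// mul1e.
Qed.

Lemma esum_cst_finite (T : choiceType) (A : set T) (k : R) : finite_set A -> 0 <= k ->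
  (\esum_(i in A) k%:E = (#|` fset_set A|%:R * k)%:E)%E.
Proof.
move=> finA k0; rewrite esum_fset//= fsbig_finite//= sumEFin.
by rewrite big_const_seq count_predT iter_addr_0 mulr_natl.
Qed.

Lemma measurable_esum_countable (T : choiceType) d (X : measurableType d)
    (a : T -> X -> \bar R) : countable [set: T] ->
  (forall t x, (0 <= a t x)%E) -> (forall t, measurable_fun setT (a t)) ->
  measurable_fun setT (fun x => \esum_(t in setT) a t x)%E.
Proof.
move=> /countable_injP[g gi] a0 ma.
pose A n := [set t | g t = n].
have AT : [set: T] = \bigcup_n A n by apply/seteqP; split => // x _; exists (g x).
have tA : trivIset setT A.
  by apply/trivIsetP => i j _ _ /eqP ij; apply/seteqP; split => // x [xi xj]; apply: ij; rewrite -xi -xj.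
rewrite [X in measurable_fun _ X](_ : _ =
    (fun x => \sum_(0 <= n <oo) \esum_(t in A n) a t x)%E); last first.
  apply/funext => x; rewrite AT esum_bigcupT// nneseries_esumT// => n.
  exact: esum_ge0.
apply: ge0_emeasurable_sum => [n x _ _|n _]; first exact: esum_ge0.
have [[t At]|/set0P/negP/negPn/eqP ->] := pselect (A n !=set0); last first.
  by under eq_fun do rewrite esum_set0; exact: measurable_cst.
have -> : A n = [set t].
  apply/seteqP; split => [y Ay|_ ->//] /=.
  by apply: gi; rewrite ?inE//; rewrite Ay At.
by under eq_fun do rewrite esum_set1//; exact: ma.
Qed.

End EsumLemmas.

(** * Translation by principal divisors *)

Section PicardGroup.
Variables (R : realType) (F : fieldExtType rat) (r1 r2 : nat).
Variable S : infinitePrimes R F r1 r2.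
Local Notation Re := (@complex.Re R).
Local Notation Im := (@complex.Im R).
Local Notation OF := (ringOfIntegers F).
Implicit Types (D : arDiv R F r1 r2) (f g : F).

Definition twist D f : arDiv R F r1 r2 := divD D (princ S f).

Lemma atReal_twist D f i : atReal (twist D f) i = atReal D i - ln `|realEmb S i f|.
Proof.
by rewrite /atReal /= !tnth_mktuple -[lshift _ _]/(unsplit (inl i)) unsplitK.
Qed.

Lemma atCplx_twist D f j : atCplx (twist D f) j = atCplx D j - 2 * ln (normc (cplxEmb S j f)).
Proof.
by rewrite /atCplx /= !tnth_mktuple -[rshift _ _]/(unsplit (inr j)) unsplitK.
Qed.

Lemma absembE f : absemb S f =
  (\prod_i `|realEmb S i f|) * \prod_j normc (cplxEmb S j f) ^+ 2.
Proof.
rewrite /absemb /emb_index big_sumType /= big_sumType /=; congr (_ * _).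
  by apply: eq_bigr => i _; rewrite -[LHS]/(normc (realEmb S i f)%:C%C) normcC.
rewrite -big_split; apply: eq_bigr => j _.
by rewrite -[LHS]/(normc (cplxEmb S j f) * normc (conjc (cplxEmb S j f))) normc_conj expr2.
Qed.

(** The finite part gains ln |N(f)| by [ords_frac]; the infinite part loses it, the factor 2 at
    complex primes accounting for the pair of conjugate embeddings. *)
Lemma divdeg_twist D f : f != 0 -> divdeg (twist D f) = divdeg D.
Proof.
move=> f0; rewrite !divdegE /= lognormD.
have [_ ->] := ords_frac S f0.
under eq_bigr do rewrite tnth_mktuple.
rewrite big_split /= addrACA -[RHS]addr0; congr (_ + _).
rewrite big_split_ord /=.
have -> : \sum_(i < r1) (tnth (princ S f).2 (lshift r2 i) : R) = - \sum_(i < r1) ln `|realEmb S i f|.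
  rewrite -sumrN; apply: eq_bigr => i _.
  by rewrite tnth_mktuple -[lshift _ _]/(unsplit (inl i)) unsplitK.
have -> : \sum_(j < r2) (tnth (princ S f).2 (rshift r1 j) : R) =
    - \sum_(j < r2) ln (normc (cplxEmb S j f) ^+ 2).
  rewrite -sumrN; apply: eq_bigr => j _.
  rewrite tnth_mktuple -[rshift _ _]/(unsplit (inr j)) unsplitK lnXn ?mulr_natl//.
  by rewrite normc_gt0 fmorph_eq0.
have lnprod (I : finType) (h : I -> R) : (forall i, 0 < h i) ->
    \sum_i ln (h i) = ln (\prod_i h i).
  move=> h0; suff [] : 0 < \prod_i h i /\ \sum_i ln (h i) = ln (\prod_i h i) by [].
  apply: (big_ind2 (fun x y : R => 0 < y /\ x = ln y)) => [|x y z t [y0 ->] [t0 ->]|i _] //.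
  - by rewrite ln1.
  - by rewrite lnM ?posrE// mulr_gt0.
have i0 i : 0 < `|realEmb S i f| by rewrite normr_gt0 fmorph_eq0.
have j0 j : 0 < normc (cplxEmb S j f) ^+ 2 by rewrite exprn_gt0// normc_gt0 fmorph_eq0.
rewrite !lnprod// -opprD -lnM ?posrE ?prodr_gt0//.
by rewrite absembE addrN.
Qed.

Lemma divnorm_twist D f : f != 0 -> divnorm (twist D f) = divnorm D.
Proof. by move=> f0; rewrite /divnorm divdeg_twist. Qed.

Lemma sqnorm_twist D f g : f != 0 -> sqnorm S (twist D f) g = sqnorm S D (f * g).
Proof.
move=> f0; rewrite /sqnorm; congr (_ + _); apply: eq_bigr => i _.
- have p : 0 < `|realEmb S i f| by rewrite normr_gt0 fmorph_eq0.
  rewrite atReal_twist rmorphM normrM exprMn mulrBr expRD !mulNr opprK.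
  have -> : expR (2 * ln `|realEmb S i f|) = `|realEmb S i f| ^+ 2.
    by rewrite mulr_natl -lnXn// lnK// posrE exprn_gt0.
  by ring.
- have p : 0 < normc (cplxEmb S i f) by rewrite normc_gt0 fmorph_eq0.
  rewrite atCplx_twist rmorphM normcM exprMn opprB expRD.
  have -> : expR (2 * ln (normc (cplxEmb S i f))) = normc (cplxEmb S i f) ^+ 2.
    by rewrite mulr_natl -lnXn// lnK// posrE exprn_gt0.
  by ring.
Qed.

Lemma ords1 : ords (1 : F) = 0.
Proof. by have [_ ->] := unit_moduli1 S. Qed.

Lemma ordsV f : f != 0 -> ords f^-1 = - ords f.
Proof.
move=> f0; apply/eqP; rewrite -addr_eq0 -(ordsM S) ?invr_eq0// mulVf//.
by rewrite ords1.
Qed.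

Lemma divideal_omodule D : omodule (divideal D).
Proof. exact: ideal_of_omodule. Qed.

(** Adding (f) multiplies the ideal by f^-1, as the ideal of a divisor has the opposite
    exponents. *)
Lemma divideal_twist D f g : f != 0 -> divideal (twist D f) g <-> divideal D (f * g).
Proof.
move=> f0; rewrite /divideal /= opprD (ideal_ofD S) -ordsV// (ideal_of_ords S) ?invr_eq0//.
have [A0 AD AM] := divideal_omodule D; split.
  apply: (@idealM_sub _ _ _ [set g | divideal D (f * g)]) => /=.
  - by rewrite mulr0.
  - by move=> x y; rewrite mulrDr; exact: AD.
  - move=> x _ Ax [a aO <-] /=.
    have -> : f * (x * (f^-1 * a)) = a * x by field.
    exact: AM.
move=> Afg; rewrite -(mulKf f0 g) mulrC; apply: idealM_mem => //.
exact: principal_mem.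
Qed.

(** The term f = 0 is left out; it is the 1 subtracted in k^0 - 1. *)
Definition theta_term D f : R :=
  if (f != 0) && `[< divideal D f >] then expR (- pi * sqnorm S D f) else 0.

Lemma theta_term_ge0 D f : 0 <= theta_term D f.
Proof. by rewrite /theta_term; case: ifP => // _; exact: expR_ge0. Qed.

Lemma effectivity_twist D f : f != 0 -> effectivity S (twist D f) = theta_term D f.
Proof.
move=> f0; rewrite /effectivity /theta_term f0 /= sqnorm_twist// mulr1.
have iff : (OF `<=` divideal (twist D f)) <-> divideal D f.
  split=> [/(_ 1 (OF1 F))|Df x xO].
    by move/(divideal_twist D 1 f0); rewrite mulr1.
  apply/divideal_twist => //; rewrite mulrC.
  by have [_ _] := divideal_omodule D; apply.
by rewrite (asbool_equiv_eq iff).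
Qed.

Definition theta_sum D : \bar R := (\esum_(f in [set: F]) (theta_term D f)%:E)%E.

Lemma theta_sum_ge0 D : (0 <= theta_sum D)%E.
Proof. by apply: esum_ge0 => f _; rewrite lee_fin theta_term_ge0. Qed.

(** Since [fine] sends +oo to 0, this identifies k^0 - 1 with the theta sum only where the latter is
    finite. *)
Lemma k0E D : k0 S D = fine (1%:E + theta_sum D)%E.
Proof.
rewrite /k0; congr fine.
have I0 : divideal D 0 by case: (divideal_omodule D).
rewrite (esumID [set 0])//.
congr (_ + _)%E.
  have -> : divideal D `&` [set 0] = [set 0].
    by apply/seteqP; split => [x []//|x /= ->].
  rewrite esum_set1 ?lee_fin ?expR_ge0//.
  suff -> : sqnorm S D 0 = 0 by rewrite mulr0 expR0.
  rewrite /sqnorm big1 => [|i _]; last by rewrite rmorph0 normr0 expr0n mul0r.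
  rewrite big1 ?addr0// => i _.
  by rewrite rmorph0 /normc ComplexField.Normc.normc0 expr0n mulr0 mul0r.
rewrite /theta_sum esum_mkcond; apply: eq_esum => f _.
rewrite /theta_term; have [If|If] := pselect (divideal D f); last first.
  rewrite asboolF// andbF memNset//; by case.
rewrite asboolT// andbT; case: eqVneq => [->|f0].
  by rewrite memNset//= => -[_]; exact.
by rewrite mem_set//; split => //; exact/eqP.
Qed.

Lemma theta_sum_twist D f : f != 0 -> theta_sum (twist D f) = theta_sum D.
Proof.
move=> f0; rewrite /theta_sum [RHS](reindex_esum [set: F] _ ( *%R f)); last first.
  split=> // [x y _ _|x _]; first exact: mulfI.
  by exists (f^-1 * x) => //; rewrite mulVKf.
apply: eq_esum => g _; rewrite /theta_term mulf_eq0 negb_or f0 /=.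
by rewrite (asbool_equiv_eq (divideal_twist D g f0)) sqnorm_twist.
Qed.

Lemma twistM D f g : f != 0 -> g != 0 -> twist (twist D f) g = twist D (f * g).
Proof.
move=> f0 g0; rewrite /twist /divD /=; congr (_, _); first by rewrite (ordsM S)// addrA.
apply: eq_from_tnth => k; rewrite !tnth_mktuple -addrA; congr (_ + _).
case: (fintype.split k) => i; rewrite rmorphM.
- by rewrite normrM lnM ?opprD// posrE normr_gt0 fmorph_eq0.
- by rewrite normcM lnM ?mulrDr ?opprD// posrE normc_gt0 fmorph_eq0.
Qed.

Lemma twist_root_of_unity D f : @roots_of_unity F f -> twist D f = D.
Proof.
rewrite -(unit_moduliE S) => -[f0 fo fm]; rewrite /twist /divD /= fo addr0.
case: D => x v /=; congr (_, _); apply: eq_from_tnth => k; rewrite !tnth_mktuple.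
case: (fintype.split k) => i.
- have := fm (inl i); rewrite -[normc _]/(normc (realEmb S i f)%:C%C) normcC => ->.
  by rewrite ln1 subr0.
- have := fm (inr (inl i)); rewrite -[normc _]/(normc (cplxEmb S i f)) => ->.
  by rewrite ln1 mulr0 subr0.
Qed.

Lemma twist1 D : twist D 1 = D.
Proof. by apply: twist_root_of_unity; exists 1%N => //; rewrite expr1n. Qed.

Lemma twist_inj D f g : f != 0 -> g != 0 -> twist D f = twist D g -> @roots_of_unity F (f / g).
Proof.
move=> f0 g0 fg; rewrite -(unit_moduliE S).
have fgo : ords f = ords g by have := congr1 fst fg => /= /addrI.
have fgk k := congr1 (fun D : arDiv R F r1 r2 => tnth D.2 k : R) fg.
have div1 (t : emb_index r1 r2) : normc (emb S t f) = normc (emb S t g) -> normc (emb S t (f / g)) = 1.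
  move=> e; apply: (mulIf (_ : normc (emb S t g) != 0)).
    by rewrite normc_eq0 fmorph_eq0.
  by rewrite -normcM -rmorphM divfK// mul1r.
have cpx j : normc (cplxEmb S j f) = normc (cplxEmb S j g).
  have := fgk (rshift r1 j); rewrite /= !tnth_mktuple -[rshift _ _]/(unsplit (inr j)) unsplitK.
  have n2 : (2 : R) != 0 by rewrite pnatr_eq0.
  move=> /addrI /oppr_inj /(mulfI n2).
  by apply: ln_inj; rewrite posrE normc_gt0 fmorph_eq0.
split; first by rewrite mulf_neq0 ?invr_eq0.
  by rewrite (ordsM S) ?invr_eq0// ordsV// fgo subrr.
case=> [i|[j|j]]; apply: div1.
- rewrite -![normc _]/(normc (realEmb S i _)%:C%C) !normcC.
  have := fgk (lshift r2 i); rewrite /= !tnth_mktuple -[lshift _ _]/(unsplit (inl i)) unsplitK.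
  move=> /addrI /oppr_inj.
  by apply: ln_inj; rewrite posrE normr_gt0 fmorph_eq0.
- exact: cpx.
- by rewrite -![normc _]/(normc (conjc (cplxEmb S j _))) !normc_conj.
Qed.

Local Notation w := (num_roots_of_unity F).

(* f |-> D + (f) is w-to-one onto the coset: its fibres are the cosets of the roots of unity. *)
Lemma esum_princ_coset D (phi : arDiv R F r1 r2 -> R) : (forall D', 0 <= phi D') ->
  (\esum_(D' in princ_coset S D) (w%:R * phi D')%:E =
   \esum_(f in [set f : F | f != 0%R]) (phi (twist D f))%:E)%E.
Proof.
move=> phi0; pose J D' := [set f : F | f != 0 /\ twist D f = D'].
have bij : set_bij [set f : F | f != 0] (princ_coset S D `*`` J) (fun f => (twist D f, f)).
  split=> [f /= f0|f g _ _ []//|[D' f] /= [_ [f0 fD]]].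
    by split; [exists f|].
  by exists f; rewrite ?fD.
rewrite -[RHS](reindex_esum _ _ _ (fun k => (phi k.1)%:E) bij).
rewrite -(@esum_esum _ _ _ (princ_coset S D) J (fun D' _ => (phi D')%:E)); last by move=> *; rewrite lee_fin.
apply: eq_esum => _ [f0 f00 <-]; rewrite -/(twist D f0).
have bijf : set_bij (@roots_of_unity F) (J (twist D f0)) ( *%R f0).
  split=> [z zu|z z' _ _|f [fn0 ff0]] /=.
  - have [z0 _ _] : unit_moduli S z by rewrite unit_moduliE.
    by split; rewrite ?mulf_neq0// -twistM// twist_root_of_unity.
  - exact: mulfI.
  - exists (f / f0); first exact: (twist_inj fn0 f00 ff0).
    by rewrite mulrC divfK.
rewrite (reindex_esum _ _ _ _ bijf) esum_cst_finite//.
exact: (finite_roots_of_unity S).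
Qed.

(** The chosen representative is a twist of any divisor that defines the class, and by [twistM]
    twisting does not change the coset. *)
Lemma val_picE (c : Pic S) : val c = princ_coset S (pic_repr c).
Proof.
have /asboolP[D cD] := valP c.
have [f f0 fD] : princ_coset S D (pic_repr c).
  rewrite -cD /pic_repr; case: xgetP => [//|/(_ D)]; rewrite cD; case.
  by exists 1; [exact: oner_neq0|exact: twist1].
rewrite cD -fD -/(twist D f); apply/seteqP; split => _ [g g0 <-].
- exists (f^-1 * g); first by rewrite /= mulf_neq0 ?invr_eq0.
  by rewrite -/(twist _ _) -/(twist _ _) twistM ?mulf_neq0 ?invr_eq0// mulVKf.
- exists (f * g); first by rewrite /= mulf_neq0.
  by rewrite -/(twist _ _) -/(twist _ _) twistM.
Qed.

Lemma pic_repr_class D : exists2 f, f != 0 & pic_repr (pic_class S D) = twist D f.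
Proof.
have : val (pic_class S D) (pic_repr (pic_class S D)).
  by rewrite val_picE; exists 1; [exact: oner_neq0|exact: twist1].
by move=> [f f0 <-]; exists f.
Qed.

(** The sigma-algebra of Pic(F) is the quotient one, so measurability is tested on Div(F). *)
Lemma measurable_fun_pic d' (U : measurableType d') (h : Pic S -> U) :
  measurable_fun setT (h \o pic_class S) -> measurable_fun setT h.
Proof.
move=> mh _ B mB; rewrite setTI.
by have := mh measurableT B mB; rewrite setTI.
Qed.

Lemma measurable_divdeg : measurable_fun setT (@divdeg R F r1 r2).
Proof.
apply: (@measurable_funD _ _ _ _ (fun D => lognorm R D.1) (fun D => \sum_(k < r1 + r2) (tnth D.2 k : R))).
  apply: (@measurableT_comp _ _ _ _ _ _ (@lognorm R F)) => //.
apply: measurable_sum => k.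
by apply: (@measurableT_comp _ _ _ _ _ _ (fun v : (r1 + r2).-tuple (measurableTypeR R) => tnth v k)) => //; exact: measurable_tnth.
Qed.

Lemma measurable_theta_term f : measurable_fun setT (theta_term ^~ f).
Proof.
pose u (x : findiv F) : R := if (f != 0) && `[< ideal_of (- x) f >] then 1 else 0.
pose v (t : (r1 + r2).-tuple (measurableTypeR R)) : R := expR (- pi *
  (\sum_(i < r1) `|realEmb S i f| ^+ 2 * expR (- 2 * tnth t (lshift r2 i)) +
   \sum_(j < r2) 2 * normc (cplxEmb S j f) ^+ 2 * expR (- tnth t (rshift r1 j)))).
rewrite (_ : _ ^~ f = fun D => u D.1 * v D.2); last first.
  apply/funext => D; rewrite /theta_term /u -/(divideal D).
  by case: ifP => _; rewrite ?mul1r ?mul0r.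
have mt k : measurable_fun setT (fun t : (r1 + r2).-tuple (measurableTypeR R) => tnth t k : R).
  exact: measurable_tnth.
apply: measurable_funM.
  by apply: (@measurableT_comp _ _ _ _ _ _ u).
apply: (@measurableT_comp _ _ _ _ _ _ v) => //.
apply: measurableT_comp; first exact: measurable_expR.
apply: measurable_funM => //; apply: measurable_funD; apply: measurable_sum => i;
  apply: measurable_funM => //; apply: measurableT_comp => //.
- exact: measurable_funM.
- exact: measurable_funN.
Qed.

End PicardGroup.

(** * Weil's formula and the integral over Pic(F) *)

Section PicIntegral.
Variables (R : realType) (F : fieldExtType rat) (r1 r2 : nat).
Variable S : infinitePrimes R F r1 r2.
Local Notation Re := (@complex.Re R).
Local Notation Im := (@complex.Im R).
Local Notation w := (num_roots_of_unity F).
Local Notation dDiv := (dDiv R F r1 r2).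
Variable s : R[i].
Hypothesis s_gt1 : 1 < Re s.
Implicit Types (D : arDiv R F r1 r2) (c : Pic S).

Definition pic_theta c : \bar R := theta_sum S (pic_repr c).
Definition pic_pow c : R[i] := cpow (pic_norm c) (- s).

Lemma measurable_theta_sum : measurable_fun setT (@theta_sum _ _ _ _ S).
Proof.
apply: measurable_esum_countable => [|f D|f].
- exact: (countable_field S).
- by rewrite lee_fin theta_term_ge0.
- by apply/measurable_EFinP; exact: measurable_theta_term.
Qed.

Lemma measurable_pic_theta : measurable_fun setT pic_theta.
Proof.
apply: measurable_fun_pic; rewrite (_ : _ \o _ = @theta_sum _ _ _ _ S).
  exact: measurable_theta_sum.
apply/funext => D /=; rewrite /pic_theta.
by have [f f0 ->] := pic_repr_class S D; rewrite theta_sum_twist.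
Qed.

Lemma pic_pow_class D : pic_pow (pic_class S D) = cexp (- s * (divdeg D)%:C%C).
Proof.
rewrite /pic_pow /pic_norm /cpow.
have [f f0 ->] := pic_repr_class S D.
by rewrite divnorm_twist// /divnorm expRK.
Qed.

Lemma normc_pic_pow_gt0 c : 0 < normc (pic_pow c).
Proof. by rewrite /pic_pow /cpow normc_cexp expR_gt0. Qed.

Lemma measurable_pic_pow : measurable_fun setT (fun c => Re (pic_pow c)) /\
  measurable_fun setT (fun c => Im (pic_pow c)).
Proof.
have mlin (k : R) : measurable_fun setT (fun D => k * divdeg D).
  by apply: measurable_funM => //; exact: measurable_divdeg.
have mE (k : R) : measurable_fun setT (fun D => expR (k * divdeg D)).
  by apply: measurableT_comp => //; exact: measurable_expR.
split; apply: measurable_fun_pic.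
- rewrite (_ : _ \o _ = fun D => expR (Re (- s) * divdeg D) * cos (Im (- s) * divdeg D)).
    apply: measurable_funM => //; apply: measurableT_comp => //.
    by apply: continuous_measurable_fun => x; exact: continuous_cos.
  by apply/funext => D; rewrite /comp pic_pow_class /cexp Re_mulC Im_mulC.
- rewrite (_ : _ \o _ = fun D => expR (Re (- s) * divdeg D) * sin (Im (- s) * divdeg D)).
    apply: measurable_funM => //; apply: measurableT_comp => //.
    by apply: continuous_measurable_fun => x; exact: continuous_sin.
  by apply/funext => D; rewrite /comp pic_pow_class /cexp Re_mulC Im_mulC.
Qed.

Lemma measurable_pic_integrand :
  measurable_fun setT (fun c => Re (pic_integrand S s c)) /\
  measurable_fun setT (fun c => Im (pic_integrand S s c)).
Proof.
have mk : measurable_fun setT (fun c => pic_k0 c - 1).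
  apply: measurable_funB => //.
  rewrite (_ : @pic_k0 _ _ _ _ S = fun c => fine (1%:E + pic_theta c)%E); last first.
    by apply/funext => c; rewrite /pic_k0 k0E.
  apply: measurableT_comp; first exact: fine_measurable.
  by apply: emeasurable_funD => //; exact: measurable_pic_theta.
have [mR mI] := measurable_pic_pow; split.
- rewrite (_ : (fun c => _) = fun c => (pic_k0 c - 1) * Re (pic_pow c)).
    exact: measurable_funM.
  by apply/funext => c; rewrite ReCM /= mul0r subr0.
- rewrite (_ : (fun c => _) = fun c => (pic_k0 c - 1) * Im (pic_pow c)).
    exact: measurable_funM.
  by apply/funext => c; rewrite ImCM /= mul0r addr0.
Qed.

Variable mu : {measure set (Pic S) -> \bar R}.
Hypothesis mu_quot : is_quotient_measure mu.

Section Functional.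
Variable q : R[i] -> R.
Hypothesis q_ge0 : forall z, 0 <= q z.
Hypothesis qZ : forall (e : R) z, 0 <= e -> q (e%:C%C * z) = e * q z.
Hypothesis mq : forall d (T : measurableType d) (f : T -> R[i]),
  measurable_fun setT (fun x => Re (f x)) -> measurable_fun setT (fun x => Im (f x)) ->
  measurable_fun setT (fun x => q (f x)).

Lemma measurable_zeta_functional : measurable_fun setT (fun D => q (zeta_integrand S s D)).
Proof. by have [[mR mI _] _] := zeta_formula S s_gt1; exact: mq. Qed.

(** Homogeneity of [q] lets the real factor e(D) out, while N(D)^(- s) is constant on a coset; [w]
    turns the sum over the coset into a sum over nonzero [f], and the effectivities add up to the
    theta sum. *)
Lemma weil_functional :
  (w%:R%:E * \int[dDiv]_D (q (zeta_integrand S s D))%:E =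
   \int[mu]_c ((q (pic_pow c))%:E * pic_theta c))%E.
Proof.
have mz := measurable_zeta_functional.
rewrite -ge0_integralZl//; last 2 first.
- by apply/measurable_EFinP.
- by move=> D _; rewrite lee_fin.
rewrite mu_quot; last 2 first.
- by move=> D; rewrite mule_ge0// lee_fin.
- by apply: measurable_funeM; apply/measurable_EFinP.
apply: eq_integral => c _; rewrite val_picE.
under eq_esum do rewrite -EFinM.
rewrite (esum_princ_coset S (pic_repr c) (phi := fun D => q (zeta_integrand S s D)))//.
rewrite /pic_theta /theta_sum -esumZl//; last by move=> f; rewrite lee_fin theta_term_ge0.
rewrite esum_mkcond; apply: eq_esum => f _.
have [->|f0] := eqVneq f 0.
  by rewrite memNset//=; [rewrite /theta_term eqxx mule0|rewrite eqxx].
rewrite mem_set// /zeta_integrand effectivity_twist// divnorm_twist//.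
by rewrite qZ ?theta_term_ge0// EFinM muleC.
Qed.

(** Where the theta sum is finite it equals the factor k^0 - 1, so this integrand and that of
    [weil_functional] agree almost everywhere. *)
Lemma pic_functional : {ae mu, forall c, pic_theta c \is a fin_num} ->
  (\int[mu]_c (q (pic_integrand S s c))%:E =
   w%:R%:E * \int[dDiv]_D (q (zeta_integrand S s D))%:E)%E.
Proof.
move=> fin; rewrite weil_functional; apply: ge0_ae_eq_integral => //.
- by apply/measurable_EFinP; have [mR mI] := measurable_pic_integrand; exact: mq.
- apply: emeasurable_funM; last exact: measurable_pic_theta.
  by apply/measurable_EFinP; have [mR mI] := measurable_pic_pow; exact: mq.
- by move=> c _; rewrite lee_fin.
- by move=> c _; rewrite mule_ge0 ?lee_fin// theta_sum_ge0.
- apply: filterS fin => c fin _.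
  have theta0 : 0 <= fine (pic_theta c) by rewrite fine_ge0// theta_sum_ge0.
  have -> : pic_integrand S s c = (fine (pic_theta c))%:C%C * pic_pow c.
    rewrite /pic_integrand /pic_k0 k0E -/(pic_theta c) fineD// /=.
    by rewrite addrAC subrr add0r.
  by rewrite qZ// EFinM fineK// muleC.
Qed.

End Functional.

Lemma zeta_normc_lt : (\int[dDiv]_D (normc (zeta_integrand S s D))%:E < +oo)%E.
Proof. by have [[]] := zeta_formula S s_gt1. Qed.

Lemma normcZ (e : R) (z : R[i]) : 0 <= e -> normc (e%:C%C * z) = e * normc z.
Proof. by move=> e0; rewrite normcM normcC ger0_norm. Qed.

(** By Weil's formula for the modulus, |N^(- s)| times the theta sum has a finite integral, and
    |N^(- s)| is positive. *)
Lemma pic_theta_fin : {ae mu, forall c, pic_theta c \is a fin_num}.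
Proof.
have mpow : measurable_fun setT (fun c => normc (pic_pow c)).
  by have [mR mI] := measurable_pic_pow; exact: measurable_normc.
have nn c : (0 <= (normc (pic_pow c))%:E * pic_theta c)%E.
  by rewrite mule_ge0 ?lee_fin ?normc_ge0// theta_sum_ge0.
have int : mu.-integrable setT (fun c => ((normc (pic_pow c))%:E * pic_theta c)%E).
  apply/integrableP; split.
    by apply: emeasurable_funM; [exact/measurable_EFinP|exact: measurable_pic_theta].
  under eq_integral do rewrite gee0_abs//.
  rewrite -weil_functional.
  - by rewrite lte_mul_pinfty// ?lee_fin// zeta_normc_lt.
  - by move=> z; exact: normc_ge0.
  - exact: normcZ.
  - by move=> d T f; exact: measurable_normc.
have := integrable_ae measurableT int; apply: filterS => c /(_ I).
have : (0 <= pic_theta c)%E by exact: theta_sum_ge0.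
case: (pic_theta c) => // _.
by rewrite mulry gtr0_sg ?normc_pic_pow_gt0// mul1e.
Qed.

(** Used for the real and the imaginary part. The functional max(t h, 0) is nonnegative and
    positively homogeneous; t = 1 and t = -1 give the positive and negative parts, and integrability
    on Div(F) allows them to be subtracted. *)
Lemma pic_Rintegral (h : R[i] -> R) :
  (forall (e : R) z, h (e%:C%C * z) = e * h z) ->
  (forall d (T : measurableType d) (f : T -> R[i]),
    measurable_fun setT (fun x => Re (f x)) -> measurable_fun setT (fun x => Im (f x)) ->
    measurable_fun setT (fun x => h (f x))) ->
  dDiv.-integrable setT (EFin \o (h \o zeta_integrand S s)) ->
  Rintegral mu setT (fun c => h (pic_integrand S s c)) =
  w%:R * Rintegral dDiv setT (fun D => h (zeta_integrand S s D)).
Proof.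
move=> hZ mh hi.
have pos (t : R) : forall (e : R) z, 0 <= e ->
    Num.max (t * h (e%:C%C * z)) 0 = e * Num.max (t * h z) 0.
  by move=> e z e0; rewrite hZ mulrCA maxr_pMr// mulr0.
have part (t : R) := @pic_functional (fun z => Num.max (t * h z) 0)
  (fun z => ltac:(by rewrite le_max lexx orbT)) (pos t).
have mpart (t : R) d (T : measurableType d) (f : T -> R[i]) :
    measurable_fun setT (fun x => Re (f x)) -> measurable_fun setT (fun x => Im (f x)) ->
    measurable_fun setT (fun x => Num.max (t * h (f x)) 0).
  by move=> mR mI; apply: measurable_maxr => //; apply: measurable_funM => //; exact: mh.
have split d (T : measurableType d) (m : {measure set T -> \bar R}) (f : T -> R) :
    (\int[m]_x (f x)%:E = \int[m]_x (Num.max (1 * f x) 0)%:E -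
                          \int[m]_x (Num.max (-1 * f x) 0)%:E)%E.
  rewrite integralE; congr (_ - _)%E; apply: eq_integral => x _.
  - by rewrite funeposE mul1r -EFin_max.
  - by rewrite funenegE mulN1r -EFin_max.
rewrite /Rintegral split !part//; try exact: pic_theta_fin; try exact: mpart.
rewrite -muleBr//; last first.
  apply: fin_num_adde_defr; rewrite (_ : (\int[_]_x _)%E = (\int[dDiv]_x (EFin \o (h \o zeta_integrand S s))^\+ x)%E).
    exact: integrable_pos_fin_num.
  by apply: eq_integral => D _; rewrite funeposE mul1r -EFin_max.
by rewrite -split fineM//; exact: integrable_fin_num.
Qed.

Lemma zeta_pic : cintegrable mu setT (pic_integrand S s) /\
  zetaF S s = w%:R^-1 * cintegral mu setT (pic_integrand S s).
Proof.
have [zi _] := zeta_formula S s_gt1.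
have [mR mI] := measurable_pic_integrand.
split; first split => //.
  rewrite (pic_functional (@normc_ge0 R) normcZ)//; last exact: pic_theta_fin.
  - by rewrite lte_mul_pinfty// ?lee_fin// zeta_normc_lt.
  - by move=> d T f; exact: measurable_normc.
have w0 : (w%:R : R) != 0 by rewrite pnatr_eq0 -lt0n (num_roots_of_unity_gt0 S).
have -> : cintegral mu setT (pic_integrand S s) = w%:R%:C%C * zetaF S s.
  apply/eqP; rewrite eq_complex ReCM ImCM /= !mul0r subr0 addr0; apply/andP; split; apply/eqP.
  - apply: (pic_Rintegral (h := Re)) => //.
    + by move=> e z; rewrite ReCM /= mul0r subr0.
    + exact: cintegrable_Re.
  - apply: (pic_Rintegral (h := Im)) => //.
    + by move=> e z; rewrite ImCM /= mul0r addr0.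
    + exact: cintegrable_Im.
by rewrite rmorph_nat mulKf// -(rmorph_nat (real_complex R)) fmorph_eq0.
Qed.

End PicIntegral.

Theorem mainTheorem6 (R : realType) (F : fieldExtType rat) (r1 r2 : nat)
    (S : infinitePrimes R F r1 r2) (s : R[i]) (hs : 1 < complex.Re s) :
  cintegrable (dDiv R F r1 r2) setT (zeta_integrand S s) /\
  csummable (nonzero_ideals F)
    (fun J => cpow (absnorm J)%:R (- s) : R[i]) /\
  zetaF S s =
    (2^-1 * cpow pi (- (s / 2)) * cGamma (s / 2)) ^+ r1 *
    (cpow (2 * pi) (- s) * cGamma s) ^+ r2 *
    csum (nonzero_ideals F) (fun J => cpow (absnorm J)%:R (- s)) /\
  (forall mu : {measure set (Pic S) -> \bar R}, is_quotient_measure mu ->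
    cintegrable mu setT (pic_integrand S s) /\
    zetaF S s =
      ((num_roots_of_unity F)%:R)^-1 * cintegral mu setT (pic_integrand S s)).
Proof.
have [zi zE] := zeta_formula S hs.
split=> //; split; first exact: (csummable_ideals S hs).
by split=> // mu mu_quot; exact: zeta_pic.
Qed.
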